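(* Let $m\ne 0,1$ be a square-free integer and $K=\mathbb{Q}(\sqrt{m})$. Then there exists an elliptic curve $E/K$ with everywhere good reduction over $K$ and rational $j$-invariant if and only if there exist a good integer $D$ and an integer $q$ with $m = qD$ such that: (a) $\left(\frac{-\epsilon_D q}{p}\right)=1$ for every (odd) prime $p$ dividing $D$; (b) $\left(\frac{\epsilon_D D}{\ell}\right)=1$ for every (odd) prime $\ell$ dividing $q$; (c) $m>0$ if $\epsilon_D D<0$; (d) if $D\equiv \pm 3 \pmod 8$ then $q\equiv D \pmod 4$; (e) if $D$ is even then $q \equiv D+1 \pmod 8$.
   Context: Let $\mathcal{R}=\{A\in\mathbb{Z} : \text{if } 2\mid A \text{ then } 16\mid A \text{ or } 16\mid A-4;\ \text{if } 3\mid A \text{ then } 27\mid A-12\}$. A square-free integer $D$ is called good if there exist $A\in\mathcal{R}$ and $t\in\mathbb{Z}$ with $Dt^2 = A^3-1728$. For good $D$, set $\epsilon_D = 1$ if $D\equiv 1 \pmod 4$ and $\epsilon_D=-1$ otherwise. $\left(\frac{a}{p}\right)$ denotes the Legendre symbol. An elliptic curve $E/K$ has everywhere good reduction if it has good reduction at every prime of $\mathcal{O}_K$. *)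

(* Defs.v *)
From HB Require Import structures.
From mathcomp Require Import all_boot all_order all_algebra all_field.
Set Implicit Arguments. Unset Strict Implicit. Unset Printing Implicit Defensive.
Import Order.TTheory GRing.Theory Num.Theory.
Local Open Scope ring_scope.

Definition squarefree (z : int) : Prop :=
  z != 0 /\ forall p : nat, prime p -> ~~ (p * p %| `|z|)%N.

Definition legendre (a : int) (p : nat) : int :=
  if (p%:Z %| a)%Z then 0
  else if [exists x : 'I_p, (p%:Z %| (x%:Z ^+ 2 - a))%Z] then 1 else -1.

Definition inR (A : int) : Prop :=
  ((2 %| A)%Z -> (16 %| A)%Z \/ (16 %| A - 4)%Z) /\
  ((3 %| A)%Z -> (27 %| A - 12)%Z).

Definition good (D : int) : Prop :=
  squarefree D /\ exists A t : int, inR A /\ D * t ^+ 2 = A ^+ 3 - 1728.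

Definition eps (D : int) : int := if (D %% 4)%Z == 1 then 1 else -1.

Definition inK (m : int) (x : algC) : Prop :=
  exists a b : rat, x = ratr a + ratr b * sqrtC (m%:~R).

Definition inOK (m : int) (x : algC) : Prop := inK m x /\ x \in Aint.

Definition prime_ideal (m : int) (P : algC -> Prop) : Prop :=
  (forall x, P x -> inOK m x) /\
  P 0 /\
  (forall x y, P x -> P y -> P (x + y)) /\
  (forall a x, inOK m a -> P x -> P (a * x)) /\
  ~ P 1 /\
  (forall x y, inOK m x -> inOK m y -> P (x * y) -> P x \/ P y) /\
  (exists x, P x /\ x != 0).

Definition inOP (m : int) (P : algC -> Prop) (x : algC) : Prop :=
  inK m x /\ exists y, inOK m y /\ ~ P y /\ inOK m (y * x).

Definition unitOP (m : int) (P : algC -> Prop) (x : algC) : Prop :=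
  inOP m P x /\ exists z, inOP m P z /\ x * z = 1.

Record wcurve := WCurve { a1 : algC; a2 : algC; a3 : algC; a4 : algC; a6 : algC }.

Definition b2 (E : wcurve) := a1 E ^+ 2 + 4 * a2 E.
Definition b4 (E : wcurve) := 2 * a4 E + a1 E * a3 E.
Definition b6 (E : wcurve) := a3 E ^+ 2 + 4 * a6 E.
Definition b8 (E : wcurve) :=
  a1 E ^+ 2 * a6 E + 4 * a2 E * a6 E - a1 E * a3 E * a4 E
  + a2 E * a3 E ^+ 2 - a4 E ^+ 2.
Definition disc (E : wcurve) :=
  - b2 E ^+ 2 * b8 E - 8 * b4 E ^+ 3 - 27 * b6 E ^+ 2 + 9 * b2 E * b4 E * b6 E.
Definition c4 (E : wcurve) := b2 E ^+ 2 - 24 * b4 E.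

Definition over_K (m : int) (E : wcurve) : Prop :=
  [/\ inK m (a1 E), inK m (a2 E), inK m (a3 E), inK m (a4 E) & inK m (a6 E)].

Definition elliptic_over (m : int) (E : wcurve) : Prop :=
  over_K m E /\ disc E != 0.

Definition rational_j (E : wcurve) : Prop :=
  exists j : rat, c4 E ^+ 3 = ratr j * disc E.

(* E' is obtained from E by the change of variables
   x = u^2 x' + r, y = u^3 y' + s u^2 x' + t  (Silverman, Table 3.1) *)
Definition change (E E' : wcurve) (u r s t : algC) : Prop :=
  [/\ u * a1 E' = a1 E + 2 * s,
      u ^+ 2 * a2 E' = a2 E - s * a1 E + 3 * r - s ^+ 2,
      u ^+ 3 * a3 E' = a3 E + r * a1 E + 2 * t,
      u ^+ 4 * a4 E' = a4 E - s * a3 E + 2 * r * a2 E - (t + r * s) * a1 E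
                       + 3 * r ^+ 2 - 2 * s * t &
      u ^+ 6 * a6 E' = a6 E + r * a4 E + r ^+ 2 * a2 E + r ^+ 3 - t * a3 E
                       - t ^+ 2 - r * t * a1 E].

Definition K_isomorphic (m : int) (E E' : wcurve) : Prop :=
  exists u r s t : algC, [/\ inK m u, u != 0, inK m r, inK m s & inK m t] /\
                         change E E' u r s t.

Definition good_reduction_at (m : int) (E : wcurve) (P : algC -> Prop) : Prop :=
  exists E', K_isomorphic m E E' /\
    [/\ inOP m P (a1 E'), inOP m P (a2 E'), inOP m P (a3 E'), inOP m P (a4 E')
        & inOP m P (a6 E')] /\ unitOP m P (disc E').

Definition everywhere_good (m : int) (E : wcurve) : Prop :=
  forall P, prime_ideal m P -> good_reduction_at m E P.

(* Main.v *)
(* A curve with good reduction at P has discriminant a 12th power times a unit at P. Hence the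
   norm of the discriminant is a rational 12th power up to sign, j = c4^3 / disc is the cube of an
   integer A, and A^3 - 1728 = D t^2 gives w in K with c4 = A D w^2, c6 = t D^2 w^3 and
   disc = D^3 w^6; moreover D times the norm of w is +n^2 or -n^2. A local study at 2 and 3 puts A
   in R, identifies the sign with eps D and yields (d) and (e); the equation for the norm of w is a
   conic D x^2 - q y^2 = eps z^2, whose solvability gives (a), (b) and (c). Conversely, Legendre's
   theorem solves this conic, hence gives a primitive integer w of K whose norm is eps D times a
   square. The curve with covariants A D w^2 and t D^2 w^3, where w may have to be multiplied by -1,
   2 or -2, then has an explicit model with good reduction at each prime. *)

Require Import Defs.
From HB Require Import structures.
From mathcomp Require Import all_boot all_order all_algebra all_field.
From Stdlib Require Import Classical.
From mathcomp Require Import zify ring.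
Import Order.TTheory GRing.Theory Num.Theory.
Local Open Scope ring_scope.
Set Implicit Arguments.
Unset Strict Implicit.
Unset Printing Implicit Defensive.

(** [K] may have class number greater than 1, so a global minimal model need not exist. Local
    information is therefore passed to rational numbers through the norm, or cleared of denominators
    prime to one residue characteristic. The identity [c4^3 - c6^2 = 1728 disc] governs the rest.
    With [j = A^3] it gives [c6^2 = (A^3 - 1728) disc], so [D] is the class of [j - 1728] modulo
    rational squares, and [w = c6 / (t D delta)] with the cube root [delta = c4 / A] of [disc]. That
    [j] is a cube comes from [N(c4)^3 = j^2 N(disc)]. At 2 the key fact is that [c6] of a good model
    is -1 or 8 times a square modulo 4, except in one ramified case that forces [D] to be even;
    comparison with [N(c6)], which is the sign times [D] times a square, fixes the sign. In the
    converse the norm condition leaves a rational factor of [w] free. The factors -1, 2 and -2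
    disturb no odd prime, and for odd [D] they suffice to make [w] a prescribed sign times a square
    modulo 4. *)

(** * Rational numbers with an integral power *)

Lemma intrX (R : pzRingType) (z : int) (n : nat) : (z ^+ n)%:~R = z%:~R ^+ n :> R.
Proof. by rewrite rmorphXn. Qed.

Lemma ratr_algC_inj (r s : rat) : ratr r = ratr s :> algC -> r = s.
Proof. by move/fmorph_inj. Qed.

Lemma squarefree_sqr (m z y : int) : squarefree m -> m = z ^+ 2 * y -> `|z|%N = 1%N.
Proof.
case=> m0 sm Em; apply/eqP; case: (ltngtP `|z|%N 1) => //.
- by rewrite ltnS leqn0 absz_eq0 => /eqP z0; move: m0; rewrite Em z0 expr0n mul0r.
- move=> z1; have /negP[] := sm _ (pdiv_prime z1).
  by rewrite Em abszM abszX dvdn_mulr // -mulnn dvdn_mul // pdiv_dvd.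
Qed.

(** The square of the denominator of [r] divides the squarefree [m]. *)
Lemma rat_sqr_mul_int (m z : int) (r : rat) :
  squarefree m -> r ^+ 2 * m%:~R = z%:~R -> exists w : int, r = w%:~R.
Proof.
move=> sm; rewrite -{1}[r]divq_num_den expr_div_n => E.
have d0 : (denq r)%:~R != 0 :> rat by rewrite intr_eq0 denq_eq0.
have {}E : numq r ^+ 2 * m = z * denq r ^+ 2.
  apply: (@intr_inj rat); rewrite [LHS]intrM [RHS]intrM !intrX -E.
  by field.
have dm : (denq r ^+ 2 %| m)%Z.
  have : (denq r ^+ 2 %| numq r ^+ 2 * m)%Z by rewrite E dvdz_mull.
  rewrite Gauss_dvdzr // coprimezE !abszX coprime_pexpl // coprime_pexpr //.
  by rewrite coprime_sym coprime_num_den.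
have [y Ey] := dvdzP dm; exists (numq r).
have d1 : `|denq r|%N = 1%N by apply: (squarefree_sqr (y := y) sm); rewrite mulrC.
have {d1}d1 : denq r = 1 by have := denq_gt0 r; lia.
by rewrite -[LHS]divq_num_den d1 divr1.
Qed.

Lemma rat_int_exp (n : nat) (z : int) (r : rat) :
  (0 < n)%N -> r ^+ n = z%:~R -> exists w : int, r = w%:~R.
Proof.
move=> n0; rewrite -{1}[r]divq_num_den expr_div_n => E.
have d0 : (denq r)%:~R != 0 :> rat by rewrite intr_eq0 denq_eq0.
have {}E : numq r ^+ n = z * denq r ^+ n.
  have dn := expf_neq0 n d0.
  apply: (@intr_inj rat); rewrite intrM !intrX -E.
  by field.
have d1 : (`|denq r| %| 1)%N.
  have cop : coprime (`|denq r|) (`|numq r| ^ n).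
    by rewrite coprime_pexpr // coprime_sym coprime_num_den.
  rewrite -(Gauss_dvdr _ cop) muln1 -abszX E abszM abszX.
  by rewrite dvdn_mull // dvdn_exp.
exists (numq r); have := denq_gt0 r; move: d1; rewrite dvdn1 => d1 dg.
have {d1 dg}d1 : denq r = 1 by lia.
by rewrite -[LHS]divq_num_den d1 divr1.
Qed.

Lemma absz_sqr (x : int) : (`|x| ^ 2)%N = x ^+ 2 :> int.
Proof. by rewrite -[RHS]gez0_abs ?sqr_ge0 // abszX. Qed.

(** * The conjugation of the quadratic field *)

Notation sq m := (sqrtC (m%:~R : algC)).

Lemma sq2 (m : int) : sq m ^+ 2 = m%:~R.
Proof. exact: sqrtCK. Qed.

Lemma sq_indep (m : int) (a b : rat) : squarefree m -> m != 1 ->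
  ratr a + ratr b * sq m = 0 -> a = 0 /\ b = 0.
Proof.
move=> sm m1 E; have [b0|b0] := eqVneq b 0.
  by move: E; rewrite b0 rmorph0 mul0r addr0 => /eqP; rewrite fmorph_eq0 => /eqP ->.
have E2 : (a / b) ^+ 2 = m%:~R.
  apply: ratr_algC_inj.
  rewrite rmorphXn fmorph_div /= ratr_int -(sq2 m).
  have bC : (ratr b : algC) != 0 by rewrite fmorph_eq0.
  have -> : ratr a = - (ratr b * sq m) by apply/eqP; rewrite -addr_eq0 E.
  by rewrite mulNr mulrAC divff // mul1r sqrrN.
have [w Ew] : exists w : int, a / b = w%:~R by apply: (@rat_int_exp 2 m).
move: E2; rewrite Ew -intrX => /intr_inj Em.
have w1 : `|w|%N = 1%N by apply: (squarefree_sqr (y := 1) sm); rewrite mulr1.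
case/eqP: m1; rewrite -Em; lia.
Qed.

(** The conjugation is built on the number field generated by [sq m] and then extended to algC. The
    minimal polynomial is not computed: its remainder modulo [X^2 - m] vanishes at [sq m], hence is
    zero by [sq_indep], so [- sq m] is a root as well. *)
Lemma sq_conjugation (m : int) : squarefree m -> m != 1 ->
  exists nu : {rmorphism algC -> algC}, nu (sq m) = - sq m.
Proof.
move=> sm m1.
have [Qn [QnC [[|zn []] // [Dz]]] genQn] := num_field_exists [:: sq m].
pose phi := kHomExtend 1 \1 zn (- zn).
have homQn1 : kHom 1 1 (\1%VF : 'End(Qn)) by rewrite kHom1.
have pzn : root (map_poly \1%VF (minPoly 1 zn)) (- zn).
  rewrite -(fmorph_root QnC) rmorphN /= Dz -map_poly_comp.
  rewrite (@eq_map_poly _ _ _ QnC) => [|a]; last by rewrite /= id_lfunE.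
  set p1 := map_poly _ _.
  have [q1 Dp1] : exists q1, p1 = map_poly ratr q1.
    have aP i : (minPoly 1 zn)`_i \in 1%VS.
      by apply/polyOverP; apply: minPolyOver.
    have {aP}a_ i := sig_eqW (vlineP _ _ (aP i)).
    exists (\poly_(i < size (minPoly 1 zn)) sval (a_ i)).
    apply/polyP=> i; rewrite coef_poly coef_map coef_poly /=.
    case: ifP => _; rewrite ?rmorph0 //; case: (a_ i) => a /= ->.
    by rewrite alg_num_field fmorph_rat.
  have : root p1 (sq m) by rewrite -Dz fmorph_root root_minPoly.
  pose s : {poly rat} := 'X^2 - (m%:~R)%:P.
  have ss : size s = 3%N.
    by rewrite size_polyDl ?size_polyXn // size_polyN ltnS (leq_trans (size_polyC_leq1 _)).
  have s0 : s != 0 by rewrite -size_poly_eq0 ss.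
  have r2 : (size (q1 %% s)%R <= 2)%N by rewrite -ltnS -ss ltn_modp.
  have rE : (q1 %% s)%R = ((q1 %% s)`_0)%:P + ((q1 %% s)`_1) *: 'X.
    apply/polyP=> -[|[|i]]; rewrite coefD coefC coefZ coefX /= ?mulr0 ?mulr1 ?addr0 ?add0r //.
    by rewrite nth_default // (leq_trans r2).
  have sr z : z ^+ 2 = m%:~R -> (map_poly ratr s).[z] = 0 :> algC.
    move=> z2; rewrite rmorphB /= map_polyXn map_polyC /= ratr_int.
    by rewrite !hornerE z2 subrr.
  have ev z : z ^+ 2 = m%:~R ->
      p1.[z] = ratr (q1 %% s)`_0 + ratr (q1 %% s)`_1 * z :> algC.
    move=> z2; rewrite Dp1 {1}(divp_eq q1 s) rmorphD rmorphM /= hornerD hornerM sr //.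
    rewrite mulr0 add0r {1}rE rmorphD /= map_polyC /= map_polyZ map_polyX.
    by rewrite !hornerE.
  rewrite !rootE ev ?sq2 // => /eqP/(sq_indep sm m1)[a0 b0].
  by rewrite ev ?sqrrN ?sq2 // a0 b0 rmorph0 mul0r addr0.
have phim : monoid_morphism phi.
  by apply/kHom_monoid_morphism; rewrite -genQn span_seq1 /= kHomExtendP.
pose phimM := GRing.isMonoidMorphism.Build _ _ phi phim.
pose phiRM : {rmorphism _ -> _} := HB.pack (fun_of_lfun phi) phimM.
have [nu Dnu] := extend_algC_subfield_aut QnC phiRM.
by exists nu; rewrite -Dz -Dnu /= /phi (kHomExtend_val homQn1) // rmorphN.
Qed.

(* cj is an automorphism of all of algC extending the conjugation of K, so that it preserves
   algebraic integers. *)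
Record quadfield (m : int) := QuadField {
  cj :> {rmorphism algC -> algC};
  cj_sq : cj (sq m) = - sq m;
  qf_sqf : squarefree m;
  qf_neq1 : m != 1 }.

Lemma quadfield_exists (m : int) :
  squarefree m -> m != 1 -> exists F : quadfield m, True.
Proof.
by move=> sm m1; have [nu Enu] := sq_conjugation sm m1; exists (QuadField Enu sm m1).
Qed.


(** * The field K and its ring of integers *)

Section FieldK.
Context {m : int}.
Local Notation K := (inK m).
Local Notation O := (inOK m).

Lemma inK_rat (a : rat) : K (ratr a).
Proof. by exists a, 0; rewrite rmorph0 mul0r addr0. Qed.

Lemma inK_int (a : int) : K a%:~R.
Proof. by rewrite -ratr_int; apply: inK_rat. Qed.

Lemma inK_nat (n : nat) : K n%:R.
Proof. exact: inK_int n. Qed.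

Lemma inK0 : K 0. Proof. exact: inK_nat 0. Qed.
Lemma inK1 : K 1. Proof. exact: inK_nat 1. Qed.

Lemma inK_sq : K (sq m).
Proof. by exists 0, 1; rewrite rmorph0 rmorph1 mul1r add0r. Qed.

Lemma inKD x y : K x -> K y -> K (x + y).
Proof.
move=> [a [b ->]] [c [d ->]]; exists (a + c), (b + d).
by rewrite !rmorphD /=; ring.
Qed.

Lemma inKN x : K x -> K (- x).
Proof. by move=> [a [b ->]]; exists (- a), (- b); rewrite !rmorphN /=; ring. Qed.

Lemma inKB x y : K x -> K y -> K (x - y).
Proof. by move=> Kx Ky; apply: inKD => //; apply: inKN. Qed.

Lemma inKM x y : K x -> K y -> K (x * y).
Proof.
move=> [a [b ->]] [c [d ->]]; exists (a * c + b * d * m%:~R), (a * d + b * c).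
rewrite !(rmorphD, rmorphM) /= ratr_int; ring: (sq2 m).
Qed.

Lemma inKX x n : K x -> K (x ^+ n).
Proof. by move=> Kx; elim: n => [|n IH]; [exact: inK1 | rewrite exprS; apply: inKM]. Qed.

Lemma inKV x : K x -> K x^-1.
Proof.
move=> [a [b Ex]]; have [->|x0] := eqVneq x 0; first by rewrite invr0; exact: inK0.
have [E|y0] := eqVneq (ratr a - ratr b * sq m) 0.
  have {E}E : ratr a = ratr b * sq m by apply/eqP; rewrite -subr_eq0 E.
  have m0 : sq m != 0 by apply: contraNneq x0 => m0; rewrite Ex E m0 mulr0 addr0.
  have b0 : ratr b != 0 :> algC by apply: contraNneq x0 => b0; rewrite Ex E b0 !mul0r addr0.
  have -> : x^-1 = ratr (2 * b * m%:~R)^-1 * sq m.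
    rewrite fmorphV !rmorphM /= rmorph_nat ratr_int Ex E.
    move: (sq2 m) m0; move: (sq m) => s <- s0; field.
    by rewrite -mulr2n s0 b0 mulrn_eq0 /= mulf_neq0.
  by apply: inKM; [exact: inK_rat | exact: inK_sq].
have -> : x^-1 = (ratr a + ratr (- b) * sq m) * ratr (a ^+ 2 - m%:~R * b ^+ 2)^-1.
  have EN : ratr (a ^+ 2 - m%:~R * b ^+ 2) = x * (ratr a - ratr b * sq m).
    by rewrite Ex; ring: (sq2 m).
  by rewrite fmorphV /= EN rmorphN mulNr; field; rewrite x0 y0.
by apply: inKM; [exists a, (- b) | exact: inK_rat].
Qed.

Lemma inK_div x y : K x -> K y -> K (x / y).
Proof. by move=> Kx Ky; apply: inKM => //; apply: inKV. Qed.

Lemma inO_K x : O x -> K x. Proof. by case. Qed.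

Lemma inOD x y : O x -> O y -> O (x + y).
Proof. by move=> [? ?] [? ?]; split; [apply: inKD | apply: rpredD]. Qed.

Lemma inON x : O x -> O (- x).
Proof. by move=> [? ?]; split; [apply: inKN | rewrite rpredN]. Qed.

Lemma inOB x y : O x -> O y -> O (x - y).
Proof. by move=> Ox Oy; apply: inOD => //; apply: inON. Qed.

Lemma inOM x y : O x -> O y -> O (x * y).
Proof. by move=> [? ?] [? ?]; split; [apply: inKM | apply: rpredM]. Qed.

Lemma inO_int (a : int) : O a%:~R.
Proof. by split; [apply: inK_int | apply: Aint_int]. Qed.

Lemma inO_nat (n : nat) : O n%:R.
Proof. exact: inO_int n. Qed.

Lemma inO0 : O 0. Proof. exact: inO_nat 0. Qed.
Lemma inO1 : O 1. Proof. exact: inO_nat 1. Qed.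

Lemma inOX x n : O x -> O (x ^+ n).
Proof. by move=> Ox; elim: n => [|n IH]; [exact: inO1 | rewrite exprS; apply: inOM]. Qed.

Lemma inO_rat (r : rat) : O (ratr r) -> exists z : int, r = z%:~R.
Proof.
move=> [_ Ar].
have /intrP[z Ez] := Cint_rat_Aint (Crat_rat r) Ar.
exists z; apply: ratr_algC_inj.
by rewrite /= ratr_int.
Qed.

(* om generates the ring of integers over Z and is a root of X^2 - tau X + nu. *)
Definition tau : int := if (m %% 4)%Z == 1 then 1 else 0.
Definition nu : int := if (m %% 4)%Z == 1 then ((1 - m) %/ 4)%Z else - m.
Definition om : algC := if (m %% 4)%Z == 1 then (1 + sq m) / 2 else sq m.

Lemma tau_nu_cases :
  [/\ (m %% 4)%Z = 1, tau = 1, 4 * nu = 1 - m & om = (1 + sq m) / 2] \/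
  [/\ (m %% 4)%Z <> 1, tau = 0, nu = - m & om = sq m].
Proof.
rewrite /tau /nu /om; case: eqP => E; [left | right]; split=> //.
have /divzK : (4 %| 1 - m)%Z by lia.
by lia.
Qed.

Lemma om_mod4_neq1 : (m %% 4)%Z <> 1 -> tau = 0 /\ nu = - m /\ om = sq m.
Proof. by case: tau_nu_cases => -[]. Qed.

Lemma om_sqr : om ^+ 2 = tau%:~R * om - nu%:~R.
Proof.
case: tau_nu_cases => -[_ Et En Eo]; rewrite Et.
  have {}En : 4 * (nu%:~R : algC) = 1 - m%:~R.
    by rewrite -[1](@mulr1z algC) -intrB -En intrM.
  have -> : nu%:~R = (1 - m%:~R) / 4 :> algC by rewrite -En; field.
  by rewrite Eo; field: (sq2 m).
by rewrite Eo sq2 En; ring.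
Qed.

Lemma inO_om : O om.
Proof.
split.
  case: tau_nu_cases => -[_ _ _ ->]; last exact: inK_sq.
  rewrite mulrC; apply: inKM; last by apply: inKD; [exact: inK1 | exact: inK_sq].
  have -> : (2^-1 : algC) = ratr 2^-1 by rewrite fmorphV rmorph_nat.
  exact: inK_rat.
have pz : root ('X^2 - tau%:~R *: 'X + (nu%:~R)%:P : {poly algC}) om.
  by rewrite rootE !hornerE om_sqr; apply/eqP; ring.
apply: (root_monic_Aint pz).
  apply/monicP; rewrite -addrA lead_coefDl ?lead_coefXn // size_polyXn.
  rewrite (leq_ltn_trans (size_polyD _ _)) // gtn_max size_polyN.
  rewrite (leq_ltn_trans (size_scale_leq _ _)) ?size_polyX //=.
  exact: leq_ltn_trans (size_polyC_leq1 _) _.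
apply/polyOverP=> i; rewrite !(coefD, coefN, coefZ, coefC, coefX, coefXn).
have aux (a : int) (b : bool) : (if b then a%:~R else 0 : algC) \is a Num.int.
  by case: b; rewrite ?intr_int ?rpred0.
by rewrite rpredD ?aux // rpredB ?rpred_nat // rpredM ?intr_int ?rpred_nat.
Qed.

Lemma inO_sq : O (sq m).
Proof.
case: tau_nu_cases inO_om => -[_ _ _ ->] // Oom.
have -> : sq m = 2 * ((1 + sq m) / 2) - 1 by field.
by apply: inOB; [apply: inOM => //; exact: inO_nat | exact: inO1].
Qed.

Lemma inO_mk (a b : int) : O (a%:~R + b%:~R * om).
Proof.
by apply: inOD; [|apply: inOM; [|exact: inO_om]]; exact: inO_int.
Qed.

End FieldK.
Arguments tau m : clear implicits.
Arguments nu m : clear implicits.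
Arguments om m : clear implicits.
Arguments tau_nu_cases m : clear implicits.
Arguments om_mod4_neq1 m : clear implicits.
Arguments om_sqr m : clear implicits.


(** * Norm, trace and integral coordinates *)

Section Conjugation.
Context {m : int} (F : quadfield m).
Local Notation K := (inK m).
Local Notation O := (inOK m).
Local Notation om := (om m).
Local Notation tau := (tau m).
Local Notation nu := (nu m).

Lemma cj_mk (a b : rat) : F (ratr a + ratr b * sq m) = ratr a - ratr b * sq m.
Proof. by rewrite (rmorphD F) (fmorph_rat F) (rmorphM F) (fmorph_rat F) cj_sq mulrN. Qed.

Lemma cjK x : K x -> F (F x) = x.
Proof. by move=> [a [b ->]]; rewrite cj_mk (rmorphB F) (fmorph_rat F) (rmorphM F) (fmorph_rat F) cj_sq; ring. Qed.

Lemma inK_cj x : K x -> K (F x).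
Proof. by move=> [a [b ->]]; exists a, (- b); rewrite cj_mk rmorphN /=; ring. Qed.

Lemma inO_cj x : O x -> O (F x).
Proof. by move=> [Kx Ax]; split; [exact: inK_cj | rewrite Aint_aut]. Qed.

Lemma norm_rat x : K x -> exists r : rat, x * F x = ratr r.
Proof.
move=> [a [b ->]]; exists (a ^+ 2 - m%:~R * b ^+ 2); rewrite cj_mk.
ring: (sq2 m).
Qed.

Lemma norm_rat_neq0 x (r : rat) : x != 0 -> x * F x = ratr r -> r != 0.
Proof.
move=> x0 Er; rewrite -(fmorph_eq0 (ratr : {rmorphism rat -> algC})) /= -Er.
by rewrite mulf_neq0 ?fmorph_eq0.
Qed.

Lemma trace_rat x : K x -> exists r : rat, x + F x = ratr r.
Proof. by move=> [a [b ->]]; exists (2 * a); rewrite cj_mk; ring. Qed.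

Lemma cj_neq0 x : x != 0 -> F x != 0.
Proof. by rewrite fmorph_eq0. Qed.

Lemma norm_int x : O x -> exists z : int, x * F x = z%:~R.
Proof.
move=> Ox; have [r Er] := norm_rat (inO_K Ox).
have [z Ez] : exists z : int, r = z%:~R.
  by apply: (@inO_rat m); rewrite -Er; apply: inOM => //; apply: inO_cj.
by exists z; rewrite Er Ez ratr_int.
Qed.

Lemma trace_int x : O x -> exists z : int, x + F x = z%:~R.
Proof.
move=> Ox; have [r Er] := trace_rat (inO_K Ox).
have [z Ez] : exists z : int, r = z%:~R.
  by apply: (@inO_rat m); rewrite -Er; apply: inOD => //; apply: inO_cj.
by exists z; rewrite Er Ez ratr_int.
Qed.

Lemma cj_om : F om = tau%:~R - om.
Proof.
case: (tau_nu_cases m) => -[_ -> _ ->]; last by rewrite cj_sq sub0r.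
by rewrite fmorph_div rmorphD rmorph1 rmorph_nat /= cj_sq; field.
Qed.

Lemma norm_sq_coord (a b : int) :
  (a%:~R + b%:~R * sq m) * F (a%:~R + b%:~R * sq m) = (a ^+ 2 - m * b ^+ 2)%:~R.
Proof. by rewrite rmorphD rmorphM /= !rmorph_int cj_sq; ring: (sq2 m). Qed.

Lemma norm_coord (a b : int) :
  (a%:~R + b%:~R * om) * F (a%:~R + b%:~R * om)
  = (a ^+ 2 + tau * a * b + nu * b ^+ 2)%:~R.
Proof. by rewrite rmorphD rmorphM /= !rmorph_int cj_om; ring: (om_sqr m). Qed.

Lemma om_indep (a b : int) : a%:~R + b%:~R * om = 0 -> a = 0 /\ b = 0.
Proof.
move=> E; have : ratr (2 * a%:~R + (tau * b)%:~R) + ratr ((2 - tau) * b)%:~R * sq m = 0.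
  case: (tau_nu_cases m) E => -[_ -> _ ->] E; last first.
    by have := congr1 ( *%R 2) E; rewrite mulr0 => <-; ring.
  by have := congr1 ( *%R 2) E; rewrite mulr0 => <-; field.
case/(sq_indep (qf_sqf F) (qf_neq1 F)) => /eqP + /eqP.
rewrite intr_eq0 -[2]/(2%:~R) -intrM -intrD intr_eq0 => /eqP E1 /eqP E2.
by case: (tau_nu_cases m) E1 E2 => -[_ -> _ _]; lia.
Qed.

Lemma om_inj (a b c d : int) :
  a%:~R + b%:~R * om = c%:~R + d%:~R * om -> a = c /\ b = d.
Proof.
move=> /eqP; rewrite -subr_eq0 => /eqP E.
have : (a - c)%:~R + (b - d)%:~R * om = 0 by rewrite -E; ring.
by case/om_indep; lia.
Qed.

Lemma sqf_mod4 : (m %% 4)%Z <> 0.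
Proof.
move=> E; have /dvdzP[q Eq] : (4 %| m)%Z by lia.
by have := @squarefree_sqr m 2 q (qf_sqf F); rewrite mulrC => /(_ Eq).
Qed.

(** The trace [T = 2 a] and the norm [N] are integers. Then [(2 b)^2 m = T^2 - 4 N] makes [U = 2 b]
    an integer, as [m] is squarefree, and [T^2 - m U^2 = 4 N] read modulo 4 settles the parities of
    [T] and [U]. *)
Lemma inO_coord x : O x -> exists a b : int, x = a%:~R + b%:~R * om.
Proof.
move=> Ox; have [T ET] := trace_int Ox; have [N EN] := norm_int Ox.
have [a [b Ex]] := inO_K Ox.
have {}ET : T%:~R = 2 * a.
  apply: ratr_algC_inj; rewrite ratr_int -ET Ex cj_mk; ring.
have {}EN : N%:~R = a ^+ 2 - m%:~R * b ^+ 2.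
  apply: ratr_algC_inj; rewrite ratr_int -EN Ex cj_mk; ring: (sq2 m).
have [U EU] : exists U : int, 2 * b = U%:~R.
  apply: (@rat_sqr_mul_int m (T ^+ 2 - 4 * N)); first exact: (qf_sqf F).
  by rewrite intrB intrX intrM EN ET; ring.
have E4 : T ^+ 2 - m * U ^+ 2 = 4 * N.
  apply: (@intr_inj rat); rewrite !(intrB, intrM, intrX) EN -EU ET; ring.
have ha : a = T%:~R / 2 by rewrite ET; field.
have hb : b = U%:~R / 2 by rewrite -EU; field.
have tC : ratr a = T%:~R / 2 :> algC by rewrite ha fmorph_div /= ratr_int rmorph_nat.
have uC : ratr b = U%:~R / 2 :> algC by rewrite hb fmorph_div /= ratr_int rmorph_nat.
have [t Et] : exists t, T = t + t \/ T = t + t + 1.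
  by exists (T %/ 2)%Z; lia.
have [u Eu] : exists u, U = u + u \/ U = u + u + 1.
  by exists (U %/ 2)%Z; lia.
case: (tau_nu_cases m) => -[Em _ _ ->].
  have [h Eh] : exists h, m = 4 * h + 1 by exists (m %/ 4)%Z; lia.
  have Ek : T = U + 2 * (t - u).
    by move: E4; rewrite Eh; case: Et => ->; case: Eu => ->; lia.
  by exists (t - u), U; rewrite Ex tC uC Ek; field.
have [h [r [Eh hr]]] : exists h r, m = 4 * h + r /\ (r = 2 \/ r = 3).
  by exists (m %/ 4)%Z, (m %% 4)%Z; have := sqf_mod4; lia.
have [Et' Eu'] : T = t + t /\ U = u + u.
  by move: E4; rewrite Eh; case: Et => ->; case: Eu => ->; case: hr => ->; try lia; nia.
by exists t, u; rewrite Ex tC uC Et' Eu'; field.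
Qed.

End Conjugation.


(** * Prime ideals above rational primes *)

Lemma prime_dvdzM (p : nat) (a b : int) :
  prime p -> (p%:Z %| a * b)%Z = (p%:Z %| a)%Z || (p%:Z %| b)%Z.
Proof. by move=> pp; rewrite !dvdzE abszM Euclid_dvdM. Qed.

Lemma prime_dvdzX (p : nat) (a : int) (n : nat) :
  prime p -> (p%:Z %| a ^+ n)%Z -> (p%:Z %| a)%Z.
Proof. by move=> pp; rewrite !dvdzE abszX Euclid_dvdX // => /andP[]. Qed.

Lemma prime_bezout (p : nat) (z : int) : prime p -> ~~ (p%:Z %| z)%Z ->
  exists u v : int, u * p%:Z + v * z = 1.
Proof.
move=> pp; rewrite dvdzE /= => npz.
have c : coprimez p%:Z z by rewrite coprimezE /= prime_coprime.
have [u [v E]] := Bezoutz p%:Z z.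
by exists u, v; rewrite E; apply/eqP.
Qed.

(* A prime ideal with its residue characteristic. *)
Record place (m : int) := Place {
  pl : algC -> Prop;
  pl_prime : prime_ideal m pl;
  pl_p : nat;
  pl_pP : prime pl_p;
  pl_mem : pl pl_p%:R }.

Section Places.
Context {m : int}.
Local Notation O := (inOK m).
Implicit Type v : place m.

Lemma pl_O v x : pl v x -> O x.
Proof. by case: v => P [h ?] /= *; apply: h. Qed.

Lemma pl0 v : pl v 0.
Proof. by case: v => P [? []] /=. Qed.

Lemma plD v x y : pl v x -> pl v y -> pl v (x + y).
Proof. by case: v => P [? [? [h ?]]] /= *; apply: h. Qed.

Lemma plM v a x : O a -> pl v x -> pl v (a * x).
Proof. by case: v => P [? [? [? [h ?]]]] /= *; apply: h. Qed.

Lemma plMr v a x : O a -> pl v x -> pl v (x * a).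
Proof. by move=> *; rewrite mulrC; apply: plM. Qed.

Lemma pl1 v : ~ pl v 1.
Proof. by case: v => P [? [? [? [? [? ?]]]]]. Qed.

Lemma plE v x y : O x -> O y -> pl v (x * y) -> pl v x \/ pl v y.
Proof. by case: v => P [? [? [? [? [? [h ?]]]]]] /= *; apply: h. Qed.

Lemma plX v x n : O x -> pl v (x ^+ n) -> pl v x.
Proof.
by move=> Ox; elim: n => [/pl1//|n IH]; rewrite exprS => /(plE Ox (inOX n Ox))[].
Qed.

Lemma pl_int v (z : int) : pl v z%:~R <-> (pl_p v %| z)%Z.
Proof.
split=> [Pz|/dvdzP[q ->]]; last first.
  by rewrite intrM; apply: plM (pl_mem v); apply: inO_int.
apply/negPn/negP => /(prime_bezout (pl_pP v))[a [b E]].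
apply: (@pl1 v); rewrite -[1](@mulr1z algC) -E intrD !intrM.
by apply: plD; apply: plM => //; [exact: inO_int | exact: pl_mem | exact: inO_int].
Qed.

(** The norm of a nonzero element of [P] is a nonzero integer in [P]; splitting off prime factors
    one at a time reaches a prime number in [P]. *)
Lemma prime_ideal_place (F : quadfield m) (P : algC -> Prop) :
  prime_ideal m P -> exists v, pl v = P.
Proof.
move=> pP; have [hO [h0 [hD [hM [h1 [hE [x [Px x0]]]]]]]] := pP.
suff [p [pp Pp]] : exists p : nat, prime p /\ P p%:R by exists (Place pP pp Pp).
have [z Ez] := norm_int F (hO _ Px).
have z0 : z != 0 by rewrite -(intr_eq0 algC) -Ez mulf_neq0 ?cj_neq0.
have Pn : P (`|z|%N)%:R.
  have Pz : P z%:~R by rewrite -Ez mulrC; apply: hM => //; apply/inO_cj/hO.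
  case: (intP z) Pz => [//|n //|n h].
  rewrite -[_%:R]opprK -mulN1r; apply: hM; [exact/inON/inO1|].
  by move: h; rewrite intrN abszN.
have : (0 < `|z|)%N by rewrite absz_gt0.
elim/ltn_ind: `|z|%N Pn => n IH Pn n0.
have [n1|n1] := leqP n 1.
  by have E : n = 1%N by [lia]; case: h1; move: Pn; rewrite E.
have pp := pdiv_prime n1; have dn := pdiv_dvd n.
move: Pn; rewrite -{1}(divnK dn) natrM => /hE[||Pq|Pq]; try exact: inO_nat.
  apply: IH Pq _; first by rewrite ltn_Pdiv ?prime_gt1.
  by rewrite divn_gt0 ?prime_gt0 // dvdn_leq.
by exists (pdiv n).
Qed.

Section Existence.
Context (F : quadfield m).
Local Notation om := (om m).
Local Notation tau := (tau m).
Local Notation nu := (nu m).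

Lemma om_mul (a b c d : int) :
  (a%:~R + b%:~R * om) * (c%:~R + d%:~R * om)
  = (a * c - nu * b * d)%:~R + (a * d + b * c + tau * b * d)%:~R * om.
Proof. ring: (om_sqr m). Qed.

(** The ideal is the kernel of the reduction modulo [p] that sends [om] to the root [r] of its
    polynomial. *)
Lemma split_place (p : nat) (r : int) : prime p -> (p %| r ^+ 2 - tau * r + nu)%Z ->
  exists v, pl_p v = p.
Proof.
move=> pp /dvdzP[k Ek].
pose P x := exists a b : int, x = a%:~R + b%:~R * om /\ (p %| a + b * r)%Z.
have PE a b : P (a%:~R + b%:~R * om) <-> (p %| a + b * r)%Z.
  by split=> [[c [d [/(om_inj F)[-> ->]]]]|]; last by exists a, b.
have PI a : P a%:~R <-> (p %| a)%Z.
  by have := PE a 0; rewrite mul0r addr0 mul0r addr0.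
have red a b c d : a * c - nu * b * d + (a * d + b * c + tau * b * d) * r
    = (a + b * r) * (c + d * r) - b * d * k * p%:Z.
  by rewrite -(mulrA (b * d)) -Ek; ring.
have dB x y : (p %| x - y * p%:Z)%Z = (p %| x)%Z by rewrite rpredBr ?dvdz_mull.
have pP : prime_ideal m P.
  split; last split; last split; last split; last split; last split.
  - by move=> x [a [b [-> _]]]; apply: inO_mk.
  - by exists 0, 0; rewrite mul0r !addr0 mul0r.
  - move=> x y [a [b [-> h1]]] [c [d [-> h2]]]; exists (a + c), (b + d).
    by split; [ring | rewrite mulrDl addrACA rpredD].
  - move=> x y /(inO_coord F)[a [b ->]] [c [d [-> h]]].
    by rewrite om_mul PE red dB dvdz_mull.
  - by move/(PI 1); rewrite dvdzE /= dvdn1 => /eqP E; move: pp; rewrite E.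
  - move=> x y /(inO_coord F)[a [b ->]] /(inO_coord F)[c [d ->]].
    by rewrite om_mul !PE red dB prime_dvdzM // => /orP[]; [left | right].
  - exists p%:R; split; first exact/(PI p%:Z).
    by rewrite pnatr_eq0 -lt0n prime_gt0.
have Pp : P p%:R by exact/(PI p%:Z).
by exists (Place pP pp Pp).
Qed.

(** The ideal is [p O]. It is prime because the norm is multiplicative and, without a root of the
    polynomial of [om] modulo [p], the norm form vanishes modulo [p] only trivially. *)
Lemma inert_place (p : nat) : prime p ->
  (forall r : int, ~~ (p %| r ^+ 2 - tau * r + nu)%Z) -> exists v, pl_p v = p.
Proof.
move=> pp nr.
pose P x := exists a b : int, x = a%:~R + b%:~R * om /\ (p %| a)%Z && (p %| b)%Z.
have PE a b : P (a%:~R + b%:~R * om) <-> (p %| a)%Z && (p %| b)%Z.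
  by split=> [[c [d [/(om_inj F)[-> ->]]]]|]; last by exists a, b.
have PI a : P a%:~R <-> (p %| a)%Z.
  by have := PE a 0; rewrite mul0r addr0 dvdz0 andbT.
have nz a b : (p %| a ^+ 2 + tau * a * b + nu * b ^+ 2)%Z -> (p %| a)%Z && (p %| b)%Z.
  move=> h; have [pb|npb] := boolP (p %| b)%Z; last first.
    (* With [w] inverse to [b] modulo [p], the number [- a w] would be a root. *)
    have [u [w E]] := prime_bezout pp npb; case/negP: (nr (- a * w)).
    have -> : (- a * w) ^+ 2 - tau * (- a * w) + nu
      = w ^+ 2 * (a ^+ 2 + tau * a * b + nu * b ^+ 2)
        + (tau * a * w + nu * (1 + w * b)) * u * p%:Z.
      by rewrite -(mulrA _ u); have -> : u * p%:Z = 1 - w * b; [rewrite -E|]; ring.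
    by rewrite rpredD ?dvdz_mull.
  rewrite andbT; apply: (@prime_dvdzX _ _ 2) => //; move: h.
  by rewrite -addrA rpredDr // rpredD // ?dvdz_mull // expr2 dvdz_mull ?dvdz_mull.
have pP : prime_ideal m P.
  split; last split; last split; last split; last split; last split.
  - by move=> x [a [b [-> _]]]; apply: inO_mk.
  - by exists 0, 0; rewrite mul0r !addr0 dvdz0.
  - move=> x y [a [b [-> /andP[h1 h2]]]] [c [d [-> /andP[h3 h4]]]].
    by exists (a + c), (b + d); split; [ring | rewrite !rpredD].
  - move=> x y /(inO_coord F)[a [b ->]] [c [d [-> /andP[h1 h2]]]].
    rewrite om_mul PE rpredB ?dvdz_mull //=.
    by rewrite rpredD ?dvdz_mull // rpredD ?dvdz_mull.
  - by move/(PI 1); rewrite dvdzE /= dvdn1 => /eqP E; move: pp; rewrite E.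
  - move=> x y /(inO_coord F)[a [b ->]] /(inO_coord F)[c [d ->]].
    rewrite om_mul !PE => /andP[h1 h2].
    have : (p %| (a ^+ 2 + tau * a * b + nu * b ^+ 2)
                 * (c ^+ 2 + tau * c * d + nu * d ^+ 2))%Z.
      set s := a * c - _ in h1; set t := _ + tau * b * d in h2.
      have -> : (a ^+ 2 + tau * a * b + nu * b ^+ 2)
                 * (c ^+ 2 + tau * c * d + nu * d ^+ 2)
         = (s + tau * t) * s + nu * t * t by rewrite /s /t; ring.
      by rewrite rpredD ?dvdz_mull.
    by rewrite prime_dvdzM // => /orP[] /nz ?; [left | right].
  - exists p%:R; split; first exact/(PI p%:Z).
    by rewrite pnatr_eq0 -lt0n prime_gt0.
have Pp : P p%:R by exact/(PI p%:Z).
by exists (Place pP pp Pp).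
Qed.

Lemma place_exists (p : nat) : prime p -> exists v, pl_p v = p.
Proof.
move=> pp.
have [/existsP[r h]|/existsPn h] :=
  boolP [exists r : 'I_p, (p %| r%:Z ^+ 2 - tau * r%:Z + nu)%Z].
  exact: split_place h.
apply: inert_place => // r; apply/negP => hr.
have pz : p%:Z != 0 by have := prime_gt0 pp; lia.
have r0 := modz_ge0 r pz.
have rp : (`|(r %% p%:Z)%Z| < p)%N by have := ltz_mod r pz; lia.
case/negP: (h (Ordinal rp)) => /=.
have -> : (`|(r %% p%:Z)%Z|%N : int) = r - (r %/ p%:Z)%Z * p%:Z.
  by rewrite gez0_abs // /modz.
set q := (_ %/ _)%Z.
have -> : (r - q * p%:Z) ^+ 2 - tau * (r - q * p%:Z) + nu
   = (r ^+ 2 - tau * r + nu) + (- 2 * r * q + q ^+ 2 * p%:Z + tau * q) * p%:Z by ring.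
by rewrite rpredD ?dvdz_mull.
Qed.

End Existence.
End Places.


(** * Valuations of rational numbers *)

(** The value at 0 is 0 rather than infinity, so the rules below ask for nonzero arguments. *)
Definition vp (p : nat) (r : rat) : int :=
  (logn p `|numq r|)%:Z - (logn p `|denq r|)%:Z.

Lemma vp_frac (p : nat) (a b : int) : a != 0 -> b != 0 ->
  vp p (a%:~R / b%:~R) = (logn p `|a|)%:Z - (logn p `|b|)%:Z.
Proof.
move=> a0 b0; set r : rat := _ / _; rewrite /vp.
have n0 : numq r != 0 by rewrite numq_eq0 mulf_neq0 ?invr_eq0 ?intr_eq0.
have d0 : denq r != 0 by rewrite denq_eq0.
have E : a * denq r = numq r * b.
  apply: (@intr_inj rat); rewrite !intrM; have := divq_num_den r.
  rewrite {3}/r => /eqP; rewrite eqr_div ?intr_eq0 // => /eqP <-; ring.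
have : logn p (`|a| * `|denq r|) = logn p (`|numq r| * `|b|) by rewrite -!abszM E.
by rewrite !lognM ?absz_gt0 //; lia.
Qed.

Lemma vp_int (p : nat) (a : int) : a != 0 -> vp p a%:~R = (logn p `|a|)%:Z.
Proof. by move=> a0; have := @vp_frac p a 1 a0 isT; rewrite divr1 logn1 subr0. Qed.

Lemma vpM (p : nat) (r s : rat) : r != 0 -> s != 0 -> vp p (r * s) = vp p r + vp p s.
Proof.
move=> r0 s0; rewrite -{1}(divq_num_den r) -{1}(divq_num_den s) mulf_div -!intrM.
rewrite vp_frac ?mulf_neq0 ?denq_eq0 ?numq_eq0 // /vp !abszM.
by rewrite !lognM ?absz_gt0 ?denq_eq0 ?numq_eq0 //; lia.
Qed.

Lemma vpV (p : nat) (r : rat) : r != 0 -> vp p r^-1 = - vp p r.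
Proof.
move=> r0; have := @vpM p r r^-1 r0; rewrite invr_eq0 divff // => /(_ r0).
by rewrite (@vp_int p 1) // logn1; lia.
Qed.

Lemma vpX (p : nat) (r : rat) (n : nat) : r != 0 -> vp p (r ^+ n) = n%:Z * vp p r.
Proof.
move=> r0; elim: n => [|n IH]; first by rewrite (@vp_int p 1) // logn1 mul0r.
by rewrite exprS vpM ?expf_neq0 // IH; lia.
Qed.

Lemma nat_pow_logn (k z : nat) : (0 < k)%N -> (0 < z)%N ->
  (forall p, prime p -> (k %| logn p z)%N) -> exists n, z = (n ^ k)%N.
Proof.
move=> k0 z0 h; exists (\prod_(p <- primes z) p ^ (logn p z %/ k))%N.
rewrite [LHS]prod_prime_decomp // prime_decompE big_map /=.
rewrite (big_morph (fun n => (n ^ k)%N) (fun x y => expnMn x y k) (exp1n k)).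
apply: eq_big_seq => p; rewrite mem_primes => /andP[pp _].
by rewrite -expnM divnK // h.
Qed.

(** Multiplication by the [k]-th power of the denominator turns [r] into an integer whose valuations
    are still multiples of [k]; the sign is what valuations do not see. *)
Lemma rat_pow_vp (k : nat) (r : rat) : (0 < k)%N -> r != 0 ->
  (forall p, prime p -> (k %| vp p r)%Z) -> exists n : rat, r = n ^+ k \/ r = - n ^+ k.
Proof.
move=> k0 r0 h; pose z := numq r * denq r ^+ k.-1.
have d0 : (denq r)%:~R != 0 :> rat by rewrite intr_eq0 denq_eq0.
have z0 : z != 0 by rewrite mulf_neq0 ?expf_neq0 ?numq_eq0 ?denq_eq0.
have zr : z%:~R = r * (denq r)%:~R ^+ k.
  by rewrite -[in RHS](prednK k0) exprS -{1}(divq_num_den r) mulrA divfK // intrM intrX.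
have [||n En] := @nat_pow_logn k `|z| k0; first by rewrite absz_gt0.
  move=> p pp; have := vp_int p z0; rewrite zr vpM ?expf_neq0 // vpX // => E.
  have : (k %| (logn p `|z|)%:Z)%Z by rewrite -E rpredD ?h ?dvdz_mulr.
  by rewrite dvdzE.
exists (n%:R / (denq r)%:~R); rewrite expr_div_n -natrX -En.
have Er : r = z%:~R / (denq r)%:~R ^+ k by rewrite zr mulfK ?expf_neq0.
have [zp|zn] := leP 0 z.
  by left; rewrite {1}Er -{1}(gez0_abs zp).
by right; rewrite {1}Er -mulNr -[in LHS](opprK z) intrN -(ltz0_abs zn).
Qed.

(** * The local ring at a place *)

Section LocalRing.
Context {m : int} (v : place m).
Local Notation K := (inK m).
Local Notation O := (inOK m).
Local Notation P := (pl v).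
Local Notation p := (pl_p v).
Local Notation L := (inOP m (pl v)).
Local Notation U := (unitOP m (pl v)).

Lemma p_neq0 : p%:R != 0 :> algC.
Proof. by rewrite pnatr_eq0 -lt0n prime_gt0 ?pl_pP. Qed.

Lemma notP_M x y : O x -> O y -> ~ P x -> ~ P y -> ~ P (x * y).
Proof. by move=> Ox Oy nx ny /(plE Ox Oy)[]. Qed.

Lemma notP_neq0 x : ~ P x -> x != 0.
Proof. by move=> nP; apply/eqP => E; apply: nP; rewrite E; exact: pl0. Qed.

Lemma L_K x : L x -> K x. Proof. by case. Qed.

Lemma L_O x : O x -> L x.
Proof.
move=> Ox; split; first exact: inO_K.
by exists 1; split; [exact: inO1 | split; [exact: pl1 | rewrite mul1r]].
Qed.

Lemma LD x y : L x -> L y -> L (x + y).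
Proof.
move=> [Kx [a [Oa [na Oax]]]] [Ky [b [Ob [nb Oby]]]]; split; first exact: inKD.
exists (a * b); split; first exact: inOM.
split; first exact: notP_M.
have -> : a * b * (x + y) = b * (a * x) + a * (b * y) by ring.
by apply: inOD; apply: inOM.
Qed.

Lemma LM x y : L x -> L y -> L (x * y).
Proof.
move=> [Kx [a [Oa [na Oax]]]] [Ky [b [Ob [nb Oby]]]]; split; first exact: inKM.
exists (a * b); split; first exact: inOM.
split; first exact: notP_M.
by rewrite mulrACA; apply: inOM.
Qed.

Lemma L_int (z : int) : L z%:~R. Proof. exact/L_O/inO_int. Qed.
Lemma L_nat (n : nat) : L n%:R. Proof. exact/L_O/inO_nat. Qed.
Lemma L1 : L 1. Proof. exact: L_nat 1. Qed.
Lemma L0 : L 0. Proof. exact: L_nat 0. Qed.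

Lemma LN x : L x -> L (- x).
Proof. by move=> Lx; rewrite -mulN1r; apply: LM => //; exact: L_int (-1). Qed.

Lemma LB x y : L x -> L y -> L (x - y).
Proof. by move=> Lx Ly; apply: LD => //; apply: LN. Qed.

Lemma LX x n : L x -> L (x ^+ n).
Proof. by move=> Lx; elim: n => [|n IH]; [exact: L1 | rewrite exprS; apply: LM]. Qed.

Lemma L_inv x : O x -> ~ P x -> L x^-1.
Proof.
move=> Ox nx; split; first exact/inKV/inO_K.
by exists x; rewrite divff ?notP_neq0 //; do 2!split=> //; exact: inO1.
Qed.

Lemma L_frac x : L x -> exists a b, [/\ O a, O b, ~ P b & x = a / b].
Proof.
move=> [Kx [y [Oy [ny Oyx]]]]; exists (y * x), y; split=> //.
by rewrite mulrC mulKf ?notP_neq0.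
Qed.

Lemma unit_iff x : U x <-> [/\ x != 0, L x & L x^-1].
Proof.
split=> [[Lx [z [Lz E]]]|[x0 Lx Lx1]]; last by split=> //; exists x^-1; rewrite divff.
have x0 : x != 0 by apply/eqP => x0; move/eqP: E; rewrite x0 mul0r eq_sym oner_eq0.
by split=> //; have -> : x^-1 = z by apply: (mulfI x0); rewrite E divff.
Qed.

Lemma unit_L x : U x -> L x. Proof. by case. Qed.
Lemma unit_K x : U x -> K x. Proof. by case=> /L_K. Qed.
Lemma unit_neq0 x : U x -> x != 0. Proof. by case/unit_iff. Qed.
Lemma unit_LV x : U x -> L x^-1. Proof. by case/unit_iff. Qed.

Lemma unit_O x : O x -> ~ P x -> U x.
Proof. by move=> Ox nx; apply/unit_iff; split; [exact: notP_neq0|exact: L_O|exact: L_inv]. Qed.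

Lemma unitM x y : U x -> U y -> U (x * y).
Proof.
move=> /unit_iff[x0 ? ?] /unit_iff[y0 ? ?]; apply/unit_iff; rewrite mulf_neq0 // invfM.
by split=> //; apply: LM.
Qed.

Lemma unitV x : U x -> U x^-1.
Proof. by move=> /unit_iff[? ? ?]; apply/unit_iff; rewrite invr_eq0 invrK. Qed.

Lemma unit_int (z : int) : ~~ (p %| z)%Z -> U z%:~R.
Proof. by move=> h; apply: unit_O; [exact: inO_int | move/pl_int; exact/negP]. Qed.

Lemma unit1 : U 1.
Proof. by apply: unit_O; [exact: inO1 | exact: pl1]. Qed.

Lemma unitN1 : U (-1).
Proof. by apply/unit_iff; rewrite oppr_eq0 oner_eq0 invrN1; have := L_int (-1). Qed.

Lemma unit_sign (s : int) : s = 1 \/ s = -1 -> U s%:~R.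
Proof. by case=> ->; [exact: unit1 | exact: unitN1]. Qed.

Lemma unitX x n : U x -> U (x ^+ n).
Proof. by move=> Ux; elim: n => [|n IH]; [exact: unit1 | rewrite exprS; apply: unitM]. Qed.

Lemma unit_div x y : U x -> U y -> U (x / y).
Proof. by move=> *; apply: unitM => //; apply: unitV. Qed.

(* The maximal ideal of the local ring. *)
Definition inM x := exists y, O y /\ ~ P y /\ P (y * x).

Lemma M_P x : P x -> inM x.
Proof. by move=> Px; exists 1; rewrite mul1r; split; [exact: inO1 | split=> //; exact: pl1]. Qed.

Lemma P_M x : O x -> inM x -> P x.
Proof. by move=> Ox [y [Oy [ny /(plE Oy Ox)[]]]]. Qed.

Lemma M_L x : inM x -> L x.
Proof.
move=> [y [Oy [ny Pyx]]].
have -> : x = (y * x) / y by rewrite mulrC mulKf ?notP_neq0.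
by apply: LM; [exact/L_O/pl_O/Pyx | exact: L_inv].
Qed.

Lemma MD x y : inM x -> inM y -> inM (x + y).
Proof.
move=> [a [Oa [na Oax]]] [b [Ob [nb Oby]]].
exists (a * b); split; first exact: inOM.
split; first exact: notP_M.
have -> : a * b * (x + y) = b * (a * x) + a * (b * y) by ring.
by apply: plD; apply: plM.
Qed.

Lemma ML x y : L x -> inM y -> inM (x * y).
Proof.
move=> [Kx [a [Oa [na Oax]]]] [b [Ob [nb Oby]]].
exists (a * b); split; first exact: inOM.
split; first exact: notP_M.
by rewrite mulrACA; apply: plM.
Qed.

Lemma MLr x y : L y -> inM x -> inM (x * y).
Proof. by move=> *; rewrite mulrC; apply: ML. Qed.

Lemma MN x : inM x -> inM (- x).
Proof. by move=> Mx; rewrite -mulN1r; apply: ML => //; exact: L_int (-1). Qed.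

Lemma MB x y : inM x -> inM y -> inM (x - y).
Proof. by move=> Mx My; apply: MD => //; apply: MN. Qed.

Lemma M_int (z : int) : inM z%:~R <-> (p %| z)%Z.
Proof. by rewrite -pl_int; split; [apply: P_M; exact: inO_int | exact: M_P]. Qed.

Lemma M1F : ~ inM 1.
Proof. by move=> /(P_M inO1) /pl1. Qed.

Lemma ME x y : L x -> L y -> inM (x * y) -> inM x \/ inM y.
Proof.
move=> [_ [a [Oa [na Oax]]]] [_ [b [Ob [nb Oby]]]] [c [Oc [nc h]]].
have : P (c * ((a * x) * (b * y))).
  have -> : c * ((a * x) * (b * y)) = (a * b) * (c * (x * y)) by ring.
  by apply: plM => //; apply: inOM.
case/(plE Oc (inOM Oax Oby)) => // /(plE Oax Oby)[h1|h1]; [left|right].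
  by exists a.
by exists b.
Qed.

Lemma MX x n : L x -> inM (x ^+ n) -> inM x.
Proof. by move=> Lx; elim: n => [/M1F//|n IH]; rewrite exprS => /(ME Lx (LX n Lx))[]. Qed.

Lemma unit_notM x : U x -> ~ inM x.
Proof. by case/unit_iff => x0 _ Lx1 Mx; apply: M1F; rewrite -(divff x0); apply: MLr. Qed.

Lemma notM_unit x : L x -> ~ inM x -> U x.
Proof.
move=> [Kx [y [Oy [ny Oyx]]]] nM.
have -> : x = (y * x) / y by rewrite mulrC mulKf ?notP_neq0.
apply: unit_div; apply: unit_O => // h; apply: nM.
by exists y.
Qed.

Lemma L_rat (r : rat) : L (ratr r) -> ~~ (p %| denq r)%Z.
Proof.
move=> Lr; apply/negP => pd.
have : inM (numq r)%:~R.
  have -> : (numq r)%:~R = ratr r * (denq r)%:~R :> algC.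
    by rewrite -{2}(divq_num_den r) fmorph_div /= !ratr_int divfK // intr_eq0 denq_eq0.
  by apply: ML => //; apply/M_int.
move/M_int => pn; have := coprime_num_den r.
rewrite !dvdzE /= in pn pd; move/(coprimeP _ _).
have : (p %| gcdn `|numq r| `|denq r|)%N by rewrite dvdn_gcd pn.
rewrite -/(coprime _ _) => + _; have := coprime_num_den r; rewrite /coprime => /eqP ->.
by rewrite dvdn1 => /eqP E; have := pl_pP v; rewrite E.
Qed.

Lemma vp_ge0 (q : nat) (r : rat) : ~~ (q %| denq r)%Z -> 0 <= vp q r.
Proof. by rewrite dvdzE /= /vp => h; rewrite (lognE q `|denq r|) (negbTE h) !andbF subr0. Qed.

Lemma unit_rat_vp (r : rat) : U (ratr r) -> vp p r = 0.
Proof.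
case/unit_iff => r0 /L_rat h1; rewrite -fmorphV => /L_rat h2.
have r0' : r != 0 by move: r0; rewrite fmorph_eq0.
have := vp_ge0 h1; have := vp_ge0 h2; rewrite vpV //; lia.
Qed.

End LocalRing.

Ltac in_local := repeat first [assumption | exact: L_nat | exact: L_int
  | apply: LD | apply: LN | apply: LX | apply: LM].
Ltac in_order := repeat first [assumption | exact: inO_nat | exact: inO_int
  | apply: inOD | apply: inON | apply: inOX | apply: inOM].


(** * Ramification and the behaviour of conjugation *)

Section Ramification.
Context {m : int} (F : quadfield m).
Local Notation K := (inK m).
Local Notation O := (inOK m).
Local Notation om := (om m).
Local Notation tau := (tau m).
Local Notation nu := (nu m).
Implicit Type v : place m.

(** [tau^2 - 4 nu] is the discriminant of the polynomial of [om], that is, the discriminant of the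
    field. *)
Definition ram v : bool := (pl_p v %| tau ^+ 2 - 4 * nu)%Z.

Lemma disc_om_cases : tau ^+ 2 - 4 * nu = m \/ tau ^+ 2 - 4 * nu = 4 * m.
Proof. by case: (tau_nu_cases m) => -[_ -> h _]; [left | right]; rewrite h; ring. Qed.

Lemma ram_odd v : pl_p v != 2%N -> ram v = (pl_p v %| m)%Z.
Proof.
move=> p2; rewrite /ram; case: disc_om_cases => -> //.
have -> : 4 * m = 2 * (2 * m) by ring.
by rewrite !prime_dvdzM ?pl_pP //= dvdzE /= dvdn_prime2 ?pl_pP // (negbTE p2).
Qed.

(** Conjugation moves [a + b om] by [b (tau - 2 om)], and [tau - 2 om] lies in the prime because its
    square is the discriminant. *)
Lemma ram_cj v x : ram v -> pl v x -> pl v (F x).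
Proof.
move=> rv Px; have [a [b Ex]] := inO_coord F (pl_O Px).
have Ot : O (tau%:~R - 2 * om).
  by apply: inOB; [exact: inO_int | apply: inOM; [exact: inO_nat | exact: inO_om]].
have Pt : pl v (tau%:~R - 2 * om).
  apply: (@plX _ _ _ 2) => //.
  have -> : (tau%:~R - 2 * om) ^+ 2 = (tau ^+ 2 - 4 * nu)%:~R by ring: (om_sqr m).
  exact/pl_int.
have -> : F x = x + b%:~R * (tau%:~R - 2 * om).
  by rewrite Ex rmorphD rmorphM /= !rmorph_int (cj_om F); ring.
by apply: plD => //; apply: plM => //; exact: inO_int.
Qed.

Lemma ram_cjN v x : ram v -> O x -> ~ pl v x -> ~ pl v (F x).
Proof. by move=> rv Ox nx /(ram_cj rv); rewrite (cjK F (inO_K Ox)). Qed.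

Lemma ram_cjL v x : ram v -> inOP m (pl v) x -> inOP m (pl v) (F x).
Proof.
move=> rv /L_frac[a [b [Oa Ob nb ->]]]; rewrite fmorph_div /=.
apply: LM; first exact/L_O/inO_cj.
by apply: L_inv; [exact: inO_cj | exact: ram_cjN].
Qed.

Lemma ram_cjU v x : ram v -> unitOP m (pl v) x -> unitOP m (pl v) (F x).
Proof.
move=> rv /unit_iff[x0 Lx Lx1]; apply/unit_iff; rewrite cj_neq0 // -fmorphV.
by split=> //; exact: ram_cjL.
Qed.

(** Trace and norm of [x] are divisible by [p], hence so is the squared trace minus four times the
    norm, which is the discriminant times [b^2]. As [p] does not divide the discriminant it divides
    [b], and then [a] because of the norm. *)
Lemma unram_pdiv v x : ~~ ram v -> pl v x -> pl v (F x) ->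
  exists y, O y /\ x = (pl_p v)%:R * y.
Proof.
move=> rv Px Pfx; have [a [b Ex]] := inO_coord F (pl_O Px).
have pp := pl_pP v.
have Et : x + F x = (2 * a + tau * b)%:~R.
  by rewrite Ex rmorphD rmorphM /= !rmorph_int (cj_om F); ring.
have h1 : (pl_p v %| 2 * a + tau * b)%Z by apply/pl_int; rewrite -Et; apply: plD.
have h2 : (pl_p v %| a ^+ 2 + tau * a * b + nu * b ^+ 2)%Z.
  by apply/pl_int; rewrite -(norm_coord F) -Ex; apply: plMr => //; apply/inO_cj/pl_O/Px.
have pb : (pl_p v %| b)%Z.
  apply: (@prime_dvdzX _ _ 2) => //.
  suff : (pl_p v %| (tau ^+ 2 - 4 * nu) * b ^+ 2)%Z.
    by rewrite prime_dvdzM // => /orP[h|//]; case/negP: rv.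
  have -> : (tau ^+ 2 - 4 * nu) * b ^+ 2 = (2 * a + tau * b) * (2 * a + tau * b)
     - 4 * (a ^+ 2 + tau * a * b + nu * b ^+ 2) by ring.
  by rewrite rpredB ?dvdz_mull.
have pa : (pl_p v %| a)%Z.
  apply: (@prime_dvdzX _ _ 2) => //; move: h2.
  by rewrite -addrA rpredDr // rpredD // ?dvdz_mull // expr2 dvdz_mull ?dvdz_mull.
have /dvdzP[a' Ea] := pa; have /dvdzP[b' Eb] := pb.
exists (a'%:~R + b'%:~R * om); split; first exact: inO_mk.
by rewrite Ex Ea Eb !intrM; ring.
Qed.

(** [p] is a uniformizer: if the conjugate of [x] is outside the prime it is a local unit, and
    [x = N(x) / F x] with [p] dividing [N(x)]. *)
Lemma unram_P v x : ~~ ram v -> pl v x ->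
  exists y, inOP m (pl v) y /\ x = (pl_p v)%:R * y.
Proof.
move=> rv Px; have Ox := pl_O Px; have Ofx := inO_cj F Ox.
have [Pfx|nPfx] := classic (pl v (F x)).
  by have [y [Oy ->]] := unram_pdiv rv Px Pfx; exists y; split=> //; exact: L_O.
have [z Ez] := norm_int F Ox.
have : pl v z%:~R by rewrite -Ez; apply: plMr.
move/pl_int/dvdzP => [w Ew]; exists (w%:~R / F x); split.
  by apply: LM; [exact: L_int | exact: L_inv].
have Exz : x = z%:~R / F x by rewrite -Ez mulfK ?(notP_neq0 nPfx).
by rewrite {1}Exz Ew intrM; ring.
Qed.

Lemma unram_M v x : ~~ ram v -> inM v x ->
  exists y, inOP m (pl v) y /\ x = (pl_p v)%:R * y.
Proof.
move=> rv [y [Oy [ny /(unram_P rv)[w [Lw Ew]]]]].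
exists (w / y); split; first by apply: LM => //; exact: L_inv.
by rewrite mulrA -Ew mulrC mulKf ?(notP_neq0 ny).
Qed.

Lemma ppow_unit v (x y : algC) (a b : nat) :
  unitOP m (pl v) x -> unitOP m (pl v) y ->
  x * (pl_p v)%:R ^+ a = y * (pl_p v)%:R ^+ b -> a = b.
Proof.
move=> Ux Uy E; pose q : rat := (pl_p v)%:R.
have q0 : q != 0 by rewrite pnatr_eq0 -lt0n prime_gt0 ?pl_pP.
have qC : ratr q = (pl_p v)%:R :> algC by rewrite /q rmorph_nat.
have : vp (pl_p v) (q ^+ a / q ^+ b) = 0.
  apply: unit_rat_vp => //.
  have -> : ratr (q ^+ a / q ^+ b) = y / x :> algC.
    rewrite fmorph_div !rmorphXn /= qC; apply/eqP.
    by rewrite eqr_div ?expf_neq0 ?p_neq0 ?(unit_neq0 Ux) // mulrC E.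
  exact: unit_div.
have vq : vp (pl_p v) q = 1.
  rewrite (@vp_int _ (pl_p v)); first by rewrite absz_nat logn_prime ?pl_pP // eqxx.
  by have := prime_gt0 (pl_pP v); lia.
by rewrite vpM ?vpV ?vpX ?invr_eq0 ?expf_neq0 // vq; lia.
Qed.

(** This stands in for a valuation; powers of [p] on both sides keep the exponents natural numbers.
    For integral [x] the proof descends on the norm: either [x] is a unit, or [p] divides [x], or
    the conjugate is a unit and [N(x)] can be used instead of [x]. *)
Lemma unram_val v x : ~~ ram v -> K x -> x != 0 ->
  exists y a b, unitOP m (pl v) y /\ x * (pl_p v)%:R ^+ a = y * (pl_p v)%:R ^+ b.
Proof.
move=> rv.
have OV : forall x, O x -> x != 0 ->
    exists y b, unitOP m (pl v) y /\ x = y * (pl_p v)%:R ^+ b.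
  move=> {}x Ox x0; have [z Ez] := norm_int F Ox.
  move En : `|z|%N => n; elim/ltn_ind: n => n IH in x z Ox x0 Ez En *.
  have [Px|nPx] := classic (pl v x); last first.
    by exists x, 0%N; rewrite expr0 mulr1; split=> //; exact: unit_O.
  have Ofx := inO_cj F Ox.
  have z0 : z != 0 by rewrite -(intr_eq0 algC) -Ez mulf_neq0 ?cj_neq0.
  have [Pfx|nPfx] := classic (pl v (F x)).
    have [y [Oy Ey]] := unram_pdiv rv Px Pfx.
    have y0 : y != 0 by apply: contraNneq x0 => y0; rewrite Ey y0 mulr0.
    have [w Ew] := norm_int F Oy.
    have Ezw : z = (pl_p v)%:Z ^+ 2 * w.
      apply: (@intr_inj algC); rewrite intrM intrX -Ew -Ez Ey rmorphM rmorph_nat /=.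
      ring.
    have [|y' [b [Uy Eb]]] := IH `|w|%N _ y w Oy y0 Ew erefl; last first.
      by exists y', b.+1; rewrite exprS {1}Ey {1}Eb; split=> //; ring.
    have w0 : w != 0 by rewrite -(intr_eq0 algC) -Ew mulf_neq0 ?cj_neq0.
    rewrite -En Ezw abszM abszX absz_nat ltn_Pmull ?absz_gt0 //.
    by rewrite -(exp1n 2) ltn_exp2r // prime_gt1 ?pl_pP.
  have zp : exists y b, unitOP m (pl v) y /\ z%:~R = y * (pl_p v)%:R ^+ b.
    have n0 : (0 < `|z|)%N by rewrite absz_gt0.
    have [w nw Ew] := pfactor_coprime (pl_pP v) n0.
    exists ((-1) ^+ (z < 0)%R * w%:~R), (logn (pl_p v) `|z|); split.
      apply: unitM; first by apply: unitX; exact: unitN1.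
      by apply: unit_int => //; rewrite dvdzE /= -prime_coprime ?pl_pP.
    rewrite -mulrA -natrX -natrM -Ew.
    by rewrite [in LHS](intEsign z) intrM intrX intrN.
  have [y [b [Uy Ey]]] := zp; exists (y / F x), b; split.
    by apply: unit_div => //; exact: unit_O.
  by rewrite mulrAC -Ey -Ez mulfK ?cj_neq0.
move=> [c [d Ex]] x0.
pose n := denq c * denq d.
have n0 : n != 0 by rewrite mulf_neq0 ?denq_eq0.
have On : O (x * n%:~R).
  have -> : x * n%:~R = (numq c * denq d)%:~R + (numq d * denq c)%:~R * sq m.
    have dC (r : rat) : (denq r)%:~R != 0 :> algC by rewrite intr_eq0 denq_eq0.
    have rE (r : rat) : ratr r = (numq r)%:~R / (denq r)%:~R :> algC by [].
    by rewrite Ex !rE /n; field; rewrite !dC.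
  by apply: inOD; [|apply: inOM; [|exact: inO_sq]]; exact: inO_int.
have nC0 : n%:~R != 0 :> algC by rewrite intr_eq0.
have [y1 [b1 [U1 E1]]] := OV _ On (mulf_neq0 x0 nC0).
have [y2 [b2 [U2 E2]]] := OV _ (inO_int n) nC0.
exists (y1 / y2), b2, b1; split; first exact: unit_div.
by rewrite mulrAC -E1 E2; field; exact: unit_neq0 U2.
Qed.

Definition cj_ideal v x := O x /\ pl v (F x).

Lemma cj_ideal_prime v : prime_ideal m (cj_ideal v).
Proof.
split; last split; last split; last split; last split; last split.
- by move=> x [].
- by split; [exact: inO0 | rewrite rmorph0; exact: pl0].
- by move=> x y [? ?] [? ?]; split; [exact: inOD | rewrite rmorphD; apply: plD].
- move=> a x Oa [? ?]; split; [exact: inOM | rewrite rmorphM; apply: plM => //].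
  exact: inO_cj.
- by move=> [_]; rewrite rmorph1 => /pl1.
- move=> x y Ox Oy [_]; rewrite rmorphM => /plE[||h|h]; try exact: inO_cj.
    by left.
  by right.
- exists (pl_p v)%:R; rewrite p_neq0; split=> //; split; first exact: inO_nat.
  by rewrite rmorph_nat; exact: pl_mem.
Qed.

Lemma cj_ideal_L v x : inOP m (cj_ideal v) x -> inOP m (pl v) (F x).
Proof.
move=> [Kx [y [Oy [ny Oyx]]]]; split; first exact: inK_cj.
exists (F y); split; first exact: inO_cj.
by rewrite -rmorphM; split; [move=> h; apply: ny | exact: inO_cj].
Qed.

Lemma cj_ideal_U v x : unitOP m (cj_ideal v) x -> unitOP m (pl v) (F x).
Proof.
move=> [Lx [z [Lz E]]]; split; first exact: cj_ideal_L.
by exists (F z); rewrite -rmorphM E rmorph1; split=> //; exact: cj_ideal_L.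
Qed.

Definition local_power (k : nat) (X : algC) (P : algC -> Prop) :=
  exists u y, [/\ K u, u != 0, unitOP m P y & X = u ^+ k * y].

(* At an unramified prime the power shape of X is used at P and at the conjugate prime, since
   the conjugate of a unit at P need not be a unit at P. *)
Lemma norm_power (k : nat) (X : algC) : (0 < k)%N -> K X -> X != 0 ->
  (forall P, prime_ideal m P -> local_power k X P) ->
  exists n : rat, X * F X = ratr n ^+ k \/ X * F X = - ratr n ^+ k.
Proof.
move=> k0 KX X0 loc; have [r Er] := norm_rat F KX.
have r0 := norm_rat_neq0 X0 Er.
suff [n En] : exists n : rat, r = n ^+ k \/ r = - n ^+ k.
  by exists n; rewrite Er; case: En => ->; [left|right]; rewrite ?rmorphN rmorphXn.
apply: rat_pow_vp => // p pp; have [v Ev] := place_exists F pp.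
have [u [y [Ku u0 Uy EX]]] := loc _ (pl_prime v).
(* At a ramified place the conjugate of a unit is a unit, so [N(X)] is [N(u)^k] times a rational
   number of valuation 0. *)
have [rv|rv] := boolP (ram v).
  have [a Ea] := norm_rat F Ku; have [b Eb] := norm_rat F (unit_K Uy).
  have a0 := norm_rat_neq0 u0 Ea; have b0 := norm_rat_neq0 (unit_neq0 Uy) Eb.
  have vb : vp p b = 0.
    by rewrite -Ev; apply: unit_rat_vp => //; rewrite -Eb; apply: unitM => //; exact: ram_cjU.
  have -> : r = a ^+ k * b.
    apply: ratr_algC_inj; rewrite /= rmorphM rmorphXn /=.
    by rewrite -Er -Ea -Eb EX rmorphM rmorphXn /= exprMn; ring.
  by rewrite vpM ?expf_neq0 // vpX // vb addr0 dvdz_mulr.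
have [u2 [y2 [Ku2 u20 /cj_ideal_U Uy2 EX2]]] := loc _ (cj_ideal_prime v).
have [y3 [a [b [Uy3 E3]]]] := unram_val rv (inKM Ku (inK_cj F Ku2)) (mulf_neq0 u0 (cj_neq0 F u20)).
pose q : rat := p%:R.
have q0 : q != 0 by rewrite pnatr_eq0 -lt0n prime_gt0.
have qC : ratr q = p%:R :> algC by rewrite /q rmorph_nat.
have E : vp p (r * q ^+ (a * k) / q ^+ (b * k)) = 0.
  rewrite -Ev; apply: unit_rat_vp => //.
  have -> : ratr (r * q ^+ (a * k) / q ^+ (b * k)) = y3 ^+ k * (y * F y2) :> algC.
    rewrite fmorph_div rmorphM !rmorphXn /= qC -Er.
    have qb : p%:R ^+ (b * k) != 0 :> algC by rewrite expf_neq0 // -Ev p_neq0.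
    apply: (mulIf qb); rewrite divfK // {1}EX EX2 rmorphM rmorphXn /= !exprM -Ev.
    transitivity ((u * F u2 * (pl_p v)%:R ^+ a) ^+ k * (y * F y2)).
      by rewrite !exprMn; ring.
    by rewrite E3 exprMn; ring.
  by apply: unitM; [exact: unitX | exact: unitM].
have {}E : vp p r = k%:Z * ((b%:Z - a%:Z) * vp p q).
  move: E; rewrite !vpM ?vpV ?vpX ?mulf_neq0 ?invr_eq0 ?expf_neq0 // !PoszM; lia.
by rewrite E dvdz_mulr.
Qed.

End Ramification.


(** * Covariants, changes of model, and j as a cube *)

Definition c6 (E : wcurve) := - b2 E ^+ 3 + 36 * b2 E * b4 E - 216 * b6 E.

Lemma c4_c6_disc (E : wcurve) : c4 E ^+ 3 - c6 E ^+ 2 = 1728 * disc E.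
Proof. by case: E => *; rewrite /c4 /c6 /disc /b2 /b4 /b6 /b8 /=; ring. Qed.

(** [c4] and [c6] do not see [r], [s] and [t]; the rule for [disc] follows from them by dividing
    [c4_c6_disc] by 1728. *)
Lemma change_covariants (E E' : wcurve) (u r s t : algC) : change E E' u r s t ->
  [/\ c4 E = u ^+ 4 * c4 E', c6 E = u ^+ 6 * c6 E' & disc E = u ^+ 12 * disc E'].
Proof.
move=> [h1 h2 h3 h4 h6].
have e2 : u ^+ 2 * b2 E' = b2 E + 12 * r.
  have -> : u ^+ 2 * b2 E' = (u * a1 E') ^+ 2 + 4 * (u ^+ 2 * a2 E') by rewrite /b2; ring.
  by rewrite h1 h2 /b2; ring.
have e4 : u ^+ 4 * b4 E' = b4 E + r * b2 E + 6 * r ^+ 2.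
  have -> : u ^+ 4 * b4 E' = 2 * (u ^+ 4 * a4 E') + (u * a1 E') * (u ^+ 3 * a3 E').
    by rewrite /b4; ring.
  by rewrite h1 h3 h4 /b2 /b4; ring.
have e6 : u ^+ 6 * b6 E' = b6 E + 2 * r * b4 E + r ^+ 2 * b2 E + 4 * r ^+ 3.
  have -> : u ^+ 6 * b6 E' = (u ^+ 3 * a3 E') ^+ 2 + 4 * (u ^+ 6 * a6 E').
    by rewrite /b6; ring.
  by rewrite h3 h6 /b2 /b4 /b6; ring.
have ec4 : c4 E = u ^+ 4 * c4 E'.
  have -> : u ^+ 4 * c4 E' = (u ^+ 2 * b2 E') ^+ 2 - 24 * (u ^+ 4 * b4 E') by rewrite /c4; ring.
  by rewrite e2 e4 /c4; ring.
have ec6 : c6 E = u ^+ 6 * c6 E'.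
  have -> : u ^+ 6 * c6 E' = - (u ^+ 2 * b2 E') ^+ 3
      + 36 * (u ^+ 2 * b2 E') * (u ^+ 4 * b4 E') - 216 * (u ^+ 6 * b6 E').
    by rewrite /c6; ring.
  by rewrite e2 e4 e6 /c6; ring.
split=> //; apply: (@mulfI _ 1728); first by rewrite pnatr_eq0.
by rewrite mulrCA -!c4_c6_disc ec4 ec6; ring.
Qed.

Definition short (x y : algC) := WCurve 0 0 0 (- x / 48) (- y / 864).

Lemma c4_short x y : c4 (short x y) = x.
Proof. by rewrite /c4 /b2 /b4 /=; field. Qed.

Lemma c6_short x y : c6 (short x y) = y.
Proof. by rewrite /c6 /b2 /b4 /b6 /=; field. Qed.

(** The values of [r], [s] and [t] come from completing the square and the cube in [E']. Hence a
    curve given by its covariants is isomorphic to every model that has the rescaled covariants. *)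
Lemma change_short (E' : wcurve) (u x y : algC) :
  x = u ^+ 4 * c4 E' -> y = u ^+ 6 * c6 E' ->
  change (short x y) E' u (u ^+ 2 * b2 E' / 12) (u * a1 E' / 2) (u ^+ 3 * a3 E' / 2).
Proof.
move=> -> ->; case: E' => A1 A2 A3 A4 A6.
by rewrite /c4 /c6 /b2 /b4 /b6; split=> /=; field.
Qed.

(** This is what later arguments use of [change]; it survives a further scaling without bookkeeping
    of [r], [s] and [t]. *)
Definition covariant_scale (E E' : wcurve) (u : algC) :=
  [/\ c4 E = u ^+ 4 * c4 E', c6 E = u ^+ 6 * c6 E' & disc E = u ^+ 12 * disc E'].

Lemma cube_covariant_scale E E' u (A : int) : u != 0 -> covariant_scale E E' u ->
  c4 E ^+ 3 = A%:~R ^+ 3 * disc E -> c4 E' ^+ 3 = A%:~R ^+ 3 * disc E'.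
Proof.
move=> u0 [h4 _ hd] e4; apply: (mulfI (expf_neq0 12 u0)).
by transitivity (c4 E ^+ 3); [rewrite h4 | rewrite e4 hd]; ring.
Qed.

Definition coefs_in (R : algC -> Prop) (E : wcurve) :=
  [/\ R (a1 E), R (a2 E), R (a3 E), R (a4 E) & R (a6 E)].

Section Models.
Context {m : int} (F : quadfield m).
Local Notation K := (inK m).
Local Notation O := (inOK m).
Local Notation inL v := (inOP m (pl v)).
Local Notation unitL v := (unitOP m (pl v)).
Implicit Type v : place m.

Lemma inK_covariants E : over_K m E -> [/\ K (c4 E), K (c6 E) & K (disc E)].
Proof.
move=> [h1 h2 h3 h4 h6].
have k2 : K (b2 E) by apply: inKD; [apply: inKX | apply: inKM => //; exact: inK_nat].
have k4 : K (b4 E) by apply: inKD; apply: inKM => //; exact: inK_nat.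
have k6 : K (b6 E) by apply: inKD; [apply: inKX | apply: inKM => //; exact: inK_nat].
have kc4 : K (c4 E).
  by apply: inKB; [apply: inKX | apply: inKM => //; exact: inK_nat].
have kc6 : K (c6 E).
  apply: inKB; [apply: inKD|]; [apply/inKN/inKX| |] => //; last first.
    by apply: inKM => //; exact: inK_nat.
  by do !apply: inKM => //; exact: inK_nat.
split=> //; have -> : disc E = (c4 E ^+ 3 - c6 E ^+ 2) / 1728.
  by rewrite c4_c6_disc; field.
by apply: inK_div; [apply: inKB; apply: inKX | exact: inK_nat].
Qed.

Lemma disc_L v E : coefs_in (inL v) E -> inL v (disc E).
Proof.
move=> [h1 h2 h3 h4 h6]; rewrite /disc /b8 /b2 /b4 /b6.
by in_local.
Qed.

Lemma disc_O E : coefs_in O E -> O (disc E).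
Proof.
move=> [h1 h2 h3 h4 h6]; rewrite /disc /b8 /b2 /b4 /b6.
by in_order.
Qed.

Lemma local_model v E : everywhere_good m E -> exists E' u,
  [/\ K u, u != 0, covariant_scale E E' u, coefs_in (inL v) E' & unitL v (disc E')].
Proof.
move=> /(_ _ (pl_prime v)) [E' [[u [r [s [t [[Ku u0 _ _ _] ch]]]]] [cf Ud]]].
by exists E', u; split=> //; exact: change_covariants ch.
Qed.

Definition rescale (E : wcurve) (n : algC) :=
  WCurve (n * a1 E) (n ^+ 2 * a2 E) (n ^+ 3 * a3 E) (n ^+ 4 * a4 E) (n ^+ 6 * a6 E).

Lemma covariant_rescale E E' u n : n != 0 -> covariant_scale E E' u ->
  covariant_scale E (rescale E' n) (u / n).
Proof.
move=> n0 [h4 h6 hd]; split; rewrite ?h4 ?h6 ?hd.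
- by rewrite /c4 /b2 /b4 /=; field.
- by rewrite /c6 /b2 /b4 /b6 /=; field.
- by rewrite /disc /b8 /b2 /b4 /b6 /=; field.
Qed.

Lemma disc_rescale E n : disc (rescale E n) = n ^+ 12 * disc E.
Proof. by rewrite /disc /b8 /b2 /b4 /b6 /=; ring. Qed.

(** At a ramified place the conjugate of a denominator outside the prime is again outside it, so the
    norm of the denominator is an integer that clears it and is prime to [p]. *)
Lemma ram_denominator v x : ram v -> inL v x ->
  exists n : int, ~~ (pl_p v %| n)%Z /\ O (n%:~R * x).
Proof.
move=> rv /L_frac[a [b [Oa Ob nb ->]]]; have [n En] := norm_int F Ob.
have nfb : ~ pl v (F b) by exact: ram_cjN.
exists n; split.
  apply/negP => /pl_int; rewrite -En; exact: notP_M Ob (inO_cj F Ob) nb nfb.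
rewrite -En; have -> : b * F b * (a / b) = a * F b by field; exact: notP_neq0 nb.
by apply: inOM => //; exact: inO_cj.
Qed.

(** Scaling by an integer prime to [p] makes the model globally integral and keeps it good at [v],
    so its discriminant has an integral norm. The extra factor [k] is 2 at the prime 3, where it
    removes the denominator of [om], and 1 at the prime 2. *)
Lemma ram_local_model v E (k : int) : ram v -> ~~ (pl_p v %| k)%Z -> everywhere_good m E ->
  exists E' u,
  [/\ K u, u != 0, covariant_scale E E' u,
      coefs_in (fun x => exists y, O y /\ x = k%:~R * y) E' & unitL v (disc E')].
Proof.
move=> rv nk /(local_model v)[E' [u [Ku u0 cs [h1 h2 h3 h4 h6] Ud]]].
have [n1 [d1 o1]] := ram_denominator rv h1.
have [n2 [d2 o2]] := ram_denominator rv h2.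
have [n3 [d3 o3]] := ram_denominator rv h3.
have [n4 [d4 o4]] := ram_denominator rv h4.
have [n6 [d6 o6]] := ram_denominator rv h6.
have [n dn] : exists n : int, n = k * (n1 * n2 * n3 * n4 * n6) by eexists.
have nn : ~~ (pl_p v %| n)%Z.
  by rewrite dn !prime_dvdzM ?pl_pP // !negb_or nk d1 d2 d3 d4 d6.
have n0 : n%:~R != 0 :> algC by rewrite intr_eq0; apply: contraNneq nn => ->.
have aux i (a x : int) y : n = k * (a * x) -> O (x%:~R * y) ->
    exists z, O z /\ n%:~R ^+ i.+1 * y = k%:~R * z.
  move=> En Oy; exists (n%:~R ^+ i * (a%:~R * (x%:~R * y))); split.
    by apply: inOM; [apply: inOX; exact: inO_int | apply: inOM => //; exact: inO_int].
  by rewrite exprS {1}En; ring.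
exists (rescale E' n%:~R), (u / n%:~R); split.
- by apply: inK_div => //; exact: inK_int.
- by rewrite mulf_neq0 ?invr_eq0.
- exact: covariant_rescale.
- split=> /=.
  + have [|z Hz] := aux 0%N (n2 * n3 * n4 * n6) n1 (a1 E') _ o1; last by exists z.
    by rewrite dn; ring.
  + by apply: (aux 1%N (n1 * n3 * n4 * n6) n2 _ _ o2); rewrite dn; ring.
  + by apply: (aux 2%N (n1 * n2 * n4 * n6) n3 _ _ o3); rewrite dn; ring.
  + by apply: (aux 3%N (n1 * n2 * n3 * n6) n4 _ _ o4); rewrite dn; ring.
  + by apply: (aux 5%N (n1 * n2 * n3 * n4) n6 _ _ o6); rewrite dn; ring.
- by rewrite disc_rescale; apply: unitM => //; apply/unitX/unit_int.
Qed.

(** The factors [p] are peeled off one at a time, so it does no harm if [p] ramifies and is not a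
    uniformizer. *)
Lemma pow_dvd v (e : nat) (n : int) x y : inL v x -> unitL v y ->
  (pl_p v)%:R ^+ e * x = n%:~R * y -> ((pl_p v)%:Z ^+ e %| n)%Z.
Proof.
move=> Lx Uy; elim: e n => [|e IH] n E; first by rewrite expr0 dvd1z.
have : inM v (n%:~R * y).
  rewrite -E exprS -mulrA; apply: MLr; last exact/M_P/pl_mem.
  by apply: LM => //; apply/LX/L_nat.
case/(ME (L_int _ _) (unit_L Uy)); last by move/(unit_notM Uy).
move/M_int/dvdzP => [q Eq]; rewrite Eq exprSr dvdz_mul // IH //.
by apply: (mulfI (p_neq0 v)); rewrite mulrA -exprS E Eq intrM; ring.
Qed.

Lemma disc_norm E : elliptic_over m E -> everywhere_good m E ->
  exists n : rat, disc E * F (disc E) = ratr n ^+ 12 \/ disc E * F (disc E) = - ratr n ^+ 12.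
Proof.
move=> [ov d0] eg; apply: norm_power => //; first by have [_ _] := inK_covariants ov.
move=> P /(prime_ideal_place F)[v <-].
have [E' [u [Ku u0 [_ _ Ed] _ Ud]]] := local_model v eg.
by exists u, (disc E').
Qed.

(** A prime in the denominator of [j] is excluded by a good model above it. Norms give
    [N(c4)^3 = j^2 N(disc)], where [N(disc)] is a 12th power up to sign; so for nonzero [j] the
    square [j^2] is a cube [q^3], and [j = (j / q)^3]. *)
Lemma j_cube E : elliptic_over m E -> rational_j E -> everywhere_good m E ->
  exists A : int, c4 E ^+ 3 = A%:~R ^+ 3 * disc E.
Proof.
move=> el [j Ej] eg; have [ov d0] := el; have [kc4 _ kd] := inK_covariants ov.
have [z Ez] : exists z : int, j = z%:~R.
  have d1 : denq j = 1.
    apply/eqP; rewrite -(gez0_abs (ltW (denq_gt0 j))) eqz_nat eqn_leq.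
    rewrite lt0n absz_eq0 denq_eq0 andbT leqNgt; apply/negP => d2.
    have [v Ev] := place_exists F (pdiv_prime d2).
    have [E' [u [Ku u0 [e4 _ ed] cf Ud]]] := local_model v eg.
    have Lj : inL v (ratr j).
      have -> : ratr j = c4 E' ^+ 3 / disc E'.
        apply: (mulIf (unit_neq0 Ud)); rewrite divfK ?(unit_neq0 Ud) //.
        apply: (mulfI (expf_neq0 12 u0)); rewrite mulrCA -ed -Ej e4; ring.
      apply: LM; last exact: unit_LV.
      apply: LX; have [h1 h2 h3 h4 h6] := cf; rewrite /c4 /b2 /b4.
      by in_local.
    by have := L_rat Lj; rewrite Ev dvdzE /= pdiv_dvd.
  by exists (numq j); rewrite -[LHS]divq_num_den d1 divr1.
have [n En] := disc_norm el eg; have [r Er] := norm_rat F kc4.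
have EN : ratr r ^+ 3 = ratr j ^+ 2 * (disc E * F (disc E)).
  rewrite -Er exprMn -rmorphXn /= Ej rmorphM /= fmorph_rat; ring.
have [j0|j0] := eqVneq j 0.
  by exists 0; rewrite Ej j0 rmorph0 expr0n !mul0r.
have n0 : n != 0.
  apply: contraNneq (mulf_neq0 d0 (cj_neq0 F d0)) => n0.
  by case: En => ->; rewrite n0 rmorph0 expr0n ?oppr0.
have [s Es] : exists s : rat, j = s ^+ 3.
  have [q [q0 Eq]] : exists q : rat, q != 0 /\ j ^+ 2 = q ^+ 3.
    have [e [e0 Ee]] : exists e : rat, e != 0 /\ r ^+ 3 = j ^+ 2 * (e * n ^+ 4) ^+ 3.
      case: En EN => -> EN; [exists 1 | exists (-1)]; split=> //; apply: ratr_algC_inj; move: EN.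
        by move=> E3; transitivity (ratr r ^+ 3 : algC); [|rewrite E3]; ring.
      by move=> E3; transitivity (ratr r ^+ 3 : algC); [|rewrite E3]; ring.
    have en0 : e * n ^+ 4 != 0 by rewrite mulf_neq0 ?expf_neq0.
    exists (r / (e * n ^+ 4)).
    have E2 : (r / (e * n ^+ 4)) ^+ 3 = j ^+ 2 by rewrite expr_div_n Ee mulfK ?expf_neq0.
    split=> //; apply: contraNneq (expf_neq0 2 j0) => h.
    by rewrite -E2 h expr0n.
  by exists (j / q); rewrite expr_div_n -Eq; field.
have [A EA] : exists A : int, s = A%:~R by apply: (@rat_int_exp 3 z) => //; rewrite -Es.
by exists A; rewrite Ej Es EA rmorphXn /= ratr_int.
Qed.

End Models.


(** * The condition on A at 3 *)

(** With [A = 3 a] the hypothesis is [a^3 = 64] modulo 27, which means [a = 4] modulo 9. *)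
Lemma cube_1728_mod729 (A : int) :
  (3 %| A)%Z -> (729 %| A ^+ 3 - 1728)%Z -> (27 %| A - 12)%Z.
Proof.
move=> /dvdzP[a ->] /dvdzP[k Ek].
have [h [r [Ea hr]]] : exists h r, a = 9 * h + r /\ 0 <= r <= 8.
  by exists (a %/ 9)%Z, (a %% 9)%Z; lia.
have {}Ek : (9 * h + r) ^+ 3 - 64 = 27 * k by rewrite -Ea; lia.
have : r = 4.
  move: Ek; have : r \in [:: 0; 1; 2; 3; 4; 5; 6; 7; 8] by rewrite !inE; lia.
  by rewrite !inE => /or4P[/eqP->|/eqP->|/eqP->|
       /or4P[/eqP->|/eqP->|/eqP->|/or3P[/eqP->|/eqP->|/eqP->]]]; lia.
by rewrite Ea => ->; lia.
Qed.

Lemma nmod3_sqr (y : int) : ~~ (3 %| y)%Z -> exists c, y ^+ 2 = 3 * c + 1.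
Proof.
move=> ny; have [h Eh] : exists h, y = 3 * h + 1 \/ y = 3 * h + 2.
  by exists (y %/ 3)%Z; lia.
case: Eh => ->; first by exists (3 * h ^+ 2 + 2 * h); ring.
by exists (3 * h ^+ 2 + 4 * h + 1); ring.
Qed.

Lemma nmod3_cube (y : int) : ~~ (3 %| y)%Z ->
  exists c e, y ^+ 3 = 9 * c + e /\ (e = 1 \/ e = -1).
Proof.
move=> ny; have [h Eh] : exists h, y = 3 * h + 1 \/ y = 3 * h - 1.
  by exists ((y + 1) %/ 3)%Z; lia.
case: Eh => ->; first by exists (3 * h ^+ 3 + 3 * h ^+ 2 + h), 1; split; [ring|left].
by exists (3 * h ^+ 3 - 3 * h ^+ 2 + h), (-1); split; [ring|right].
Qed.

(** Everything is read modulo 9, where [k^12 = 1] and the right side is [7 s]. If 3 divides [x] the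
    left side is 0. Otherwise [x^3] is a sign [u] and the left side is
    [(3 m' + 4 u)^2 = 6 m' u + 7], which is neither 7 nor -7 because 3 does not divide [m']. *)
Lemma ramified3_norm_mod9 (m' x Y e f s k : int) :
  ~~ (3 %| m')%Z -> ~~ (3 %| Y)%Z -> ~~ (3 %| k)%Z -> (s = 1 \/ s = -1) ->
  (3 * m' * Y ^+ 2 * x ^+ 2 - 32 * x ^+ 3 + 9 * e) ^+ 2 - 3 * m' * (3 * f) ^+ 2
    = 16 * (s * k ^+ 12) -> False.
Proof.
move=> nm nY nk hs.
have [c Ec] := nmod3_sqr nY.
have [k3 [t [Ek ht]]] := nmod3_cube nk.
have {Ek}[k12 Ek] : exists q, k ^+ 12 = 9 * q + 1.
  exists (729 * k3 ^+ 4 + 324 * k3 ^+ 3 * t + 54 * k3 ^+ 2 + 4 * k3 * t).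
  have -> : k ^+ 12 = (k ^+ 3) ^+ 4 by ring.
  by rewrite Ek; case: ht => ->; ring.
have [x3|nx] := boolP (3 %| x)%Z.
  have /dvdzP[y ->] := x3; rewrite Ek.
  have -> : (3 * m' * Y ^+ 2 * (y * 3) ^+ 2 - 32 * (y * 3) ^+ 3 + 9 * e) ^+ 2
      - 3 * m' * (3 * f) ^+ 2
    = 9 * (9 * (3 * m' * Y ^+ 2 * y ^+ 2 - 96 * y ^+ 3 + e) ^+ 2 - 3 * m' * f ^+ 2) by ring.
  by move: (9 * _ ^+ 2 - _) => T; case: hs => ->; lia.
have [d Ed] := nmod3_sqr nx; have [g [u [Eg hu]]] := nmod3_cube nx.
rewrite Ec Ed Eg Ek.
have -> : 3 * m' * (3 * c + 1) * (3 * d + 1) - 32 * (9 * g + u) + 9 * e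
   = 9 * (m' * (3 * c * d + c + d) - 32 * g - 4 * u + e) + (3 * m' + 4 * u) by ring.
move: (_ + e) => w.
have -> : (9 * w + (3 * m' + 4 * u)) ^+ 2 - 3 * m' * (3 * f) ^+ 2
  = 9 * (9 * w ^+ 2 + 2 * w * (3 * m' + 4 * u) + m' ^+ 2 - 3 * m' * f ^+ 2)
    + 24 * m' * u + 16 * u ^+ 2 by ring.
move: (9 * w ^+ 2 + _ + _ - _) => T; move: nm hu hs; clear=> nm hu hs.
by case: hu => ->; case: hs => ->; lia.
Qed.

Section ThreeAdic.
Context {m : int} (F : quadfield m).
Local Notation K := (inK m).
Local Notation O := (inOK m).
Local Notation inL v := (inOP m (pl v)).
Local Notation unitL v := (unitOP m (pl v)).
Implicit Type v : place m.

Lemma b_covariants_L v E : coefs_in (inL v) E -> [/\ inL v (b2 E), inL v (b4 E) & inL v (b6 E)].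
Proof.
move=> [h1 h2 h3 h4 h6]; rewrite /b2 /b4 /b6.
by split; in_local.
Qed.

Lemma M_nat v (n k : nat) : pl_p v = n -> inM v (n * k)%:R.
Proof.
move=> Ev; apply/M_P/(pl_int v (n * k)%N%:Z).
by rewrite Ev dvdzE /= dvdn_mulr.
Qed.

Lemma dvd_cube_covariant v E (A : int) :
  coefs_in (inL v) E -> c4 E ^+ 3 = A%:~R ^+ 3 * disc E -> (pl_p v %| A)%Z -> inM v (c4 E).
Proof.
move=> cf e4 pA; have [h2 h4 h6] := b_covariants_L cf.
apply: (@MX _ _ _ 3).
  by rewrite /c4; in_local.
rewrite e4; apply: MLr; first exact: disc_L.
by rewrite -intrX; apply/M_int; rewrite exprS dvdz_mulr.
Qed.

(** [b2 = 3 y] makes [c6] equal to 27 times a local integer, so [3^6] divides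
    [c6^2 / disc = A^3 - 1728]. *)
Lemma three_adic_div v E (A : int) (y : algC) : pl_p v = 3%N ->
  coefs_in (inL v) E -> unitL v (disc E) -> c4 E ^+ 3 = A%:~R ^+ 3 * disc E ->
  (3 %| A)%Z -> inL v y -> b2 E = 3 * y -> (27 %| A - 12)%Z.
Proof.
move=> Ev cf Ud e4 A3 Ly Eb; apply: cube_1728_mod729 => //.
have [h2 h4 h6] := b_covariants_L cf.
have := @pow_dvd _ v 6 (A ^+ 3 - 1728) ((- y ^+ 3 + 4 * y * b4 E - 8 * b6 E) ^+ 2) (disc E).
rewrite Ev; apply=> //.
  by in_local.
have : c6 E ^+ 2 = (A%:~R ^+ 3 - 1728) * disc E.
  by rewrite mulrBl -e4 -c4_c6_disc; ring.
rewrite intrB intrX => <-; rewrite /c6 Eb; ring.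
Qed.

(** Rescaling divides the norm by a rational 12th power, and integrality of the new model forces the
    remaining 12th root to be an integer. *)
Lemma norm_disc_int E E' u (n : rat) : K u -> u != 0 -> covariant_scale E E' u ->
  coefs_in O E' ->
  (disc E * F (disc E) = ratr n ^+ 12 \/ disc E * F (disc E) = - ratr n ^+ 12) ->
  exists s k : int, (s = 1 \/ s = -1) /\ disc E' * F (disc E') = (s * k ^+ 12)%:~R.
Proof.
move=> Ku u0 [_ _ ->] cf hn.
have [z Ez] := norm_int F (disc_O cf); have [r Er] := norm_rat F Ku.
have r0 : ratr r != 0 :> algC by rewrite -Er mulf_neq0 ?cj_neq0.
have [s [hs Es]] : exists s : int, (s = 1 \/ s = -1) /\
    disc E' * F (disc E') = s%:~R * ratr (n / r) ^+ 12.
  have E2 x : u ^+ 12 * disc E' * F (u ^+ 12 * disc E') = x ->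
      disc E' * F (disc E') = x / ratr r ^+ 12.
    have -> : F (u ^+ 12 * disc E') = F u ^+ 12 * F (disc E').
      by rewrite rmorphM; congr (_ * _); exact: rmorphXn.
    move=> <-; rewrite -Er; move: (cj_neq0 F u0); move: (F u) (F (disc E')) => a b a0.
    by field; rewrite u0 a0.
  have Enr : ratr (n / r) = ratr n / ratr r :> algC by exact: fmorph_div.
  case: hn => /E2 ->; [exists 1 | exists (-1)]; (split; first by [left|right]);
  by rewrite Enr; field.
have [k Ek] : exists k : int, n / r = k%:~R.
  apply: (@rat_int_exp 12 (s * z)) => //.
  apply: ratr_algC_inj; rewrite /= ratr_int rmorphXn /=.
  by rewrite intrM -Ez Es; case: hs => ->; ring.
by exists s, k; split=> //; rewrite Es Ek ratr_int intrM intrX.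
Qed.

(* If 3 did not divide b2, the norm of 4 disc, which is 16 times a 12th power up to sign, would
   have a forbidden residue modulo 9. *)
Lemma three_adic_ram_contra v E E' u (n : rat) : pl_p v = 3%N -> ram v ->
  K u -> u != 0 -> covariant_scale E E' u ->
  coefs_in (fun x => exists y, O y /\ x = 2%:~R * y) E' -> unitL v (disc E') ->
  (disc E * F (disc E) = ratr n ^+ 12 \/ disc E * F (disc E) = - ratr n ^+ 12) ->
  inM v (b2 E') -> exists y, O y /\ b2 E' = 3 * y.
Proof.
move=> Ev rv Ku u0 cs cf Ud hn Mb2.
have [m' [Em nm']] : exists m', m = 3 * m' /\ ~~ (3 %| m')%Z.
  have m3 : (3 %| m)%Z by move: rv; rewrite ram_odd Ev.
  have /dvdzP[m' Em'] := m3; exists m'; split; first by rewrite mulrC.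
  apply/negP => /dvdzP[q Eq].
  by have := @squarefree_sqr m 3 q (qf_sqf F); rewrite Em' Eq => h; have := h _; lia.
have sqf : sq m ^+ 2 = 3 * m'%:~R by rewrite sq2 {1}Em intrM.
have coord x : (exists y, O y /\ x = 2%:~R * y) ->
    exists a b : int, x = a%:~R + b%:~R * sq m.
  move=> [y [/(inO_coord F)[a [b ->]] ->]].
  case: (tau_nu_cases m) => -[_ _ _ ->].
    by exists (2 * a + b), b; field.
  by exists (2 * a), (2 * b); ring.
have cfO : coefs_in O E'.
  have h x : (exists y, O y /\ x = 2%:~R * y) -> O x.
    by move=> [y [Oy ->]]; apply: inOM => //; exact: inO_int.
  by case: cf => *; split; apply: h.
have [s [k [hs Ek]]] := norm_disc_int Ku u0 cs cfO hn.
case: cf => [[y1 [o1 e1]] [y2 [o2 e2]] [y3 [o3 e3]] [y4 [o4 e4]] [y6 [o6 e6]]].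
have [X0 [Y E2]] : exists a b : int, b2 E' = a%:~R + b%:~R * sq m.
  apply: coord; exists (2 * y1 ^+ 2 + 4 * y2); split; first by in_order.
  by rewrite /b2 e1 e2; ring.
have [x [y E4]] : exists a b : int, b4 E' = a%:~R + b%:~R * sq m.
  apply: coord; exists (2 * y4 + 2 * y1 * y3); split; first by in_order.
  by rewrite /b4 e1 e3 e4; ring.
have [z [w E6]] : exists a b : int, b6 E' = a%:~R + b%:~R * sq m.
  apply: coord; exists (2 * y3 ^+ 2 + 4 * y6); split; first by in_order.
  by rewrite /b6 e3 e6; ring.
have OZ (a b : int) : O (a%:~R + b%:~R * sq m).
  by apply: inOD; [|apply: inOM; [|exact: inO_sq]]; exact: inO_int.
have /dvdzP[X EX] : (3 %| X0)%Z.
  have : (pl_p v %| X0 ^+ 2 - m * Y ^+ 2)%Z.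
    apply/pl_int; rewrite -(norm_sq_coord F).
    apply: plMr; first exact/inO_cj.
    by apply: P_M => //; rewrite -E2.
  rewrite Ev => h; apply: (@prime_dvdzX 3 X0 2) => //; move: h.
  by rewrite Em -mulrA rpredBr // dvdz_mulr.
have [/dvdzP[Y' EY]|nY] := boolP (3 %| Y)%Z.
  by exists (X%:~R + Y'%:~R * sq m); rewrite E2 EX EY !intrM; split=> //; ring.
have nk : ~~ (3 %| k)%Z.
  apply/negP => k3; have := unit_notM (unitM Ud (ram_cjU F rv Ud)); apply; rewrite Ek.
  by apply/M_int; rewrite Ev dvdz_mull // exprS dvdz_mulr.
(* [e] and [f] are what remains, after division by 9 and by 3, of the two coordinates of [4 disc =
   b2^2 b4^2 - 32 b4^3 + 36 b2 b4 b6 - b2^3 b6 - 108 b6^2] at [b2 = 3 X + Y sq m]. This expression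
   of [4 disc] uses [4 b8 = b2 b6 - b4^2]. *)
pose e := X ^+ 2 * (x ^+ 2 + 3 * m' * y ^+ 2) + m' ^+ 2 * Y ^+ 2 * y ^+ 2
  + 4 * m' * X * Y * x * y - 32 * m' * x * y ^+ 2
  + 4 * (3 * X * (x * z + 3 * m' * y * w) + 3 * m' * Y * (x * w + y * z))
  - (3 * X ^+ 3 + 3 * m' * X * Y ^+ 2) * z - (9 * X ^+ 2 * Y + m' * Y ^+ 3) * m' * w
  - 12 * (z ^+ 2 + 3 * m' * w ^+ 2).
pose f := (3 * X ^+ 2 + m' * Y ^+ 2) * 2 * x * y + 2 * X * Y * (x ^+ 2 + 3 * m' * y ^+ 2)
  - 32 * (x ^+ 2 * y + m' * y ^+ 3)
  + 12 * (3 * X * (x * w + y * z) + Y * (x * z + 3 * m' * y * w))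
  - (9 * X ^+ 3 + 9 * m' * X * Y ^+ 2) * w - (9 * X ^+ 2 * Y + m' * Y ^+ 3) * z
  - 72 * z * w.
have E4d : 4 * disc E' = (3 * m' * Y ^+ 2 * x ^+ 2 - 32 * x ^+ 3 + 9 * e)%:~R
    + (3 * f)%:~R * sq m.
  have -> : 4 * disc E' = b2 E' ^+ 2 * b4 E' ^+ 2 - 32 * b4 E' ^+ 3
     + 36 * b2 E' * b4 E' * b6 E' - b2 E' ^+ 3 * b6 E' - 108 * b6 E' ^+ 2.
    by rewrite /disc /b8 /b2 /b4 /b6; ring.
  by rewrite E2 E4 E6 EX /e /f; ring: sqf.
case: (@ramified3_norm_mod9 m' x Y e f s k) => //.
rewrite -[X in _ - X * (3 * f) ^+ 2]Em; apply: (@intr_inj algC); rewrite -(norm_sq_coord F) -E4d rmorphM rmorph_nat /=.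
by rewrite [in RHS]intrM -Ek; ring.
Qed.

Lemma three_adic E (A : int) : elliptic_over m E -> everywhere_good m E ->
  c4 E ^+ 3 = A%:~R ^+ 3 * disc E -> (3 %| A)%Z -> (27 %| A - 12)%Z.
Proof.
move=> el eg e4 A3; have [v Ev] := @place_exists m F 3 isT.
have [n En] := disc_norm F el eg.
have key E' u : u != 0 -> covariant_scale E E' u -> coefs_in (inL v) E' ->
    unitL v (disc E') -> c4 E' ^+ 3 = A%:~R ^+ 3 * disc E' /\ inM v (b2 E').
  move=> u0 cs cf Ud.
  have e4' := cube_covariant_scale u0 cs e4.
  split=> //; apply: (@MX _ _ _ 2); first by case: (b_covariants_L cf).
  have -> : b2 E' ^+ 2 = c4 E' + (3 * 8)%:R * b4 E' by rewrite /c4; ring.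
  apply: MD; first by apply: (dvd_cube_covariant cf e4'); rewrite Ev.
  by apply: MLr; [case: (b_covariants_L cf) | apply: M_nat].
have [rv|rv] := boolP (ram v); last first.
  have [E' [u [Ku u0 cs cf Ud]]] := local_model v eg.
  have [e4' Mb2] := key E' u u0 cs cf Ud.
  have [y [Ly Ey]] := unram_M F rv Mb2; rewrite Ev in Ey.
  exact: three_adic_div Ev cf Ud e4' A3 Ly Ey.
have n2 : ~~ (pl_p v %| 2)%Z by rewrite Ev.
have [E' [u [Ku u0 cs cf Ud]]] := ram_local_model F rv n2 eg.
have cfL : coefs_in (inL v) E'.
  have h x : (exists y, O y /\ x = 2%:~R * y) -> inL v x.
    by move=> [y [Oy ->]]; apply/L_O/inOM => //; exact: inO_int.
  by case: cf => *; split; apply: h.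
have [e4' Mb2] := key E' u u0 cs cfL Ud.
have [y [Oy Ey]] := three_adic_ram_contra Ev rv Ku u0 cs cf Ud En Mb2.
exact: three_adic_div Ev cfL Ud e4' A3 (L_O v Oy) Ey.
Qed.

End ThreeAdic.


(** * The condition on A at 2, and the shape of c6 there *)

Lemma odd_sqr (x : int) : ~~ (2 %| x)%Z -> exists c, x ^+ 2 = 8 * c + 1.
Proof.
move=> nx; have [y ->] : exists y, x = 2 * y + 1 by exists (x %/ 2)%Z; lia.
have [z Ez] : exists z, y * (y + 1) = 2 * z.
  have [z [->|->]] : exists z, y = 2 * z \/ y = 2 * z + 1 by exists (y %/ 2)%Z; lia.
    by exists (z * (2 * z + 1)); ring.
  by exists ((2 * z + 1) * (z + 1)); ring.
exists z; have -> : (2 * y + 1) ^+ 2 = 4 * (y * (y + 1)) + 1 by ring.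
by rewrite Ez; ring.
Qed.

Lemma odd_exp12 (x : int) : ~~ (2 %| x)%Z -> exists c, x ^+ 12 = 8 * c + 1.
Proof.
move=> nx; have -> : x ^+ 12 = (x ^+ 6) ^+ 2 by ring.
by apply: odd_sqr; apply: contra nx; exact: (@prime_dvdzX 2 x 6).
Qed.

Lemma dvdz_pexp2r (a b : int) (k : nat) : (0 < k)%N -> (a ^+ k %| b ^+ k)%Z = (a %| b)%Z.
Proof. by move=> k0; rewrite !dvdzE !abszX dvdn_pexp2r. Qed.

Lemma odd_dvd8 (D t n : int) : ~~ (2 %| D)%Z -> D * t ^+ 2 = 64 * n -> (8 %| t)%Z.
Proof.
move=> nD E; have [B EB] : exists B : int, B = 8 by exists 8.
rewrite -EB -(@dvdz_pexp2r B t 2) //.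
have h : (B ^+ 2 %| D * t ^+ 2)%Z by apply/dvdzP; exists n; rewrite E EB; ring.
rewrite -(@Gauss_dvdzr _ D) // coprimezE abszX coprime_pexpl // EB.
by rewrite (@coprime_pexpl 3 2) // prime_coprime.
Qed.

(** Since [2^12 = 4^6] and [k] is odd, [4^6] divides [A^6]; as [N] is odd no further factor 2 is
    left in [A]. *)
Lemma quarter_of_norm (A N s k : int) : (s = 1 \/ s = -1) -> ~~ (2 %| k)%Z -> ~~ (2 %| N)%Z ->
  2 ^+ 12 * N ^+ 3 = A ^+ 6 * (s * k ^+ 12) ->
  exists A', [/\ A = 4 * A', ~~ (2 %| A')%Z & N ^+ 3 = A' ^+ 6 * (s * k ^+ 12)].
Proof.
move=> hs nk nN E.
have d4 : (4 %| A)%Z.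
  have [B EB] : exists B : int, B = 4 by exists 4.
  rewrite -EB -(@dvdz_pexp2r B A 6) //.
  have h : (B ^+ 6 %| A ^+ 6 * k ^+ 12)%Z.
    apply/dvdzP; exists (s * N ^+ 3).
    have -> : s * N ^+ 3 * B ^+ 6 = s * (2 ^+ 12 * N ^+ 3) by rewrite EB; ring.
    by rewrite E; case: hs => ->; ring.
  rewrite -(@Gauss_dvdzl _ _ (k ^+ 12)) // coprimezE !abszX coprime_pexpl // coprime_pexpr //.
  by rewrite EB (@coprime_pexpl 2 2) // prime_coprime.
have /dvdzP[A' EA] := d4; exists A'.
have E' : N ^+ 3 = A' ^+ 6 * (s * k ^+ 12).
  have n0 : 2 ^+ 12 != 0 :> int by rewrite expf_neq0.
  by apply: (mulfI n0); rewrite E EA; ring.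
have A'4 : A = 4 * A' by rewrite EA mulrC.
split=> //; apply: contra nN => dA; apply: (@prime_dvdzX 2 N 3 isT).
by rewrite E' exprS -!mulrA dvdz_mulr.
Qed.

Lemma int_parity (x : int) : exists y, x = 2 * y \/ x = 2 * y + 1.
Proof. by exists (x %/ 2)%Z; lia. Qed.

Lemma odd_half (x : int) : ~~ (2 %| x)%Z -> exists y, x = 2 * y + 1.
Proof. by exists (x %/ 2)%Z; lia. Qed.

(* The norm of c4 / 4 when 2 ramifies, m = 3 mod 4 and 2 does not divide a1; cube_five_mod8 rules
   this case out. *)
Lemma mod4_three_norm_mod8 (h R S T V m : int) : m = 4 * h + 3 ->
  exists n, (4 * R ^+ 2 + m * (2 * S + 1) ^+ 2 - 12 * T - 6) ^+ 2
   - m * (4 * R * (2 * S + 1) - 12 * V - 6) ^+ 2 = 8 * n + 5.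
Proof.
move=> Em; set G := (X in X ^+ 2 - _); set H := 4 * R * _ - _ - _.
have [g Eg] : exists g, G ^+ 2 = 8 * g + 1.
  apply: odd_sqr; rewrite /G Em; apply/negP => /dvdzP[q].
  have -> : (2 * S + 1) ^+ 2 = 2 * (2 * S ^+ 2 + 2 * S) + 1 by ring.
  by move: (2 * S ^+ 2 + 2 * S) (R ^+ 2) => u u'; clear; lia.
have [e Ee] : exists e, (2 * R * (2 * S + 1) - 6 * V - 3) ^+ 2 = 8 * e + 1.
  apply: odd_sqr; apply/negP => /dvdzP[q].
  have -> : 2 * R * (2 * S + 1) = 2 * (R * (2 * S + 1)) by ring.
  by clear; lia.
exists (g - 4 * m * e - 2 * h - 2).
have -> : H ^+ 2 = 4 * (2 * R * (2 * S + 1) - 6 * V - 3) ^+ 2 by rewrite /H; ring.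
by rewrite Eg Ee Em; ring.
Qed.

(** Modulo 8 the left side is [5^3 = 5], while even powers of odd numbers are 1 and the right side
    is [s]. *)
Lemma cube_five_mod8 (A N n s k : int) : ~~ (2 %| A)%Z -> ~~ (2 %| k)%Z ->
  (s = 1 \/ s = -1) -> N = 8 * n + 5 -> N ^+ 3 = A ^+ 6 * (s * k ^+ 12) -> False.
Proof.
move=> nA nk hs -> E; have [c Ec] := odd_exp12 nk.
have [a Ea] : exists a, A ^+ 6 = 8 * a + 1.
  have -> : A ^+ 6 = (A ^+ 3) ^+ 2 by ring.
  by apply: odd_sqr; apply: contra nA; exact: (@prime_dvdzX 2 A 3).
have : 8 * (64 * n ^+ 3 + 120 * n ^+ 2 + 75 * n + 15) + 5 = s * (8 * (8 * a * c + a + c) + 1).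
  transitivity ((8 * n + 5) ^+ 3); first by ring.
  by rewrite E Ea Ec; ring.
move: (64 * _ + _ + _ + _) (8 * a * c + a + c) hs => u w hs; clear -hs.
by case: hs => ->; lia.
Qed.

Section TwoAdic.
Context {m : int} (F : quadfield m).
Local Notation O := (inOK m).
Local Notation inL v := (inOP m (pl v)).
Local Notation unitL v := (unitOP m (pl v)).
Implicit Type v : place m.

Definition half_c4 (E : wcurve) (y : algC) :=
  (y ^+ 2 + a2 E) ^+ 2 - 3 * (a4 E + y * a3 E).

Lemma half_c4E E y : a1 E = 2 * y -> c4 E = 16 * half_c4 E y.
Proof. by move=> h; rewrite /c4 /half_c4 /b2 /b4 h; ring. Qed.

(** Chosen so that [c6 / 8] is visibly the square [a3^2] modulo 4 when [a1 = 2 y]. In the same way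
    [odd_c6] exhibits [- c6] as the square of [a1^3] modulo 4, which is used for odd [A]. *)
Definition half_c6 (E : wcurve) (y : algC) :=
  - 2 * (y ^+ 2 + a2 E) ^+ 3 + 9 * (y ^+ 2 + a2 E) * (a4 E + y * a3 E)
  - 7 * a3 E ^+ 2 - 27 * a6 E.

Lemma half_c6E E y : a1 E = 2 * y -> c6 E = 8 * (a3 E ^+ 2 + 4 * half_c6 E y).
Proof. by move=> h; rewrite /c6 /half_c6 /b2 /b4 /b6 h; ring. Qed.

Definition odd_c6 (E : wcurve) :=
  3 * a1 E ^+ 4 * a2 E + 12 * a1 E ^+ 2 * a2 E ^+ 2 + 16 * a2 E ^+ 3
  - 9 * b2 E * b4 E + 54 * b6 E.

Lemma odd_c6E E : c6 E = - ((a1 E ^+ 3) ^+ 2 + 4 * odd_c6 E).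
Proof. by rewrite /c6 /odd_c6 /b2 /b4 /b6; ring. Qed.

Lemma half_c46_L v E y : coefs_in (inL v) E -> inL v y ->
  inL v (half_c4 E y) /\ inL v (half_c6 E y).
Proof.
move=> [h1 h2 h3 h4 h6] hy; rewrite /half_c4 /half_c6.
by split; in_local.
Qed.

Lemma half_c6_O E y : coefs_in O E -> O y -> O (half_c6 E y).
Proof.
move=> [h1 h2 h3 h4 h6] hy; rewrite /half_c6.
by in_order.
Qed.

Lemma odd_c6_L v E : coefs_in (inL v) E -> inL v (odd_c6 E).
Proof.
move=> [h1 h2 h3 h4 h6]; rewrite /odd_c6 /b2 /b4 /b6.
by in_local.
Qed.

Lemma odd_c6_O E : coefs_in O E -> O (odd_c6 E).
Proof.
move=> [h1 h2 h3 h4 h6]; rewrite /odd_c6 /b2 /b4 /b6.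
by in_order.
Qed.

Section RamifiedTwo.
Context (v : place m) (p2 : pl_p v = 2%N) (rv : ram v).

Lemma ram2_m : (m %% 4)%Z <> 1 /\ om m = sq m.
Proof.
move: rv; rewrite /ram p2; case: (tau_nu_cases m) => -[h -> h' h'']; last by split.
by move=> h3; exfalso; lia.
Qed.

Lemma ram2_coord x : O x -> exists a b : int, x = a%:~R + b%:~R * sq m.
Proof. by move/(inO_coord F) => [a [b ->]]; exists a, b; case: ram2_m => _ ->. Qed.

Lemma ram2_O (a b : int) : O (a%:~R + b%:~R * sq m).
Proof. by case: ram2_m => _ <-; exact: inO_mk. Qed.

(** Conjugation preserves a ramified prime, so membership can be read off the norm. *)
Lemma ram2_M (a b : int) : inM v (a%:~R + b%:~R * sq m) <-> (2 %| a ^+ 2 - m * b ^+ 2)%Z.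
Proof.
have -> : (2 %| a ^+ 2 - m * b ^+ 2)%Z = (pl_p v %| a ^+ 2 - m * b ^+ 2)%Z by rewrite p2.
rewrite -pl_int -(norm_sq_coord F).
have Ox := ram2_O a b; split=> [/(P_M Ox)|].
  by apply: plMr; exact: inO_cj.
case/(plE Ox (inO_cj F Ox)); first exact: M_P.
by move/(ram_cj F rv); rewrite (cjK F (inO_K Ox)); exact: M_P.
Qed.

End RamifiedTwo.

(* The covariants of a model at a ramified prime above 2 with a1 not divisible by 2; this occurs
   exactly when D is even. *)
Definition even_D_model (E : wcurve) (A : int) :=
  exists m' A' X Y a b : int, [/\ m = 2 * m', A = 4 * A', (A' %% 4)%Z = 1,
    c4 E = 4 * ((4 * a + 1)%:~R + (4 * b + 2)%:~R * sq m) &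
    c6 E = 8 * ((2 * X)%:~R + (2 * Y + 1)%:~R * sq m)].

(** The constant in front of the square modulo 4 in [c6]; being rational, it enters the norm of [c6]
    only through its square. *)
Definition even_scale (A : int) : int := if (2 %| A)%Z then 8 else -1.

Section Even.
Context (v : place m) (E : wcurve) (A : int).
Hypothesis p2 : pl_p v = 2%N.
Hypothesis cf : coefs_in (inL v) E.
Hypothesis Ud : unitL v (disc E).
Hypothesis e4 : c4 E ^+ 3 = A%:~R ^+ 3 * disc E.

Let M2 n : inM v (2 * n)%:R. Proof. exact: M_nat. Qed.

Lemma even_a1 : (2 %| A)%Z -> inM v (a1 E).
Proof.
move=> A2; have [h2 h4 h6] := b_covariants_L cf; have [l1 l2 _ _ _] := cf.
apply: (@MX _ _ _ 2) => //.
have -> : a1 E ^+ 2 = b2 E - (2 * 2)%:R * a2 E by rewrite /b2; ring.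
apply: MB; last by apply: MLr => //.
apply: (@MX _ _ _ 2) => //.
have -> : b2 E ^+ 2 = c4 E + (2 * 12)%:R * b4 E by rewrite /c4; ring.
apply: MD; last by apply: MLr.
by apply: (dvd_cube_covariant cf e4); rewrite p2.
Qed.

Lemma b2_M : inM v (a1 E) -> inM v (b2 E).
Proof.
move=> Ma; have [l1 l2 _ _ _] := cf.
have -> : b2 E = a1 E * a1 E + (2 * 2)%:R * a2 E by rewrite /b2; ring.
by apply: MD; apply: MLr.
Qed.

Lemma odd_a1 : ~~ (2 %| A)%Z -> unitL v (a1 E).
Proof.
move=> nA; have [l1 l2 _ _ _] := cf; have [h2 h4 h6] := b_covariants_L cf.
apply: notM_unit => // /b2_M Mb.
have Mc : inM v (c4 E).
  have -> : c4 E = b2 E * b2 E - (2 * 12)%:R * b4 E by rewrite /c4; ring.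
  by apply: MB; apply: MLr.
have Ac : unitL v (A%:~R ^+ 3 * disc E).
  by apply: unitM => //; apply/unitX/unit_int; rewrite p2.
apply: (unit_notM Ac); rewrite -e4 exprS; apply: MLr => //.
exact/LX/M_L.
Qed.

(** If [a1] and [a3] were both in the maximal ideal, so would be [b2], [b6] and, with the term
    [8 b4^3], the discriminant. *)
Lemma even_a3 : inM v (a1 E) -> unitL v (a3 E).
Proof.
move=> /b2_M Mb; have [l1 l2 l3 l4 l6] := cf; have [h2 h4 h6] := b_covariants_L cf.
apply: notM_unit => // Ma3.
have Mb6 : inM v (b6 E).
  have -> : b6 E = a3 E * a3 E + (2 * 2)%:R * a6 E by rewrite /b6; ring.
  by apply: MD; apply: MLr.
apply: (unit_notM Ud).
have -> : disc E = b2 E * (- b2 E * b8 E) - (2 * 4)%:R * b4 E ^+ 3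
   + b6 E * (9 * b2 E * b4 E - 27 * b6 E) by rewrite /disc; ring.
apply: MD; first apply: MB; apply: MLr => //.
- by rewrite /b8; in_local.
- exact: LX.
- by in_local.
Qed.

(** Here [c4] is 16 times a local integer [h], so [2^12 h^3 = A^3 disc] with [disc] a unit. *)
Lemma even_half y : inL v y -> a1 E = 2 * y -> (16 %| A)%Z.
Proof.
move=> Ly Ea; have [Lh _] := half_c46_L cf Ly.
have := @pow_dvd _ v 12 (A ^+ 3) (half_c4 E y ^+ 3) (disc E) (LX 3 Lh) Ud.
rewrite p2 intrX -e4 (half_c4E Ea) -(dvdz_pexp2r 16 A (ltn0Sn 2)).
by apply; ring.
Qed.

Lemma two_adic_unram : ~~ ram v ->
  (~~ (2 %| A)%Z \/ (16 %| A)%Z) /\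
  exists r z, [/\ unitL v r, inL v z & c6 E = (even_scale A)%:~R * (r ^+ 2 + 4 * z)].
Proof.
move=> rv; have [A2|nA2] := orP (orbN (2 %| A)%Z); last first.
  split; first by left.
  exists (a1 E ^+ 3), (odd_c6 E); rewrite /even_scale (negbTE nA2).
  split; [exact/unitX/odd_a1|exact: odd_c6_L|].
  by rewrite odd_c6E; ring.
have Ma := even_a1 A2; have [y [Ly Ey]] := unram_M F rv Ma; rewrite p2 in Ey.
split; first by right; exact: even_half Ly Ey.
exists (a3 E), (half_c6 E y); rewrite /even_scale A2.
split; [exact: even_a3| |exact: half_c6E].
by case: (half_c46_L cf Ly).
Qed.

Context (s k : int).
Hypothesis cfO : coefs_in O E.
Hypothesis hs : s = 1 \/ s = -1.
Hypothesis Nd : disc E * F (disc E) = (s * k ^+ 12)%:~R.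
Hypothesis rv : ram v.

(** For even [A] the coordinates [X] and [Y] of [a1] decide, since [a1] lies in the prime. If [m] is
    odd they have equal parity, and both odd is excluded by the norm of [c4 / 4]. If [m] is even
    then [X] is even, and an odd [Y] leads to [even_D_model]. In the remaining cases [a1] is twice
    an integer. *)
Lemma two_adic_ram :
  ((~~ (2 %| A)%Z \/ (16 %| A)%Z) /\
  exists r z, [/\ O r /\ ~ pl v r, O z & c6 E = (even_scale A)%:~R * (r ^+ 2 + 4 * z)]) \/
  even_D_model E A.
Proof.
have [o1 o2 o3 o4 o6] := cfO.
have nP x : unitL v x -> ~ pl v x by move=> /unit_notM h /M_P.
have [A2|nA2] := orP (orbN (2 %| A)%Z); last first.
  left; split; first by left.
  exists (a1 E ^+ 3), (odd_c6 E); rewrite /even_scale (negbTE nA2).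
  split; [|exact: odd_c6_O|].
    by split; [exact: inOX | apply/nP/unitX/odd_a1].
  by rewrite odd_c6E; ring.
have Ma := even_a1 A2; have Ua3 := even_a3 Ma.
have [X [Y E1]] := ram2_coord p2 rv o1.
have := Ma; rewrite E1 => /(ram2_M p2 rv) NX.
have half : (2 %| X)%Z -> (2 %| Y)%Z ->
    ((~~ (2 %| A)%Z \/ (16 %| A)%Z) /\
    exists r z, [/\ O r /\ ~ pl v r, O z & c6 E = (even_scale A)%:~R * (r ^+ 2 + 4 * z)]).
  move=> /dvdzP[X' EX] /dvdzP[Y' EY]; pose y := X'%:~R + Y'%:~R * sq m.
  have Oy : O y by exact: (ram2_O p2 rv).
  have Ey : a1 E = 2 * y by rewrite E1 EX EY /y; ring.
  split; first by right; exact: even_half (L_O v Oy) Ey.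
  exists (a3 E), (half_c6 E y); rewrite /even_scale A2; split; [| |exact: half_c6E].
    by split=> //; exact: nP.
  exact: half_c6_O.
have nk : ~~ (2 %| k)%Z.
  apply/negP => k2; apply: (unit_notM (unitM Ud (ram_cjU F rv Ud))); rewrite Nd.
  by apply/M_int; rewrite p2 dvdz_mull // exprS dvdz_mulr.
have [a [b E2]] := ram2_coord p2 rv o2.
have [z [w E3]] := ram2_coord p2 rv o3.
have [c [d E4]] := ram2_coord p2 rv o4.
have [e [f E6]] := ram2_coord p2 rv o6.
have nz : ~~ (2 %| z ^+ 2 - m * w ^+ 2)%Z.
  by apply/negP => /(ram2_M p2 rv); rewrite -E3; exact: unit_notM.
have normA (G H : int) : c4 E = 4 * (G%:~R + H%:~R * sq m) ->
    2 ^+ 12 * (G ^+ 2 - m * H ^+ 2) ^+ 3 = A ^+ 6 * (s * k ^+ 12).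
  move=> Ec; apply: (@intr_inj algC).
  have -> : (A ^+ 6 * (s * k ^+ 12))%:~R = c4 E ^+ 3 * F (c4 E ^+ 3) :> algC.
    by rewrite e4 intrM -Nd; ring.
  transitivity (2 ^+ 12 * (G ^+ 2 - m * H ^+ 2)%:~R ^+ 3 : algC); first by ring.
  by rewrite Ec -(norm_sq_coord F); ring.
have [y1 hY] := int_parity Y; have [x hX] := int_parity X.
have m4 : (exists h, m = 4 * h + 3) \/ (exists h, m = 2 * (2 * h + 1)).
  have [m4 _] := ram2_m p2 rv; have m0 := sqf_mod4 F; clear -m4 m0.
  have [m3|m2] : (m %% 4)%Z = 3 \/ (m %% 4)%Z = 2 by lia.
    by left; exists (m %/ 4)%Z; lia.
  by right; exists (m %/ 4)%Z; lia.
have two (u : int) : (2 %| 2 * u)%Z by exact: dvdz_mulr.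
have odd1 (u : int) : ~~ (2 %| 2 * u + 1)%Z by clear; lia.
case: m4 => -[h Em].
  case: hX => hX; case: hY => hY.
  - by left; apply: half; rewrite ?hX ?hY.
  - case/negP: (odd1 (2 * x ^+ 2 - h * (8 * y1 ^+ 2 + 8 * y1 + 2) - (6 * y1 ^+ 2 + 6 * y1 + 2))).
    by move: NX; congr (_ %| _)%Z; rewrite Em hX hY; ring.
  - case/negP: (odd1 (2 * x ^+ 2 + 2 * x - 2 * m * y1 ^+ 2)).
    by move: NX; congr (_ %| _)%Z; rewrite hX hY; ring.
  (* Both coordinates of [a1] are odd here. As [a3] is a unit, [z + w] is odd. *)
  have [q Eq] : exists q, z = 2 * q + 1 - w.
    have [q [Eq|Eq]] := int_parity (z + w); last by exists q; rewrite -Eq; ring.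
    case/negP: nz; have -> : z = 2 * q - w by rewrite -Eq; ring.
    rewrite Em; have -> : (2 * q - w) ^+ 2 - (4 * h + 3) * w ^+ 2
       = 2 * (2 * q ^+ 2 - 2 * q * w - 2 * h * w ^+ 2 - w ^+ 2) by ring.
    exact: two.
  pose R := x ^+ 2 + x + m * (y1 ^+ 2 + y1) + h + 1 + a.
  pose S := 2 * x * y1 + x + y1 + b.
  pose T := c + x * z + w * (4 * h * y1 + 2 * h + 3 * y1 + 1) + q.
  pose V := d + x * w + y1 * z + q.
  have [n En] := mod4_three_norm_mod8 R S T V Em.
  have mC : (m%:~R : algC) = 4 * h%:~R + 3 by rewrite Em; ring.
  have qC : (z%:~R : algC) = 2 * q%:~R + 1 - w%:~R by rewrite Eq; ring.
  have sC : sq m ^+ 2 = 4 * h%:~R + 3 by rewrite sq2.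
  have Ec : c4 E = 4 * ((4 * R ^+ 2 + m * (2 * S + 1) ^+ 2 - 12 * T - 6)%:~R
      + (4 * R * (2 * S + 1) - 12 * V - 6)%:~R * sq m).
    rewrite /c4 /b2 /b4 E1 E2 E3 E4 hX hY /R /S /T /V Eq.
    by ring: mC sC.
  have nN : ~~ (2 %| (4 * R ^+ 2 + m * (2 * S + 1) ^+ 2 - 12 * T - 6) ^+ 2
      - m * (4 * R * (2 * S + 1) - 12 * V - 6) ^+ 2)%Z.
    by rewrite En; have -> : 8 * n + 5 = 2 * (4 * n + 2) + 1 by ring.
  have [A' [_ nA' EN]] := quarter_of_norm hs nk nN (normA _ _ Ec).
  by case: (cube_five_mod8 nA' nk hs En EN).
case: hX => hX; last first.
  case/negP: (odd1 (2 * x ^+ 2 + 2 * x - (2 * h + 1) * Y ^+ 2)).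
  by move: NX; congr (_ %| _)%Z; rewrite Em hX; ring.
case: hY => hY; first by left; apply: half; rewrite ?hX ?hY.
right.
have [zz Ez] : exists zz, z = 2 * zz + 1.
  have [zz [Ez|Ez]] := int_parity z; last by exists zz.
  case/negP: nz; rewrite Ez Em.
  have -> : (2 * zz) ^+ 2 - 2 * (2 * h + 1) * w ^+ 2
    = 2 * (2 * zz ^+ 2 - (2 * h + 1) * w ^+ 2) by ring.
  exact: two.
pose m' := 2 * h + 1; have {}Em : m = 2 * m' by [].
have mC : (m%:~R : algC) = 2 * m'%:~R by rewrite Em intrM.
have sC : sq m ^+ 2 = 2 * m'%:~R :> algC by rewrite sq2.
have [oo Eo] : exists oo, 2 * x ^+ 2 + m' * Y ^+ 2 + 2 * a = 2 * oo + 1.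
  exists (x ^+ 2 + h * Y ^+ 2 + 2 * y1 ^+ 2 + 2 * y1 + a); rewrite hY /m'; ring.
pose o := 2 * oo + 1; pose u := x * Y + b.
pose hh := c + x * z + m' * Y * w.
pose ll := d + x * w + 2 * y1 * zz + y1 + zz.
pose kk := 2 * ll + 1.
have Eb2 : b2 E = 2 * (o%:~R + 2 * u%:~R * sq m).
  rewrite /b2 E1 E2 /o -Eo /u hX; ring: sC.
have Eb4 : b4 E = 2 * hh%:~R + kk%:~R * sq m.
  by rewrite /b4 E1 E3 E4 /hh /kk /ll hX hY Ez; ring: sC.
have Eb6 : b6 E = (z ^+ 2 + 2 * m' * w ^+ 2 + 4 * e)%:~R + (2 * z * w + 4 * f)%:~R * sq m.
  by rewrite /b6 E3 E6; ring: sC.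
pose ga := oo ^+ 2 + oo + 2 * m' * u ^+ 2 - 3 * hh.
pose gb := o * u - 3 * ll - 2.
pose kX := - (4 * oo ^+ 3 + 6 * oo ^+ 2 + 3 * oo) - 27 * (2 * zz ^+ 2 + 2 * zz) - 14
  - 12 * o * u ^+ 2 * m' + 9 * o * hh + 18 * u * kk * m' - 27 * m' * w ^+ 2 - 54 * e.
pose kY := 9 * (2 * oo * ll + oo + ll) + 4 - 3 * o ^+ 2 * u - 8 * m' * u ^+ 3 + 18 * u * hh
  - 27 * z * w - 54 * f.
have Ec4 : c4 E = 4 * ((4 * ga + 1)%:~R + (4 * gb + 2)%:~R * sq m).
  by rewrite /c4 Eb2 Eb4 /ga /gb /kk /o; ring: sC.
have Ec6 : c6 E = 8 * ((2 * kX)%:~R + (2 * kY + 1)%:~R * sq m).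
  by rewrite /c6 Eb2 Eb4 Eb6 /kX /kY /kk /o Ez; ring: sC.
have nN : ~~ (2 %| (4 * ga + 1) ^+ 2 - m * (4 * gb + 2) ^+ 2)%Z.
  have -> : (4 * ga + 1) ^+ 2 - m * (4 * gb + 2) ^+ 2
    = 2 * (8 * ga ^+ 2 + 4 * ga - m' * (4 * gb + 2) ^+ 2) + 1 by rewrite Em; ring.
  exact: odd1.
have [A' [EA nA' EN]] := quarter_of_norm hs nk nN (normA _ _ Ec4).
exists m', A', kX, kY, ga, gb; split=> //.
(* It remains to exclude [A' = 3] modulo 4. Then [A'^3 - 27 = 4 j], and the squared norm of [c6 / 8]
   would be divisible by 16; but that norm is [(2 kX)^2 - 2 m' (2 kY + 1)^2], which is 2 modulo
   4. *)
have [t [Et|Et]] : exists t, A' = 4 * t + 1 \/ A' = 4 * t + 3.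
  by exists (A' %/ 4)%Z; clear -nA'; lia.
  by rewrite Et; clear; lia.
pose j := 16 * t ^+ 3 + 36 * t ^+ 2 + 27 * t.
have Ek : ((2 * kX) ^+ 2 - m * (2 * kY + 1) ^+ 2) ^+ 2 = (4 * j) ^+ 2 * (s * k ^+ 12).
  apply: (@intr_inj algC); apply: (@mulfI _ (64 ^+ 2)); first by rewrite expf_neq0 ?pnatr_eq0.
  transitivity (c6 E ^+ 2 * F (c6 E ^+ 2)).
    rewrite Ec6; transitivity (64 ^+ 2 * ((2 * kX) ^+ 2 - m * (2 * kY + 1) ^+ 2)%:~R ^+ 2 : algC).
      by ring.
    by rewrite -(norm_sq_coord F); ring.
  have -> : c6 E ^+ 2 = (64 * (4 * j))%:~R * disc E.
    transitivity (c4 E ^+ 3 - 1728 * disc E); first by rewrite -c4_c6_disc; ring.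
    by rewrite e4 EA Et /j; ring.
  by rewrite [in RHS]intrM -Nd; ring.
pose q := kX ^+ 2 - h * (4 * kY ^+ 2 + 4 * kY + 1) - (2 * kY ^+ 2 + 2 * kY) - 1.
have /negP[] := odd1 (2 * q ^+ 2 + 2 * q).
have -> : 2 * (2 * q ^+ 2 + 2 * q) + 1 = 2 * (2 * j ^+ 2 * (s * k ^+ 12)).
  apply: (@mulfI _ 4) => //.
  transitivity (((2 * kX) ^+ 2 - m * (2 * kY + 1) ^+ 2) ^+ 2); last by rewrite Ek; ring.
  by rewrite Em /m' /q; ring.
exact: two.
Qed.

End Even.
End TwoAdic.


(** * The squarefree part D and the conic *)

Lemma squarefree_part (z : int) : z != 0 ->
  exists D t : int, [/\ squarefree D, t != 0 & z = D * t ^+ 2].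
Proof.
move En : `|z|%N => n; elim/ltn_ind: n z En => n IH z En z0.
have [[p [pp /dvdnP[q Eq]]]|sf] := classic (exists p, prime p /\ (p * p %| `|z|)%N); last first.
  exists z, 1; split=> //; last by rewrite expr1n mulr1.
  by split=> // p pp; apply/negP => d; apply: sf; exists p.
have dz : (p%:Z ^+ 2 %| z)%Z by rewrite dvdzE abszX /= -mulnn Eq dvdn_mull.
have /dvdzP[w Ew] := dz; have p1 := prime_gt1 pp.
have w0 : w != 0 by apply: contraNneq z0 => w0; rewrite Ew w0 mul0r.
have [|D [t [sD t0 Ed]]] := IH `|w|%N _ w erefl w0.
  by rewrite -En Ew abszM abszX /= ltn_Pmulr ?absz_gt0 // -(exp1n 2) ltn_exp2r.
exists D, (t * p%:Z); split=> //; first by rewrite mulf_neq0 //; lia.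
by rewrite Ew Ed; ring.
Qed.

Lemma squarefree_logn (D : int) (p : nat) : squarefree D -> prime p -> (logn p `|D| <= 1)%N.
Proof.
move=> [D0 sD] pp; rewrite leqNgt; apply/negP => l2; case/negP: (sD p pp).
by rewrite mulnn pfactor_dvdn ?absz_gt0.
Qed.

Lemma squarefree_dvd (D z : int) : squarefree D ->
  (forall p : nat, prime p -> (p %| D)%Z -> (p %| z)%Z) -> (D %| z)%Z.
Proof.
move=> sD h; have [->|z0] := eqVneq z 0; first exact: dvdz0.
have [D0 _] := sD; rewrite dvdzE; apply/dvdn_partP; first by rewrite absz_gt0.
move=> p; rewrite mem_primes => /and3P[pp _ pD].
rewrite p_part; apply: dvdn_trans (dvdn_exp2l p (squarefree_logn sD pp)) _.
by rewrite expn1; exact: (h p pp pD).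
Qed.

Lemma legendre_eq1 (a b n : int) (p : nat) : prime p -> ~~ (p %| a)%Z -> ~~ (p %| b)%Z ->
  (p %| n ^+ 2 - a * b ^+ 2)%Z -> legendre a p = 1.
Proof.
move=> pp na nb hd; rewrite /legendre (negbTE na).
have [u [w E]] := prime_bezout pp nb.
have p0 : p%:Z != 0 by have := prime_gt0 pp; lia.
(* The square root of [a] modulo [p] is [n / b], and [w] is inverse to [b]. *)
set r := n * w.
have rp : (`|(r %% p%:Z)%Z| < p)%N.
  by rewrite -ltz_nat gez0_abs ?modz_ge0 // ltz_pmod // ltz_nat prime_gt0.
case: existsP => // -[]; exists (Ordinal rp) => /=.
have -> : (`|(r %% p%:Z)%Z|%N : int) = r - (r %/ p%:Z)%Z * p%:Z.
  by rewrite gez0_abs ?modz_ge0 // /modz.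
set q := (_ %/ _)%Z.
have -> : (r - q * p%:Z) ^+ 2 - a = w ^+ 2 * (n ^+ 2 - a * b ^+ 2)
    + (q ^+ 2 * p%:Z - 2 * r * q - a * (1 + w * b) * u) * p%:Z.
  have Ew : (1 + w * b) * u * p%:Z = 1 - (w * b) ^+ 2.
    have Eu : u * p%:Z = 1 - w * b by rewrite -E; ring.
    by rewrite -mulrA Eu; ring.
  transitivity (w ^+ 2 * (n ^+ 2 - a * b ^+ 2)
    + (q ^+ 2 * p%:Z - 2 * r * q) * p%:Z - a * ((1 + w * b) * u * p%:Z)); last by ring.
  by rewrite Ew /r; ring.
by rewrite rpredD ?dvdz_mull.
Qed.

(** The only integer root is 12, and neither 12 nor 12 - 4 is divisible by 16. *)
Lemma inR_cube_neq (A : int) : inR A -> A ^+ 3 - 1728 != 0.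
Proof.
move=> [h2 _]; apply/eqP => h; have hA : A = 12.
  have : (A - 12) * ((A + 6) ^+ 2 + 108) = 0 by rewrite -h; ring.
  move/eqP; rewrite mulf_eq0 => /orP[/eqP|/eqP]; first by clear; lia.
  by have := sqr_ge0 (A + 6); clear; lia.
by move: h2; rewrite hA => /(_ isT)[].
Qed.

(** Modulo [p] the equation is [z^2 = s be y^2]. If [p] divided [y] it would divide [z], so [p^2]
    would divide [al x^2]; as [al] has a single factor [p], also [p] would divide [x]. *)
Lemma form_residue (al be s x y z : int) (p : nat) : prime p -> s * s = 1 ->
  al * x ^+ 2 + be * y ^+ 2 = s * z ^+ 2 ->
  (forall p : nat, prime p -> (p %| x)%Z -> (p %| y)%Z -> (p %| z)%Z -> False) ->
  (p %| al)%Z -> ~~ (p * p %| `|al|)%N -> ~~ (p %| be)%Z -> legendre (s * be) p = 1.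
Proof.
move=> pp ss E cop pal sal nbe.
have z2 : z ^+ 2 = s * (al * x ^+ 2 + be * y ^+ 2) by rewrite E mulrA ss mul1r.
have ns : ~~ (p %| s)%Z.
  apply/negP => /(dvdz_mull s); rewrite ss dvdzE /= dvdn1 => /eqP p1.
  by move: pp; rewrite p1.
apply: (legendre_eq1 (b := y) (n := z)) => //; last first.
- rewrite z2; have -> : s * (al * x ^+ 2 + be * y ^+ 2) - s * be * y ^+ 2
    = s * x ^+ 2 * al by ring.
  exact: dvdz_mull.
- apply/negP => py; have pz : (p %| z)%Z.
    apply: (@prime_dvdzX p z 2) => //; rewrite z2; apply: dvdz_mull.
    by apply: rpredD; [exact: dvdz_mulr | rewrite exprS dvdz_mull // dvdz_mulr].
  have /dvdzP[a Ea] := pal; have /dvdzP[y' Ey] := py; have /dvdzP[z' Ez] := pz.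
  have na : ~~ (p %| a)%Z.
    by apply: contra sal; rewrite dvdzE Ea abszM => h; rewrite dvdn_mul.
  apply: (cop p pp _ py pz); apply: (@prime_dvdzX p x 2) => //.
  have : (p %| a * x ^+ 2)%Z.
    apply/dvdzP; exists (s * z' ^+ 2 - be * y' ^+ 2).
    have p0 : p%:Z != 0 by have := prime_gt0 pp; clear; lia.
    apply: (mulfI p0); transitivity (al * x ^+ 2 + be * y ^+ 2 - be * y ^+ 2).
      by rewrite Ea; ring.
    by rewrite E Ey Ez; ring.
  by rewrite prime_dvdzM // (negbTE na).
by rewrite prime_dvdzM // negb_or ns.
Qed.

(** Coprimality makes numerator and denominator of [g] both odd, and odd squares are 1 modulo 8. *)
Lemma odd_rat_sqr_mod8 (x y : int) (g : rat) : ~~ (2 %| x)%Z -> ~~ (2 %| y)%Z ->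
  x%:~R * g ^+ 2 = y%:~R -> (8 %| x - y)%Z.
Proof.
move=> nx ny E; have d0 : (denq g)%:~R != 0 :> rat by rewrite intr_eq0 denq_eq0.
have {}E : x * numq g ^+ 2 = y * denq g ^+ 2.
  apply: (@intr_inj rat); have En : (numq g)%:~R = g * (denq g)%:~R.
    by rewrite -{2}(divq_num_den g) divfK.
  by rewrite [LHS]intrM [RHS]intrM !intrX En -E; ring.
have cop := coprime_num_den g.
have odd2 (a b c d : int) : ~~ (2 %| a)%Z -> a * c ^+ 2 = b * d ^+ 2 -> (2 %| d)%Z -> (2 %| c)%Z.
  move=> na Eq d2; apply: (@prime_dvdzX 2 c 2) => //.
  have : (2 %| a * c ^+ 2)%Z by rewrite Eq expr2 dvdz_mull ?dvdz_mull.
  by rewrite (@prime_dvdzM 2) // (negbTE na).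
have ncd : ~ ((2 %| numq g)%Z /\ (2 %| denq g)%Z).
  rewrite !dvdzE /= => -[h1 h2]; have : (2 %| gcdn `|numq g| `|denq g|)%N by rewrite dvdn_gcd h1.
  by move: cop; rewrite /coprime => /eqP ->.
have nn : ~~ (2 %| numq g)%Z.
  by apply/negP => h; apply: ncd; split=> //; exact: odd2 ny (esym E) h.
have nd : ~~ (2 %| denq g)%Z.
  by apply/negP => h; apply: ncd; split=> //; exact: odd2 nx E h.
have [a Ea] := odd_sqr nn; have [b Eb] := odd_sqr nd.
apply/dvdzP; exists (y * b - x * a).
by move: E; rewrite Ea Eb; clear; lia.
Qed.

Lemma rat_sixth_power (y n : rat) : y ^+ 6 = n ^+ 12 \/ y ^+ 6 = - n ^+ 12 ->
  exists s : int, (s = 1 \/ s = -1) /\ y = s%:~R * n ^+ 2.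
Proof.
move=> h; have h6 : `|y| ^+ 6 = (n ^+ 2) ^+ 6.
  rewrite -normrX -exprM; case: h => ->; rewrite ?normrN ger0_norm //.
    by rewrite (exprM n 6 2) sqr_ge0.
  by rewrite (exprM n 6 2) sqr_ge0.
have Ey : `|y| = n ^+ 2.
  by apply/eqP; rewrite -(eqrXn2 (n := 6)) ?normr_ge0 ?sqr_ge0 // h6.
have [y0|y0] := leP 0 y; [exists 1 | exists (-1)]; split; try by [left|right].
  by rewrite mul1r -Ey ger0_norm.
by rewrite mulN1r -Ey ltr0_norm // opprK.
Qed.

Lemma coprime_triple (x y z : int) : z != 0 -> exists g x' y' z' : int,
  [/\ g != 0, x = g * x', y = g * y', z = g * z' &
   forall p : nat, prime p -> (p %| x')%Z -> (p %| y')%Z -> (p %| z')%Z -> False].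
Proof.
move=> z0; pose g := gcdz (gcdz x y) z.
have g0 : g != 0 by rewrite gcdz_eq0 negb_and z0 orbT.
have gxy : (g %| gcdz x y)%Z by exact: dvdz_gcdl.
have /dvdzP[x' Ex] : (g %| x)%Z by apply: dvdz_trans gxy _; exact: dvdz_gcdl.
have /dvdzP[y' Ey] : (g %| y)%Z by apply: dvdz_trans gxy _; exact: dvdz_gcdr.
have /dvdzP[z' Ez] : (g %| z)%Z by exact: dvdz_gcdr.
have gE h : (h %| x)%Z -> (h %| y)%Z -> (h %| z)%Z -> (h %| g)%Z.
  by move=> h1 h2 h3; rewrite !dvdz_gcd h1 h2.
move: g g0 Ex Ey Ez gE {gxy} => g g0 Ex Ey Ez gE.
exists g, x', y', z'; split=> //; try by rewrite mulrC.
move=> p pp px py pz; have : (g * p%:Z %| g)%Z.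
  have dz u : (p %| u)%Z -> (g * p%:Z %| u * g)%Z.
    by move=> /dvdzP[k ->]; apply/dvdzP; exists k; ring.
  by apply: gE; [rewrite Ex | rewrite Ey | rewrite Ez]; apply: dz.
move=> /dvdzP[k Ek]; have E1 : 1 = k * p%:Z.
  by apply: (mulfI g0); rewrite mulr1 {1}Ek; ring.
have : (p %| 1)%Z by apply/dvdzP; exists k.
by rewrite dvdzE /= dvdn1 => /eqP E; move: pp; rewrite E.
Qed.

(** After clearing denominators, squarefreeness of [D] forces [D] to divide [z0] and then [x0];
    dividing out leaves the conic. *)
Lemma ternary_form (D q m s : int) (a b n : rat) : squarefree D -> m = q * D ->
  (s = 1 \/ s = -1) -> n != 0 ->
  D%:~R * (a ^+ 2 - m%:~R * b ^+ 2) = s%:~R * n ^+ 2 ->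
  exists x y z : int, [/\ z != 0, D * x ^+ 2 - q * y ^+ 2 = s * z ^+ 2 &
   forall p : nat, prime p -> (p %| x)%Z -> (p %| y)%Z -> (p %| z)%Z -> False].
Proof.
move=> sD Em hs n0 E; pose d := denq a * denq b * denq n.
have dE (r : rat) : r * (denq r)%:~R = (numq r)%:~R.
  by rewrite -{1}(divq_num_den r) divfK // intr_eq0 denq_eq0.
pose x0 := numq a * denq b * denq n; pose y0 := denq a * numq b * denq n.
pose z0 := denq a * denq b * numq n.
have d0 : d%:~R != 0 :> rat by rewrite intr_eq0 !mulf_neq0 ?denq_eq0.
have ax : a * d%:~R = x0%:~R by rewrite /d /x0 !intrM -dE; ring.
have bx : b * d%:~R = y0%:~R by rewrite /d /y0 !intrM -dE; ring.
have nx : n * d%:~R = z0%:~R by rewrite /d /z0 !intrM -dE; ring.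
have zn0 : z0 != 0 by rewrite -(intr_eq0 rat) -nx mulf_neq0.
have {}E : D * (x0 ^+ 2 - m * y0 ^+ 2) = s * z0 ^+ 2.
  apply: (@intr_inj rat).
  transitivity (D%:~R * (a ^+ 2 - m%:~R * b ^+ 2) * d%:~R ^+ 2); last first.
    by rewrite E; transitivity (s%:~R * z0%:~R ^+ 2 : rat); [rewrite -nx|]; ring.
  transitivity (D%:~R * (x0%:~R ^+ 2 - m%:~R * y0%:~R ^+ 2) : rat); first by ring.
  by rewrite -ax -bx; ring.
have ss : s * s = 1 by case: hs => ->.
have [D0 _] := sD.
have /dvdzP[z1 Ez] : (D %| z0)%Z.
  apply: squarefree_dvd => // p pp pD; apply: (@prime_dvdzX p z0 2) => //.
  have -> : z0 ^+ 2 = s * (D * (x0 ^+ 2 - m * y0 ^+ 2)) by rewrite E mulrA ss mul1r.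
  by rewrite dvdz_mull // dvdz_mulr.
have E1 : x0 ^+ 2 - m * y0 ^+ 2 = D * (s * z1 ^+ 2).
  by apply: (mulfI D0); rewrite E Ez; ring.
have /dvdzP[x1 Ex] : (D %| x0)%Z.
  apply: squarefree_dvd => // p pp pD; apply: (@prime_dvdzX p x0 2) => //.
  have -> : x0 ^+ 2 = D * (s * z1 ^+ 2 + q * y0 ^+ 2) by rewrite mulrDr -E1 Em; ring.
  by rewrite dvdz_mulr.
have E2 : D * x1 ^+ 2 - q * y0 ^+ 2 = s * z1 ^+ 2.
  by apply: (mulfI D0); rewrite -E1 Ex Em; ring.
have z10 : z1 != 0 by apply: contraNneq zn0 => h; rewrite Ez h mul0r.
have [g [x [y [z [g0 Ex1 Ey1 Ez1 cop]]]]] := coprime_triple x1 y0 z10.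
exists x, y, z; split=> //; first by apply: contraNneq z10 => h; rewrite Ez1 h mulr0.
apply: (mulfI (expf_neq0 2 g0)); transitivity (s * z1 ^+ 2); last by rewrite Ez1; ring.
by rewrite -E2 Ex1 Ey1; ring.
Qed.


(** * The norm of c6 at 2 *)

Section ForwardLocal.
Context {m : int} (F : quadfield m).
Local Notation K := (inK m).
Local Notation O := (inOK m).
Local Notation inL v := (inOP m (pl v)).
Local Notation unitL v := (unitOP m (pl v)).
Implicit Type v : place m.

(** At a ramified place [r] and [z] are kept globally integral, so that their norms and traces are
    integers. *)
Lemma two_adic_cases E (A : int) v : pl_p v = 2%N ->
  elliptic_over m E -> everywhere_good m E -> c4 E ^+ 3 = A%:~R ^+ 3 * disc E ->
  ((~~ (2 %| A)%Z \/ (16 %| A)%Z) /\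
   exists u r z, [/\ K u, u != 0, unitL v r, inL v z &
     c6 E = u ^+ 6 * ((even_scale A)%:~R * (r ^+ 2 + 4 * z))] /\ (ram v -> O r /\ O z)) \/
  (ram v /\ exists E' u, [/\ K u, u != 0 & covariant_scale E E' u] /\ @even_D_model m E' A).
Proof.
move=> p2 el eg e4; have [rv|rv] := orP (orbN (ram v)); last first.
  have [E' [u [Ku u0 cs cf Ud]]] := local_model v eg.
  have e4' := cube_covariant_scale u0 cs e4.
  have [hA [r [z [Ur Lz E6]]]] := two_adic_unram F p2 cf Ud e4' rv.
  left; split=> //; exists u, r, z; split; last by rewrite (negbTE rv).
  by have [_ h6 _] := cs; split=> //; rewrite h6 E6.
have n1 : ~~ (pl_p v %| 1)%Z by rewrite p2.
have [E' [u [Ku u0 cs cf Ud]]] := ram_local_model F rv n1 eg.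
have e4' := cube_covariant_scale u0 cs e4.
have cfO : coefs_in O E'.
  have h x : (exists y, O y /\ x = 1%:~R * y) -> O x by move=> [y [Oy ->]]; rewrite mul1r.
  by case: cf => *; split; apply: h.
have cfL : coefs_in (inL v) E' by case: cfO => *; split; apply: L_O.
have [n En] := disc_norm F el eg.
have [s [k [hs Nd]]] := norm_disc_int Ku u0 cs cfO En.
have [[hA [r [z [[Or nr] Oz E6]]]]|h] := two_adic_ram p2 cfL Ud e4' cfO hs Nd rv.
  left; split=> //; exists u, r, z; split=> //; have [_ h6 _] := cs.
  by split=> //; [exact: unit_O | exact: L_O | rewrite h6 E6].
by right; split=> //; exists E', u; split.
Qed.

Lemma two_adic_A E (A : int) :
  elliptic_over m E -> everywhere_good m E -> c4 E ^+ 3 = A%:~R ^+ 3 * disc E ->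
  (2 %| A)%Z -> (16 %| A)%Z \/ (16 %| A - 4)%Z.
Proof.
move=> el eg e4 A2; have [v p2] := @place_exists m F 2 isT.
have [[[nA|h] _]|[_ [E' [u [_ [m' [A' [X [Y [a [b [_ -> h _ _]]]]]]]]]]]] := two_adic_cases p2 el eg e4.
- by case/negP: nA.
- by left.
- by right; clear -h; lia.
Qed.

Lemma conj_place v : exists v', pl v' = cj_ideal F v /\ pl_p v' = pl_p v.
Proof.
have [v' Ev'] := prime_ideal_place F (cj_ideal_prime F v); exists v'; split=> //.
have : pl v' (pl_p v)%:~R.
  by rewrite Ev'; split; [exact: inO_int | rewrite rmorph_int; exact: pl_mem].
move/pl_int; rewrite dvdzE /= dvdn_prime2 ?pl_pP // => /eqP.
by [].
Qed.

(** Comparing powers of 2 shows that [h] is a unit. If [N = 3] modulo 4 then [h^2 = -1] modulo 4.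
    But 2 is a uniformizer, so [h = 1 + 2 h'], and [h^2 + 1] is 2 modulo 4. *)
Lemma unram2_unit_sqr v (N : int) (h x : algC) : pl_p v = 2%N -> ~~ ram v ->
  ~~ (2 %| N)%Z -> K h -> inL v x -> N%:~R * h ^+ 2 = 1 + 4 * x -> (4 %| N - 1)%Z.
Proof.
move=> p2 rv nN Kh Lx E.
have hn n : inL v n%:R by exact: L_nat.
have M2 n : inM v (2 * n)%:R by exact: M_nat.
have U1 : unitL v (1 + 4 * x).
  apply: notM_unit => [|M]; first by apply: LD; [exact: L1 | apply: LM].
  apply: (@M1F _ v); have -> : (1 : algC) = (1 + 4 * x) - (2 * 2)%:R * x by ring.
  by apply: MB => //; apply: MLr.
have UN : unitL v N%:~R by apply: unit_int; rewrite p2.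
have h0 : h != 0.
  by apply: contraTneq (unit_neq0 U1) => h0; rewrite -E h0 expr0n mulr0 eqxx.
have [y [a [b [Uy Ey]]]] := unram_val F rv Kh h0.
have Ey2 : (1 + 4 * x) * (pl_p v)%:R ^+ (2 * a) = (N%:~R * y ^+ 2) * (pl_p v)%:R ^+ (2 * b).
  rewrite -E !(mulnC 2) !exprM.
  transitivity (N%:~R * (h * (pl_p v)%:R ^+ a) ^+ 2); first by ring.
  by rewrite Ey; ring.
have ab : a = b by have := ppow_unit U1 (unitM UN (unitX 2 Uy)) Ey2; clear; lia.
have {}Ey : h = y by apply: (mulIf (expf_neq0 a (p_neq0 v))); rewrite Ey ab.
have Lh : inL v h by rewrite Ey; exact: unit_L.
have [k [Ek|Ek]] : exists k, N = 4 * k + 1 \/ N = 4 * k + 3.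
  by exists (N %/ 4)%Z; clear -nN; lia.
  by rewrite Ek; clear; lia.
exfalso; pose x2 := k%:~R * h ^+ 2 + h ^+ 2 - x.
have Lx2 : inL v x2 by apply: LB => //; apply: LD; [apply: LM; [exact: L_int|]|]; exact: LX.
have Eh : h ^+ 2 + 1 = 4 * x2.
  transitivity ((4 * k + 3)%:~R * h ^+ 2 + h ^+ 2 - 4 * x); last by rewrite /x2; ring.
  by rewrite -Ek E; ring.
have Mh : inM v (h - 1).
  have : inM v ((h - 1) * (h + 1)).
    have -> : (h - 1) * (h + 1) = (2 * 2)%:R * x2 - (2 * 1)%:R.
      by transitivity (h ^+ 2 + 1 - 2); [|rewrite Eh]; ring.
    by apply: MB => //; apply: MLr.
  case/ME => [||//|Mh]; [by apply: LB => //; exact: L1|by apply: LD => //; exact: L1|].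
  have -> : h - 1 = h + 1 - (2 * 1)%:R by ring.
  by apply: MB.
have [h' [Lh' Eh']] := unram_M F rv Mh; rewrite p2 in Eh'.
apply: (@M1F _ v); have -> : (1 : algC) = (2 * 1)%:R * (x2 - h' ^+ 2 - h').
  apply: (@mulfI _ 2); first by rewrite pnatr_eq0.
  transitivity (4 * x2 - 4 * h' ^+ 2 - 4 * h'); last by ring.
  have {}Eh' : h = 2 * h' + 1 by rewrite -Eh'; ring.
  by rewrite -Eh Eh'; ring.
by apply: MLr => //; do !apply: LB => //; exact: LX.
Qed.

(** [N(c6)] is [s D] times a rational square. In the unramified case it is also a product of two
    squares modulo 4, the second taken from the conjugate place. In the ramified case it is a
    rational square times [N(r^2 + 4 z) = N(r)^2 + 4 Tr(r^2 F z) + 16 N(z)], where the trace is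
    even, so that this norm is 1 modulo 8. *)
Lemma odd_case_mod E (A D s : int) (g : rat) v : pl_p v = 2%N ->
  elliptic_over m E -> everywhere_good m E -> c4 E ^+ 3 = A%:~R ^+ 3 * disc E ->
  (A%:~R : algC) != 0 ->
  ~~ (16 %| A - 4)%Z -> ~~ (2 %| s * D)%Z ->
  c6 E * F (c6 E) = (s * D)%:~R * ratr g ^+ 2 ->
  (4 %| s * D - 1)%Z /\ (ram v -> (8 %| s * D - 1)%Z).
Proof.
move=> p2 el eg e4 A0 nA nD Ng.
have e0 : (even_scale A)%:~R != 0 :> algC by rewrite /even_scale; case: ifP; rewrite intr_eq0.
have eR : exists e : rat, (even_scale A)%:~R = ratr e :> algC.
  by exists (even_scale A)%:~R; rewrite ratr_int.
have data v0 : pl_p v0 = 2%N -> exists u r z, [/\ K u, u != 0, unitL v0 r, inL v0 z &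
     c6 E = u ^+ 6 * ((even_scale A)%:~R * (r ^+ 2 + 4 * z))] /\ (ram v0 -> O r /\ O z).
  move=> p20; have [[_ h]//|[_ [E' [u [_ [m' [A' [X [Y [a [b [_ EA h _ _]]]]]]]]]]]] :=
    two_adic_cases p20 el eg e4.
  by case/negP: nA; rewrite EA; clear -h; lia.
have [u [r [z [[Ku u0 Ur Lz E6] hram]]]] := data v p2.
have [rv|rv] := orP (orbN (ram v)); last first.
  split; last by rewrite (negbTE rv).
  have [v' [Ev' pv']] := conj_place v.
  have [|u' [r' [z' [[Ku' u0' Ur' Lz' E6'] _]]]] := data v'; first by rewrite pv'.
  rewrite Ev' in Ur' Lz'; have {}Ur' := cj_ideal_U Ur'; have {}Lz' := cj_ideal_L Lz'.
  have fr0 := unit_neq0 Ur'; have r0 := unit_neq0 Ur.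
  have fu0 := cj_neq0 F u0'.
  pose c := (u * F u') ^+ 3 * (even_scale A)%:~R * (r * F r').
  have c0 : c != 0 by rewrite !mulf_neq0 ?expf_neq0 // mulf_neq0.
  pose x := (r ^+ 2 * F z' + F r' ^+ 2 * z + 4 * z * F z') / (r * F r') ^+ 2.
  have Ex : (r * F r') ^+ 2 * x = r ^+ 2 * F z' + F r' ^+ 2 * z + 4 * z * F z'.
    by rewrite /x mulrC divfK // expf_neq0 // mulf_neq0.
  apply: (@unram2_unit_sqr v (s * D) (ratr g / c) x p2 rv nD).
  - apply: inK_div; first exact: inK_rat.
    apply: inKM; last by apply: inKM; [exact: unit_K Ur | exact: unit_K Ur'].
    by apply: inKM; [apply/inKX/inKM => //; exact: inK_cj | exact: inK_int].
  - have hn n : inL v n%:R by exact: L_nat.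
    have Lr := unit_L Ur; have Lr' := unit_L Ur'.
    apply: LM; last by apply/unit_LV/unitX/unitM.
    by in_local.
  - apply: (mulfI (expf_neq0 2 c0)).
    transitivity ((s * D)%:~R * ratr g ^+ 2 : algC); first by field.
    rewrite -Ng {1}E6 E6'.
    transitivity ((u * F u') ^+ 6 * (even_scale A)%:~R ^+ 2 *
      ((r ^+ 2 + 4 * z) * (F r' ^+ 2 + 4 * F z'))); first by ring.
    transitivity ((u * F u') ^+ 6 * (even_scale A)%:~R ^+ 2 *
      ((r * F r') ^+ 2 + 4 * ((r * F r') ^+ 2 * x))); first by rewrite Ex; ring.
    by rewrite /c; ring.
have [Or Oz] := hram rv.
have [N1 EN1] := norm_int F Or; have [N2 EN2] := norm_int F Oz.
have [t Et] : exists t : int, r ^+ 2 * F z + F (r ^+ 2 * F z) = (2 * t)%:~R.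
  have Oy : O (r ^+ 2 * F z) by apply: inOM; [exact: inOX | exact: inO_cj].
  have [t [t' ->]] := ram2_coord F p2 rv Oy.
  by exists t; rewrite rmorphD rmorphM /= !rmorph_int cj_sq; ring.
have [a Ea] := norm_rat F Ku; have [e Ee] := eR.
pose M := N1 ^+ 2 + 8 * t + 16 * N2.
have EM : (r ^+ 2 + 4 * z) * F (r ^+ 2 + 4 * z) = M%:~R.
  transitivity ((r * F r) ^+ 2 + 4 * (r ^+ 2 * F z + F (r ^+ 2 * F z)) + 16 * (z * F z)).
    have FFz := cjK F (inO_K Oz).
    have -> : F (r ^+ 2 * F z) = F r ^+ 2 * z.
      by rewrite rmorphM FFz; congr (_ * _); exact: rmorphXn.
    by ring.
  by rewrite EN1 EN2 Et /M; ring.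
have nN1 : ~~ (2 %| N1)%Z.
  apply/negP => h; apply: (unit_notM (unitM Ur (ram_cjU F rv Ur))); rewrite EN1.
  by apply/M_int; rewrite p2.
have a0 : ratr a != 0 :> algC by rewrite -Ea mulf_neq0 ?cj_neq0.
have e0' : ratr e != 0 :> algC by rewrite -Ee.
have [c Ec] := odd_sqr nN1.
have nM : ~~ (2 %| M)%Z.
  have -> : M = 2 * (4 * c + 4 * t + 8 * N2) + 1 by rewrite /M Ec; ring.
  by clear; lia.
have EgM : (s * D)%:~R * (g / (a ^+ 3 * e)) ^+ 2 = M%:~R :> rat.
  apply: ratr_algC_inj; have -> : ratr ((s * D)%:~R * (g / (a ^+ 3 * e)) ^+ 2)
     = (s * D)%:~R * (ratr g / (ratr a ^+ 3 * ratr e)) ^+ 2 :> algC.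
    have -> : ratr g / (ratr a ^+ 3 * ratr e) = ratr (g / (a ^+ 3 * e)) :> algC.
      by rewrite fmorph_div; congr (_ / _); ring.
    by ring.
  rewrite ratr_int -EM; apply: (mulfI (expf_neq0 2 (mulf_neq0 (expf_neq0 3 a0) e0'))).
  transitivity ((s * D)%:~R * ratr g ^+ 2 : algC).
    by field; rewrite e0' a0.
  by rewrite -Ng E6 -Ea -Ee; ring.
have h8 : (8 %| s * D - 1)%Z.
  have := odd_rat_sqr_mod8 nD nM EgM; rewrite /M Ec; move: (s * D) => T; clear; lia.
by split=> //; move: (s * D) h8 => T; clear; lia.
Qed.

End ForwardLocal.


(** * Necessity of the conditions *)

(** The coordinate equation [hI] makes [X] odd. Then [hR] gives [D' = 2 + m'] modulo 4 and [h8]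
    gives [s D' = 2 - m'] modulo 8; the sign [s = 1] would make [2 m'] divisible by 4. *)
Lemma even_case_int (A' X Y a b m' D' t s : int) : (A' %% 4)%Z = 1 ->
  A' ^+ 3 - 27 = 2 * (D' * t ^+ 2) ->
  A' ^+ 3 * (2 * X ^+ 2 + m' * (2 * Y + 1) ^+ 2)
    = D' * t ^+ 2 * ((4 * a + 1) ^+ 3 + 6 * m' * (4 * a + 1) * (4 * b + 2) ^+ 2) ->
  A' ^+ 3 * (X * (2 * Y + 1))
    = D' * t ^+ 2 * (3 * (4 * a + 1) ^+ 2 * (2 * b + 1) + 8 * m' * (2 * b + 1) ^+ 3) ->
  (8 %| s * D' - (2 * X ^+ 2 - m' * (2 * Y + 1) ^+ 2))%Z ->
  (s = 1 \/ s = -1) -> ~~ (2 %| m')%Z -> ~~ (2 %| D')%Z ->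
  s = -1 /\ (8 %| m' - D' - 2)%Z.
Proof.
move=> hA hF hR hI h8 hs nm nD.
have odd1 (u : int) : ~~ (2 %| 2 * u + 1)%Z by clear; lia.
have [al Eal] : exists al, A' = 4 * al + 1 by exists (A' %/ 4)%Z; clear -hA; lia.
have nt : ~~ (2 %| t)%Z.
  apply/negP => /dvdzP[u Eu]; move: hF; rewrite Eal Eu.
  have -> : (4 * al + 1) ^+ 3 - 27 = 2 * (2 * (16 * al ^+ 3 + 12 * al ^+ 2 + 3 * al - 7) + 1) by ring.
  have -> : 2 * (D' * (u * 2) ^+ 2) = 2 * (2 * (2 * D' * u ^+ 2)) by ring.
  by move: (16 * _ + _ + _ - _) (2 * D' * _) => ? ?; clear; lia.
have [c Ec] := odd_sqr nt.
have [e Ee] : exists e, D' = 2 * e + 1 by exact: odd_half.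
have nX : ~~ (2 %| X)%Z.
  apply/negP => /dvdzP[u Eu]; move: hI; rewrite Ec Eu Ee.
  have -> : A' ^+ 3 * (u * 2 * (2 * Y + 1)) = 2 * (A' ^+ 3 * (u * (2 * Y + 1))) by ring.
  have -> : 3 * (4 * a + 1) ^+ 2 * (2 * b + 1) + 8 * m' * (2 * b + 1) ^+ 3
    = 2 * (3 * (8 * a ^+ 2 + 4 * a) * (2 * b + 1) + 3 * b + 1 + 4 * m' * (2 * b + 1) ^+ 3) + 1.
    by ring.
  move: (3 * _ * _ + _ + _ + _) (A' ^+ 3 * _) => f g.
  have -> : (2 * e + 1) * (8 * c + 1) * (2 * f + 1)
    = 2 * ((2 * e + 1) * (8 * c + 1) * f + 8 * e * c + 4 * c + e) + 1 by ring.
  by move: (_ * f + _ + _ + _) => h; clear; lia.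
have [x Ex] := odd_sqr nX; have [y Ey] := odd_sqr (odd1 Y).
rewrite Ex Ey in hR h8; rewrite Ec in hR.
have h4 : (4 %| 2 + m' - D')%Z.
  pose k1 := 16 * al ^+ 3 + 12 * al ^+ 2 + 3 * al.
  have Ek1 : A' ^+ 3 = 4 * k1 + 1 by rewrite Eal /k1; ring.
  pose k2 := 16 * a ^+ 3 + 12 * a ^+ 2 + 3 * a + 6 * m' * (4 * a + 1) * (2 * b + 1) ^+ 2.
  have Ek2 : (4 * a + 1) ^+ 3 + 6 * m' * (4 * a + 1) * (4 * b + 2) ^+ 2 = 4 * k2 + 1.
    by rewrite /k2; ring.
  rewrite Ek1 Ek2 in hR; apply/dvdzP.
  exists (D' * (2 * c) * (4 * k2 + 1) + D' * k2 - k1 * (2 * (8 * x + 1) + m' * (8 * y + 1))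
    - 4 * x - 2 * m' * y).
  apply/eqP; rewrite -subr_eq0; apply/eqP.
  transitivity ((4 * k1 + 1) * (2 * (8 * x + 1) + m' * (8 * y + 1))
    - D' * (8 * c + 1) * (4 * k2 + 1)); first by ring.
  by rewrite hR; ring.
have {h8}/dvdzP[l El] := h8; have {h4}/dvdzP[k Ek] := h4.
have E8 : s * D' - 2 + m' = 8 * (l + 2 * x - m' * y).
  transitivity (s * D' - (2 * (8 * x + 1) - m' * (8 * y + 1)) + 8 * (2 * x - m' * y)); first by ring.
  by rewrite El; ring.
move: (l + 2 * x - m' * y) E8 => L E8; by move: Ee Ek hs E8; clear=> Ee Ek [] -> E8; lia.
Qed.

Section Forward.
Context {m : int} (F : quadfield m).
Local Notation K := (inK m).
Implicit Type v : place m.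

(** The relation [A^3 c6^2 = (A^3 - 1728) c4^3] is compared coordinate by coordinate, and the norm
    of [c6] adds a congruence modulo 8. The outcome [m' = D' + 2] modulo 8 turns into [q = D + 1] on
    multiplication by [D'], whose square is 1 modulo 8. *)
Lemma even_case E (A D t s q : int) (g : rat) v : pl_p v = 2%N -> ram v ->
  squarefree D -> (2 %| D)%Z -> m = q * D -> (s = 1 \/ s = -1) ->
  c4 E ^+ 3 = A%:~R ^+ 3 * disc E -> disc E != 0 ->
  D * t ^+ 2 = A ^+ 3 - 1728 ->
  c6 E * F (c6 E) = (s * D)%:~R * ratr g ^+ 2 ->
  (exists E' u, [/\ K u, u != 0 & covariant_scale E E' u] /\ @even_D_model m E' A) ->
  s = -1 /\ (q %% 8)%Z = ((D + 1) %% 8)%Z.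
Proof.
move=> p2 rv sD /dvdzP[D' ED] Eq hs e4 d0 EDt Ng.
move=> [E' [u [[Ku u0 cs] [m' [A' [X [Y [a [b [Em EA hA Ec4 Ec6]]]]]]]]]].
have e4' := cube_covariant_scale u0 cs e4.
have nD : ~~ (2 %| D')%Z.
  apply/negP => /dvdzP[k Ek]; have := @squarefree_sqr D 2 k sD.
  by rewrite ED Ek => h; have := h _; rewrite -mulrA mulrC => /(_ erefl).
have nm : ~~ (2 %| m')%Z.
  by have := sqf_mod4 F; rewrite Em; clear; lia.
have [al Eal] : exists al, A' = 4 * al + 1 by exists (A' %/ 4)%Z; clear -hA; lia.
pose F0 := 32 * al ^+ 3 + 24 * al ^+ 2 + 6 * al - 13.
have EF0 : A' ^+ 3 - 27 = 2 * F0 by rewrite Eal /F0; ring.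
have E64 : 64 * F0 = D' * t ^+ 2.
  apply: (@mulfI _ 2) => //; transitivity (D * t ^+ 2); last by rewrite ED; ring.
  rewrite EDt EA; transitivity (64 * (2 * F0)); first by ring.
  by rewrite -EF0; ring.
have /dvdzP[t' Et] := odd_dvd8 nD (esym E64).
have EF : F0 = D' * t' ^+ 2.
  by apply: (@mulfI _ 64) => //; rewrite E64 Et; ring.
rewrite EF in EF0.
have key : A'%:~R ^+ 3 * ((2 * X)%:~R + (2 * Y + 1)%:~R * sq m) ^+ 2
    = 2 * (D' * t' ^+ 2)%:~R * ((4 * a + 1)%:~R + (4 * b + 2)%:~R * sq m) ^+ 3.
  have n0 : (64 * 64 : algC) != 0 by rewrite mulf_neq0 ?pnatr_eq0.
  apply: (mulfI n0).
  transitivity (A%:~R ^+ 3 * c6 E' ^+ 2); first by rewrite EA Ec6; ring.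
  have -> : c6 E' ^+ 2 = c4 E' ^+ 3 - 1728 * disc E' by rewrite -c4_c6_disc; ring.
  have d0' : A%:~R ^+ 3 * (c4 E' ^+ 3 - 1728 * disc E') = (A ^+ 3 - 1728)%:~R * c4 E' ^+ 3.
    by rewrite e4'; ring.
  rewrite d0' EA Ec4.
  have -> : (4 * A') ^+ 3 - 1728 = 64 * (2 * (D' * t' ^+ 2)) by rewrite -EF0; ring.
  by ring.
have sC : sq m ^+ 2 = 2 * m'%:~R :> algC by rewrite sq2 Em intrM.
have [r1 r2] : A' ^+ 3 * (4 * X ^+ 2 + 2 * m' * (2 * Y + 1) ^+ 2)
    = 2 * (D' * t' ^+ 2) * ((4 * a + 1) ^+ 3 + 6 * m' * (4 * a + 1) * (4 * b + 2) ^+ 2) /\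
   A' ^+ 3 * (4 * X * (2 * Y + 1))
    = 2 * (D' * t' ^+ 2) * (3 * (4 * a + 1) ^+ 2 * (4 * b + 2) + 2 * m' * (4 * b + 2) ^+ 3).
  apply: (om_inj F); have [_ ->] := ram2_m p2 rv.
  transitivity (A'%:~R ^+ 3 * ((2 * X)%:~R + (2 * Y + 1)%:~R * sq m) ^+ 2).
    by ring: sC.
  by rewrite key; ring: sC.
have [ur Eur] := norm_rat F Ku.
have ur0 : ratr ur != 0 :> algC by rewrite -Eur mulf_neq0 ?cj_neq0.
have nnu : ~~ (2 %| 2 * X ^+ 2 - m' * (2 * Y + 1) ^+ 2)%Z.
  have [k ->] := odd_half nm.
  have -> : 2 * X ^+ 2 - (2 * k + 1) * (2 * Y + 1) ^+ 2
    = 2 * (X ^+ 2 - k * (2 * Y + 1) ^+ 2 - 2 * Y ^+ 2 - 2 * Y - 1) + 1 by ring.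
  by clear; lia.
have nsD : ~~ (2 %| s * D')%Z.
  by case: hs => ->; [rewrite mul1r | rewrite mulN1r rpredN].
have h8 : (8 %| s * D' - (2 * X ^+ 2 - m' * (2 * Y + 1) ^+ 2))%Z.
  apply: (@odd_rat_sqr_mod8 _ _ (g / (8 * ur ^+ 3)) nsD nnu).
  apply: ratr_algC_inj; rewrite ratr_int.
  have -> : ratr ((s * D')%:~R * (g / (8 * ur ^+ 3)) ^+ 2)
     = (s * D')%:~R * (ratr g / (8 * ratr ur ^+ 3)) ^+ 2 :> algC.
    have -> : ratr g / (8 * ratr ur ^+ 3) = ratr (g / (8 * ur ^+ 3)) :> algC.
      by rewrite fmorph_div; congr (_ / _); ring.
    by ring.
  have n0 : 2 * 64 * ratr ur ^+ 6 != 0 :> algC by rewrite mulf_neq0 ?expf_neq0 // mulf_neq0 ?pnatr_eq0.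
  apply: (mulfI n0).
  transitivity ((s * D)%:~R * ratr g ^+ 2 : algC); first by rewrite ED; field.
  rewrite -Ng; have [_ -> _] := cs; rewrite Ec6.
  transitivity (64 * ratr ur ^+ 6 * (((2 * X)%:~R + (2 * Y + 1)%:~R * sq m) *
     F ((2 * X)%:~R + (2 * Y + 1)%:~R * sq m))); first by rewrite -Eur; ring.
  by rewrite (norm_sq_coord F) Em; ring.
have R1 : A' ^+ 3 * (2 * X ^+ 2 + m' * (2 * Y + 1) ^+ 2)
    = D' * t' ^+ 2 * ((4 * a + 1) ^+ 3 + 6 * m' * (4 * a + 1) * (4 * b + 2) ^+ 2).
  apply: (@mulfI _ 2) => //; transitivity (A' ^+ 3 * (4 * X ^+ 2 + 2 * m' * (2 * Y + 1) ^+ 2)).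
    by ring.
  by rewrite r1; ring.
have R2 : A' ^+ 3 * (X * (2 * Y + 1))
    = D' * t' ^+ 2 * (3 * (4 * a + 1) ^+ 2 * (2 * b + 1) + 8 * m' * (2 * b + 1) ^+ 3).
  apply: (@mulfI _ 4) => //; transitivity (A' ^+ 3 * (4 * X * (2 * Y + 1))); first by ring.
  by rewrite r2; ring.
have [Es h] := even_case_int hA EF0 R1 R2 h8 hs nm nD.
split=> //.
have Eqm : m' = q * D' by apply: (@mulfI _ 2) => //; rewrite -Em Eq ED; ring.
have [d Ed] := odd_sqr nD.
have /dvdzP[k Ek] := h.
have E8 : q - (D + 1) = 8 * (k * D' - q * d + d).
  have -> : q - (D + 1) = q * D' ^+ 2 - D' ^+ 2 - 2 * D' + 8 * (d - q * d).
    by rewrite Ed ED; ring.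
  have -> : q * D' ^+ 2 - D' ^+ 2 - 2 * D' = (m' - D' - 2) * D' by rewrite Eqm; ring.
  by rewrite Ek; ring.
by move: (k * D' - _ + _) E8 => j E8; clear -E8; lia.
Qed.

(** At an unramified prime dividing [D] the valuation of [disc = D^3 w^6] is odd, whereas good
    reduction makes it a multiple of 12. *)
Lemma ram_of_dvd E (D : int) (w : algC) v : squarefree D -> (pl_p v %| D)%Z ->
  everywhere_good m E -> K w -> w != 0 -> disc E = D%:~R ^+ 3 * w ^+ 6 -> ram v.
Proof.
move=> sD pD eg Kw w0 Ed; apply/negPn/negP => rv.
have [E' [u [Ku u0 [_ _ hd] cf Ud]]] := local_model v eg.
have [y [a [b [Uy Ey]]]] := unram_val F rv Kw w0.
have [z [c [d [Uz Ez]]]] := unram_val F rv Ku u0.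
have /dvdzP[D1 ED] := pD.
have nD1 : ~~ (pl_p v %| D1)%Z.
  apply/negP => /dvdzP[k Ek]; have [_ /(_ _ (pl_pP v))/negP] := sD; apply.
  by rewrite ED Ek !abszM /= -mulnA dvdn_mull.
have U1 := unitM (unitX 3 (unit_int nD1)) (unitX 6 Uy).
have U2 := unitM (unitX 12 Uz) Ud.
have e6 (x : algC) k : x ^+ (6 * k)%N = (x ^+ k) ^+ 6 by rewrite mulnC exprM.
have e12 (x : algC) k : x ^+ (12 * k)%N = (x ^+ k) ^+ 12 by rewrite mulnC exprM.
have : D1%:~R ^+ 3 * y ^+ 6 * (pl_p v)%:R ^+ (3 + 6 * b + 12 * c)%N
     = z ^+ 12 * disc E' * (pl_p v)%:R ^+ (12 * d + 6 * a)%N.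
  transitivity (D%:~R ^+ 3 * w ^+ 6 * (pl_p v)%:R ^+ (6 * a + 12 * c)%N).
    rewrite (exprD _ (3 + 6 * b)%N) (exprD _ 3%N) (exprD _ (6 * a)%N) !e6 !e12 ED intrM.
    transitivity (D1%:~R ^+ 3 * (y * (pl_p v)%:R ^+ b) ^+ 6 * (pl_p v)%:R ^+ 3 * (pl_p v)%:R ^+ c ^+ 12).
      by ring.
    by rewrite -Ey; ring.
  rewrite -Ed hd (exprD _ (6 * a)%N) (exprD _ (12 * d)%N) !e6 !e12.
  transitivity ((u * (pl_p v)%:R ^+ c) ^+ 12 * disc E' * (pl_p v)%:R ^+ a ^+ 6); first by ring.
  by rewrite Ez; ring.
by move/(ppow_unit U1 U2); clear; lia.
Qed.

Lemma eps_odd (D s : int) : (s = 1 \/ s = -1) -> (4 %| s * D - 1)%Z -> eps D = s.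
Proof. by rewrite /eps => -[->|->] h; case: eqP => // h'; clear -h h'; lia. Qed.

Lemma logn_odd (x : int) : ~~ (2 %| x)%Z -> logn 2 `|x| = 0%N.
Proof. by rewrite dvdzE /= => h; rewrite lognE (negbTE h) !andbF. Qed.

(** The parity of the valuation of [A^3 - 1728] at 2 decides: it is 0 for odd [A], 6 when 16 divides
    [A], and 7 in the second case. *)
Lemma good_parity (A D t : int) : squarefree D -> t != 0 -> D * t ^+ 2 = A ^+ 3 - 1728 ->
  (~~ (2 %| A)%Z \/ (16 %| A)%Z -> ~~ (2 %| D)%Z) /\
  (forall A', A = 4 * A' -> (A' %% 4)%Z = 1 -> (2 %| D)%Z).
Proof.
move=> sD t0 E; have [D0 _] := sD; have l1 := squarefree_logn sD (isT : prime 2).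
have lE : logn 2 `|A ^+ 3 - 1728| = (logn 2 `|D| + 2 * logn 2 `|t|)%N.
  by rewrite -E abszM abszX lognM ?expn_gt0 ?absz_gt0 // ?t0 // lognX.
have l22 : logn 2 `|2%:Z| = 1%N by rewrite logn_prime.
split=> [[nA|/dvdzP[a Ea]]|A' EA hA].
- apply: contra nA => d2; apply: (@prime_dvdzX 2 A 3) => //.
  have -> : A ^+ 3 = D * t ^+ 2 + 864 * 2 by rewrite E; ring.
  by rewrite rpredD ?dvdz_mulr ?dvdz_mull.
- apply/negP; rewrite dvdzE => d2.
  have : logn 2 `|A ^+ 3 - 1728| = 6%N.
    have -> : A ^+ 3 - 1728 = 2 ^+ 6 * (2 * (32 * a ^+ 3 - 14) + 1) by rewrite Ea; ring.
    rewrite abszM lognM ?absz_gt0 //; last by clear; lia.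
    rewrite [X in (_ + X)%N]logn_odd; last by clear; lia.
    by rewrite abszX lognX l22 addn0.
  have : logn 2 `|D| = 1%N.
    by apply/eqP; rewrite eqn_leq l1 -(pfactor_dvdn 1) ?absz_gt0.
  by rewrite lE => ->; move: (logn 2 `|t|) => x; clear; lia.
rewrite dvdzE; have [al Eal] : exists al, A' = 4 * al + 1 by exists (A' %/ 4)%Z; clear -hA; lia.
have : logn 2 `|A ^+ 3 - 1728| = 7%N.
  have -> : A ^+ 3 - 1728 = 2 ^+ 7 * (2 * (16 * al ^+ 3 + 12 * al ^+ 2 + 3 * al - 7) + 1).
    by rewrite EA Eal; ring.
  rewrite abszM lognM ?absz_gt0 //; last by clear; lia.
  rewrite [X in (_ + X)%N]logn_odd; last by clear; lia.
  by rewrite abszX lognX l22 addn0.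
rewrite lE => h; have : (0 < logn 2 `|D|)%N by move: h; move: (logn 2 _) (logn 2 _); clear; lia.
by rewrite -(pfactor_dvdn 1) ?absz_gt0.
Qed.

Lemma forward E : elliptic_over m E -> rational_j E -> everywhere_good m E ->
  exists D q : int,
     good D /\ m = q * D /\ [/\
         (forall p : nat, prime p -> odd p -> (p %| `|D|)%N -> legendre (- eps D * q) p = 1),
         (forall l : nat, prime l -> odd l -> (l %| `|q|)%N -> legendre (eps D * D) l = 1),
         (eps D * D < 0 -> 0 < m),
         ((D %% 8)%Z = 3 \/ (D %% 8)%Z = 5 -> (q %% 4)%Z = (D %% 4)%Z) &
         ((2 %| D)%Z -> (q %% 8)%Z = ((D + 1) %% 8)%Z)].
Proof.
move=> el rj eg; have [ov d0] := el.
have [A e4] := j_cube F el rj eg.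
have RA : inR A by split; [exact: (two_adic_A F el eg e4) | exact: (three_adic F el eg e4)].
have A0 : A != 0.
  by apply/eqP => h; have [_ h3] := RA; move: h3; rewrite h => /(_ isT).
have B0 := inR_cube_neq RA.
have [D [t [sD t0 EDt]]] := squarefree_part B0.
have [D0 _] := sD.
have AC : (A%:~R : algC) != 0 by rewrite intr_eq0.
have tC : (t%:~R : algC) != 0 by rewrite intr_eq0.
have DC : (D%:~R : algC) != 0 by rewrite intr_eq0.
have [kc4 kc6 kd] := inK_covariants ov.
pose dl := c4 E / A%:~R.
have dl3 : dl ^+ 3 = disc E by rewrite expr_div_n e4 mulrAC divff ?mul1r // expf_neq0.
have dl0 : dl != 0 by apply: contraNneq d0 => h; rewrite -dl3 h expr0n.
pose w := c6 E / (t%:~R * D%:~R * dl).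
have Kdl : K dl by apply: inK_div => //; exact: inK_int.
have Kw : K w.
  by apply: inK_div => //; apply: inKM => //; apply: inKM; exact: inK_int.
have Ec6 : c6 E = t%:~R * D%:~R * dl * w.
  by rewrite /w mulrC divfK // mulf_neq0 // mulf_neq0.
(* From [c6^2 = (A^3 - 1728) disc = D t^2 dl^3] and the definition of [w]. *)
have Edl : dl = D%:~R * w ^+ 2.
  have n0 : t%:~R ^+ 2 * D%:~R * dl ^+ 2 != 0.
    by rewrite mulf_neq0 ?expf_neq0 // mulf_neq0 ?expf_neq0.
  apply: (mulfI n0); transitivity ((A ^+ 3 - 1728)%:~R * disc E).
    by rewrite EDt -dl3; ring.
  transitivity (c6 E ^+ 2); last by rewrite Ec6; ring.
  transitivity (c4 E ^+ 3 - 1728 * disc E); first by rewrite e4; ring.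
  by rewrite -c4_c6_disc; ring.
have w0 : w != 0 by apply: contraNneq dl0 => h; rewrite Edl h expr0n mulr0.
have Edisc : disc E = D%:~R ^+ 3 * w ^+ 6 by rewrite -dl3 Edl; ring.
have {}Ec6 : c6 E = t%:~R * D%:~R ^+ 2 * w ^+ 3 by rewrite Ec6 Edl; ring.
have [n En] := disc_norm F el eg.
have [a [b Ew]] := Kw.
(* [y] is [D N(w)], and [y^6 = N(disc)] is a 12th power up to sign, so [y] is a square up to
   sign. *)
pose y : rat := D%:~R * (a ^+ 2 - m%:~R * b ^+ 2).
have Ey : D%:~R * (w * F w) = ratr y.
  by rewrite Ew cj_mk /y; ring: (sq2 m).
have Ey6 : disc E * F (disc E) = ratr (y ^+ 6).
  transitivity ((D%:~R * (w * F w)) ^+ 6); first by rewrite Edisc; ring.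
  by rewrite Ey; ring.
have [s [hs Es]] : exists s : int, (s = 1 \/ s = -1) /\ y = s%:~R * n ^+ 2.
  apply: rat_sixth_power.
  case: En => En; [left | right]; apply: ratr_algC_inj; rewrite -Ey6 En; ring.
have n0 : n != 0.
  apply: contraNneq (mulf_neq0 DC (mulf_neq0 w0 (cj_neq0 F w0))) => h.
  by rewrite Ey Es h expr0n mulr0 rmorph0.
have pm v : (pl_p v %| D)%Z -> ram v.
  by move=> pD; apply: (ram_of_dvd sD pD eg Kw w0 Edisc).
have Ng : c6 E * F (c6 E) = (s * D)%:~R * ratr (t%:~R * n ^+ 3) ^+ 2.
  have ss : (s%:~R : algC) ^+ 3 = s%:~R by case: hs => ->; ring.
  transitivity (t%:~R ^+ 2 * D%:~R * (D%:~R * (w * F w)) ^+ 3); first by rewrite Ec6; ring.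
  rewrite Ey Es; transitivity (t%:~R ^+ 2 * D%:~R * ((s%:~R : algC) ^+ 3 * ratr n ^+ 6)); first by ring.
  by rewrite ss; ring.
have [v2 p2] := @place_exists m F 2 isT.
have [par1 par2] := good_parity sD t0 (esym EDt).
(* Every prime factor of [D] ramifies. Ramified odd primes divide [m], and an even [D] forces
   [even_D_model], where [m] is even. *)
have Dm : (D %| m)%Z.
  apply: squarefree_dvd => // p pp pD; have [v Ev] := place_exists F pp.
  have rv : ram v by apply: pm; rewrite Ev.
  have [p2'|pn2] := eqVneq p 2%N.
    have p2v : pl_p v = 2%N by rewrite Ev.
    have [[hA _]|[_ [E' [u [_ [m' [A' [X [Y [? [? [Em _ _ _ _]]]]]]]]]]]] := two_adic_cases F p2v el eg e4.
      by move: (par1 hA); rewrite p2' in pD; rewrite pD.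
    by rewrite Em p2' dvdz_mulr.
  by move: rv; rewrite ram_odd Ev.
have /dvdzP[q Eq] := Dm.
have [q_odd q_even] : ((~~ (2 %| D)%Z) -> eps D = s /\ (ram v2 -> (8 %| s * D - 1)%Z)) /\
   ((2 %| D)%Z -> s = -1 /\ (q %% 8)%Z = ((D + 1) %% 8)%Z).
  have [[hA _]|[rv data]] := two_adic_cases F p2 el eg e4.
    split=> [nD|h]; last by case/negP: (par1 hA).
    have nsD : ~~ (2 %| s * D)%Z.
      by case: hs => ->; [rewrite mul1r | rewrite mulN1r rpredN].
    have nA4 : ~~ (16 %| A - 4)%Z by move: hA; clear; lia.
    have [h4 h8] := odd_case_mod p2 el eg e4 AC nA4 nsD Ng.
    by split=> //; exact: eps_odd.
  split=> h.
    have [E' [u [_ [m' [A' [X [Y [? [? [_ EA hA _ _]]]]]]]]]] := data.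
    by case/negP: h; exact: par2 EA hA.
  exact: (even_case p2 rv sD h Eq hs e4 d0 (esym EDt) Ng data).
have Eeps : eps D = s.
  have [h|h] := orP (orbN (2 %| D)%Z); last by case: (q_odd h).
  have [-> _] := q_even h; rewrite /eps; case: eqP => // h'; clear -h h'; lia.
have [x1 [y1 [z1 [z10 Eform cop]]]] : exists x y z : int, [/\ z != 0, D * x ^+ 2 - q * y ^+ 2 = s * z ^+ 2 &
   forall p : nat, prime p -> (p %| x)%Z -> (p %| y)%Z -> (p %| z)%Z -> False].
  exact: (ternary_form sD Eq hs n0 Es).
have ss : s * s = 1 by case: hs => ->.
have sqm (p : nat) : prime p -> (p * p %| `|(q * D)%R|)%N -> False.
  by move=> pp; rewrite -Eq; have [_ /(_ p pp)/negP] := qf_sqf F.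
have nDq (p : nat) : prime p -> (p %| D)%Z -> (p %| q)%Z -> False.
  by rewrite !dvdzE => pp h1 h2; apply: (sqm p pp); rewrite abszM dvdn_mul.
exists D, q; split; first by split=> //; exists A, t; split.
split=> //; rewrite Eeps; split.
- move=> p pp _ pD; have -> : - s * q = s * - q by ring.
  apply: (@form_residue D _ s x1 y1 z1) => //; first by rewrite -Eform; ring.
    by have [_ ->] := sD.
  by rewrite rpredN; apply/negP; exact: nDq pp pD.
- move=> l pl _ lq; apply: (@form_residue (- q) _ s y1 x1 z1) => //.
  + by rewrite -Eform; ring.
  + by move=> p pp h1 h2; exact: cop pp h2 h1.
  + by rewrite rpredN.
  + by rewrite abszN; apply/negP => h; apply: (sqm l pl); rewrite abszM dvdn_mulr.
  by apply/negP => h; exact: nDq pl h lq.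
(* If [m] were not positive, [D^2 x1^2 - m y1^2] would be nonnegative, but it equals [s D z1^2],
   which is negative. *)
- move=> sD0; have [m_pos//|m_neg] := ltP 0 m.
  have : D ^+ 2 * x1 ^+ 2 - m * y1 ^+ 2 = s * D * z1 ^+ 2.
    by transitivity (D * (D * x1 ^+ 2 - q * y1 ^+ 2)); [rewrite Eq | rewrite Eform]; ring.
  have z2p : 0 < z1 ^+ 2 by rewrite lt0r sqr_ge0 expf_neq0.
  have lt : s * D * z1 ^+ 2 < 0 by rewrite pmulr_llt0.
  have ge : 0 <= D ^+ 2 * x1 ^+ 2 - m * y1 ^+ 2.
    apply: addr_ge0; first by apply: mulr_ge0; exact: sqr_ge0.
    by rewrite -mulNr; apply: mulr_ge0; [rewrite oppr_ge0 | exact: sqr_ge0].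
  by move=> h; move: ge; rewrite h leNgt lt.
(* If 2 ramifies, [s D = 1] modulo 8 contradicts [D = 3] or [5]. Otherwise [m = q D] is 1 modulo 4,
   so [q = D] modulo 4. *)
- move=> hD; have nD : ~~ (2 %| D)%Z by move: hD; clear; lia.
  have [_ h8] := q_odd nD.
  have [rv|nrv] := orP (orbN (ram v2)).
    by have := h8 rv; case: hs => ->; move: hD; clear; lia.
  have m1 : (m %% 4)%Z = 1.
    move: nrv; rewrite /ram p2; case: (tau_nu_cases m) => -[//] _ -> -> _.
    by clear; lia.
  have [d [r [Ed hr]]] : exists d r, D = 4 * d + r /\ (r = 1 \/ r = 3).
    by exists (D %/ 4)%Z, (D %% 4)%Z; move: nD; clear; lia.
  have : ((q * (4 * d + r)) %% 4)%Z = 1 by rewrite -Ed -Eq.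
  have -> : q * (4 * d + r) = 4 * (q * d) + q * r by ring.
  by rewrite Ed; case: hr => ->; clear; lia.
- by move=> h; case: (q_even h).
Qed.

End Forward.


(** * Legendre's theorem on conics *)

(** Chinese remainders over the prime factors; modulo 2 every integer is a square. *)
Lemma sqrt_mod_squarefree (n : nat) (a : int) : (0 < n)%N ->
  (forall p : nat, prime p -> ~~ (p * p %| n)%N) ->
  (forall p : nat, prime p -> odd p -> (p %| n)%N -> legendre a p = 1) ->
  exists r : int, (n %| r ^+ 2 - a)%Z.
Proof.
elim/ltn_ind: n => n IH n0 sn leg.
have [n1|n1] := leqP n 1; first by exists 0; rewrite (_ : n = 1%N) ?dvd1z //; lia.
have pp := pdiv_prime n1; set p := pdiv n in pp.
have /dvdnP[k Ek] : (p %| n)%N by exact: pdiv_dvd.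
have k0 : (0 < k)%N by move: n0; rewrite Ek muln_gt0 => /andP[].
have kn : (k < n)%N by rewrite Ek ltn_Pmulr ?prime_gt1.
have npk : ~~ (p %| k%:Z)%Z.
  rewrite dvdzE /=; apply: contra (sn p pp) => /dvdnP[j Ej].
  by rewrite Ek Ej -mulnA dvdn_mull.
have [r1 h1] : exists r : int, (p %| r ^+ 2 - a)%Z.
  have [po|pe] := boolP (odd p); last first.
    have p2 : p = 2%N by case/even_prime: pp pe => // ->.
    rewrite p2; exists a; have [b [->|->]] := int_parity a.
      by apply/dvdzP; exists (2 * b ^+ 2 - b); ring.
    by apply/dvdzP; exists (2 * b ^+ 2 + b); ring.
  have := leg p pp po (pdiv_dvd n); rewrite /legendre; case: ifP => // _.
  by case: existsP => // -[x hx] _; exists x%:Z.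
have [||r2 h2] := IH k kn k0.
- by move=> q qq; apply: contra (sn q qq) => h; rewrite Ek dvdn_mulr.
- by move=> q qq qo qk; apply: leg => //; rewrite Ek dvdn_mulr.
have [u [v E]] := prime_bezout pp npk.
exists (r2 * u * p%:Z + r1 * v * k%:Z).
have -> : n%:Z = p%:Z * k%:Z by rewrite Ek PoszM mulrC.
have hp : (p %| (r2 * u * p%:Z + r1 * v * k%:Z) ^+ 2 - a)%Z.
  have -> : (r2 * u * p%:Z + r1 * v * k%:Z) ^+ 2 - a
     = (r1 ^+ 2 - a) + p%:Z * ((r2 - r1) * u * (r1 + (r1 + (r2 - r1) * u * p%:Z))).
    have -> : r1 * v * k%:Z = r1 - r1 * u * p%:Z by rewrite -[X in X - _]mulr1 -E; ring.
    by ring.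
  by rewrite rpredD // dvdz_mulr.
have hk : (k %| (r2 * u * p%:Z + r1 * v * k%:Z) ^+ 2 - a)%Z.
  have -> : (r2 * u * p%:Z + r1 * v * k%:Z) ^+ 2 - a
     = (r2 ^+ 2 - a) + k%:Z * ((r1 - r2) * v * (r2 + (r2 + (r1 - r2) * v * k%:Z))).
    have -> : r2 * u * p%:Z = r2 - r2 * v * k%:Z by rewrite -[X in X - _]mulr1 -E; ring.
    by ring.
  by rewrite rpredD // dvdz_mulr.
rewrite Gauss_dvdz ?hp ?hk // coprimezE /= prime_coprime //.
Qed.

Lemma ceil_sqrt (n : nat) : exists c, (n <= c ^ 2)%N /\ forall x, (x < c)%N -> (x ^ 2 < n)%N.
Proof.
have ex : exists c, (n <= c ^ 2)%N.
  by exists n; case: n => // n; rewrite -mulnn leq_pmull.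
exists (ex_minn ex); case: ex_minnP => c hc hmin; split=> // x xc.
by rewrite ltnNge; apply/negP => /hmin; rewrite leqNgt xc.
Qed.

(** Pigeonhole: the box whose sides are the rounded-up square roots of [|be|], [|al|] and [|al be|]
    has more points than there are pairs of residues. The inequality is strict because a squarefree
    number above 1 is not a square. *)
Lemma thue_box (al be r r' : int) : al != 0 -> be != 0 ->
  (forall p : nat, prime p -> ~~ (p * p %| `|al|)%N) ->
  (forall p : nat, prime p -> ~~ (p * p %| `|be|)%N) ->
  (1 < `|al|)%N || (1 < `|be|)%N ->
  exists x y z : int, [/\ (al %| z - r * y)%Z /\ (be %| z - r' * x)%Z,
    (`|x| ^ 2 < `|be|)%N, (`|y| ^ 2 < `|al|)%N, (`|z| ^ 2 < `|al| * `|be|)%N &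
    ~ (x = 0 /\ y = 0 /\ z = 0)].
Proof.
move=> al0 be0 sa sb h1.
have [cx [hx bx]] := ceil_sqrt `|be|; have [cy [hy by_]] := ceil_sqrt `|al|.
have [cz [hz bz]] := ceil_sqrt (`|al| * `|be|).
have a0 : (0 < `|al|)%N by rewrite absz_gt0.
have b0 : (0 < `|be|)%N by rewrite absz_gt0.
have nsq (n c : nat) : (forall p : nat, prime p -> ~~ (p * p %| n)%N) -> (1 < n)%N -> n <> (c ^ 2)%N.
  move=> sn n1 En; have c1 : (1 < c)%N by move: n1; rewrite En; case: c {En} => [|[|c]].
  by case/negP: (sn _ (pdiv_prime c1)); rewrite En -mulnn dvdn_mul ?pdiv_dvd.
have big : (`|al| * `|be| < cx * cy * cz)%N.
  rewrite -(ltn_exp2r _ _ (isT : 0 < 2)%N) !expnMn.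
  have hxy : (`|be| * `|al| < cx ^ 2 * cy ^ 2)%N.
    case/orP: h1 => h1.
      have lt : (`|al| < cy ^ 2)%N by rewrite ltn_neqAle hy andbT; apply/eqP/nsq.
      by rewrite (leq_ltn_trans (leq_mul hx (leqnn _))) // ltn_pmul2l // (leq_trans b0).
    have lt : (`|be| < cx ^ 2)%N by rewrite ltn_neqAle hx andbT; apply/eqP/nsq.
    by rewrite (leq_ltn_trans (leq_mul (leqnn _) hy)) // ltn_pmul2r // (leq_trans a0).
  rewrite -expnMn -mulnn {1}(mulnC `|al|%N).
  apply: leq_trans (leq_mul (leqnn (cx ^ 2 * cy ^ 2)%N) hz).
  by rewrite ltn_pmul2r // muln_gt0 a0 b0.
have mlt (d u : int) : d != 0 -> (`|(u %% d)%Z| < `|d|)%N.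
  by move=> d0; have := ltz_mod u d0; have := modz_ge0 u d0; clear; lia.
pose f (t : 'I_cx * 'I_cy * 'I_cz) : 'I_`|al| * 'I_`|be| :=
  (Ordinal (mlt al (t.2%:Z - r * t.1.2%:Z) al0), Ordinal (mlt be (t.2%:Z - r' * t.1.1%:Z) be0)).
have /injectivePn[[[x1 y1] z1] [[[x2 y2] z2] ne [E1 E2]]] : ~~ injectiveb f.
  apply/negP => /injectiveP/leq_card; rewrite !card_prod !card_ord leqNgt.
  by rewrite big.
have modE (d u u' : int) : d != 0 -> `|(u %% d)%Z|%N = `|(u' %% d)%Z|%N -> (d %| u - u')%Z.
  move=> d0 E; rewrite -eqz_mod_dvd; apply/eqP.
  by have := modz_ge0 u d0; have := modz_ge0 u' d0; move: E; clear; lia.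
have sml (c : nat) (i j : 'I_c) n : (forall x, (x < c)%N -> (x ^ 2 < n)%N) ->
    (`|i%:Z - j%:Z| ^ 2 < n)%N.
  move=> hc; apply: hc; have := ltn_ord i; have := ltn_ord j; clear; lia.
exists (x1%:Z - x2%:Z), (y1%:Z - y2%:Z), (z1%:Z - z2%:Z); split.
- split.
    have := modE _ _ _ al0 E1; congr (_ %| _)%Z; rewrite /=; ring.
  have := modE _ _ _ be0 E2; congr (_ %| _)%Z; rewrite /=; ring.
- exact: sml bx.
- exact: sml by_.
- exact: sml bz.
move=> [ex [ey ez]]; case/eqP: ne; congr (_, _, _); apply: val_inj => /=.
- by move: ex; clear; lia.
- by move: ey; clear; lia.
- by move: ez; clear; lia.
Qed.

Lemma small_multiple (T k u v w : int) : 0 <= u < T -> 0 <= v < T -> 0 <= w < T ->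
  k * T = u + v - w -> k = 0 \/ k = 1.
Proof.
move=> hu hv hw E; have T0 : 0 < T by clear -hu; lia.
have lo : - 1 * T < k * T by rewrite E; clear -hu hv hw; lia.
have hi : k * T < 2 * T by rewrite E; clear -hu hv hw; lia.
by rewrite !ltr_pM2r // in lo hi; clear -lo hi; lia.
Qed.

(* Mordell's form of Legendre's theorem: a small vector of the lattice on which the form
   al x^2 + be y^2 - z^2 vanishes modulo al be gives the value 0 or al be, and
   (z^2 + al be)^2 = al (x z + be y)^2 + be (y z - al x)^2 handles the latter. *)
Lemma legendre_conic (al be : int) : al != 0 -> be != 0 ->
  (forall p : nat, prime p -> ~~ (p * p %| `|al|)%N) ->
  (forall p : nat, prime p -> ~~ (p * p %| `|be|)%N) ->
  coprimez al be -> (0 < al) || (0 < be) -> (forall z, z ^+ 2 + al * be != 0) ->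
  (forall p : nat, prime p -> odd p -> (p %| `|al|)%N -> legendre be p = 1) ->
  (forall p : nat, prime p -> odd p -> (p %| `|be|)%N -> legendre al p = 1) ->
  exists x y z : int, (x != 0) || (y != 0) /\ al * x ^+ 2 + be * y ^+ 2 = z ^+ 2.
Proof.
move=> al0 be0 sa sb cop pos nz la lb.
have [h1|] := boolP ((1 < `|al|)%N || (1 < `|be|)%N); last first.
  rewrite negb_or -!leqNgt => /andP[a1 b1].
  have [al1|be1] : al = 1 \/ be = 1 by move: a1 b1 pos al0 be0; clear; lia.
    by exists 1, 0, 1; rewrite al1; split=> //; ring.
  by exists 0, 1, 1; rewrite be1; split=> //; ring.
have [|r hr] := sqrt_mod_squarefree _ sa la; first by rewrite absz_gt0.
have [|r' hr'] := sqrt_mod_squarefree _ sb lb; first by rewrite absz_gt0.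
rewrite !dvdzE in hr hr'.
have [x [y [z [[d1 d2] bx by_ bz n0]]]] := thue_box r r' al0 be0 sa sb h1.
have da : (al %| al * x ^+ 2 + be * y ^+ 2 - z ^+ 2)%Z.
  have -> : al * x ^+ 2 + be * y ^+ 2 - z ^+ 2
    = al * x ^+ 2 - (r ^+ 2 - be) * y ^+ 2 - (z + r * y) * (z - r * y) by ring.
  by apply: rpredB; [apply: rpredB; [exact: dvdz_mulr | apply: dvdz_mulr; rewrite dvdzE] | exact: dvdz_mull].
have db : (be %| al * x ^+ 2 + be * y ^+ 2 - z ^+ 2)%Z.
  have -> : al * x ^+ 2 + be * y ^+ 2 - z ^+ 2
    = be * y ^+ 2 - (r' ^+ 2 - al) * x ^+ 2 - (z + r' * x) * (z - r' * x) by ring.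
  by apply: rpredB; [apply: rpredB; [exact: dvdz_mulr | apply: dvdz_mulr; rewrite dvdzE] | exact: dvdz_mull].
have /dvdzP[k Ek] : (al * be %| al * x ^+ 2 + be * y ^+ 2 - z ^+ 2)%Z by rewrite Gauss_dvdz // da db.
rewrite -!ltz_nat !absz_sqr ?PoszM !abszE in bx by_ bz.
have hx0 := sqr_ge0 x; have hy0 := sqr_ge0 y; have hz0 := sqr_ge0 z.
have a0 : 0 < `|al| by rewrite normr_gt0.
have b0 : 0 < `|be| by rewrite normr_gt0.
have hu : 0 <= `|al| * x ^+ 2 < `|al| * `|be| by rewrite mulr_ge0 //= ltr_pM2l.
have hv : 0 <= `|be| * y ^+ 2 < `|al| * `|be| by rewrite mulr_ge0 //= mulrC ltr_pM2r.
have hw : 0 <= z ^+ 2 < `|al| * `|be| by rewrite hz0.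
(* For each admissible choice of signs, [k |al be|] is the sum of two of the three nonnegative terms
   minus the third. *)
have k01 : k = 0 \/ k = 1.
  have [ha|ha] := ltP 0 al; have [hb|hb] := ltP 0 be.
  - by apply: (small_multiple hu hv hw); rewrite !gtr0_norm // -Ek.
  - apply: (small_multiple hw hv hu); rewrite (gtr0_norm ha) (ler0_norm hb).
    by transitivity (- (k * (al * be))); [|rewrite -Ek]; ring.
  - apply: (small_multiple hw hu hv); rewrite (ler0_norm ha) (gtr0_norm hb).
    by transitivity (- (k * (al * be))); [|rewrite -Ek]; ring.
  - by move: pos; rewrite !ltNge ha hb.
case: k01 => k_; rewrite k_ in Ek.
  exists x, y, z; split; last by apply/eqP; rewrite -subr_eq0 Ek mul0r.
  rewrite -negb_and; apply/negP => /andP[/eqP x0 /eqP y0]; apply: n0; do !split=> //.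
  by apply/eqP; rewrite -sqrf_eq0; apply/eqP; move: Ek; rewrite x0 y0; clear; lia.
have E1 : al * x ^+ 2 + be * y ^+ 2 = z ^+ 2 + al * be by rewrite -[al * be]mul1r -Ek; ring.
exists (x * z + be * y), (y * z - al * x), (z ^+ 2 + al * be); split; last first.
  transitivity ((z ^+ 2 + al * be) * (al * x ^+ 2 + be * y ^+ 2)); first by ring.
  by rewrite E1; ring.
rewrite -negb_and; apply/negP => /andP[/eqP x0 /eqP y0]; case/eqP: (nz z).
apply/eqP; rewrite -sqrf_eq0; apply/eqP.
transitivity (al * (x * z + be * y) ^+ 2 + be * (y * z - al * x) ^+ 2); last by rewrite x0 y0; ring.
transitivity ((z ^+ 2 + al * be) * (al * x ^+ 2 + be * y ^+ 2)); last by ring.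
by rewrite E1; ring.
Qed.


(** * A primitive element of prescribed norm, and its behaviour at odd primes *)

Lemma coprime_pair (x y : int) : (x != 0) || (y != 0) -> exists g x' y' : int,
  [/\ g != 0, x = g * x', y = g * y' &
   forall p : nat, prime p -> (p %| x')%Z -> (p %| y')%Z -> False].
Proof.
have aux (u w : int) : w != 0 -> exists g u' w' : int, [/\ g != 0, u = g * u', w = g * w' &
   forall p : nat, prime p -> (p %| u')%Z -> (p %| w')%Z -> False].
  move=> w0; have [g [u1 [u2 [w1 [g0 E1 E2 Ew cop]]]]] := coprime_triple u u w0.
  have E12 : u1 = u2 by apply: (mulfI g0); rewrite -E1 -E2.
  by exists g, u1, w1; split=> // p pp h; apply: (cop p pp h); rewrite -E12.
case/orP=> [/aux|/aux] h; last exact: h.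
have [g [y' [x' [g0 Ey Ex cop]]]] := h y.
by exists g, x', y'; split=> // p pp h1 h2; exact: (cop p pp h2 h1).
Qed.

Section Backward.
Context {m : int} (F : quadfield m).
Local Notation K := (inK m).
Local Notation O := (inOK m).
Local Notation om := (om m).
Local Notation tau := (tau m).
Local Notation nu := (nu m).
Local Notation inL v := (inOP m (pl v)).
Local Notation unitL v := (unitOP m (pl v)).
Implicit Type v : place m.

(** A point of [e D x^2 - e q y^2 = z^2] gives [D x + y sq m] of norm [e D z^2]. Dividing by the
    common factor [g] of its integral coordinates keeps the shape of the norm, because [g] divides
    [z] as [D] is squarefree. *)
Lemma primitive_norm (e D q : int) : squarefree D -> m = q * D -> (e = 1 \/ e = -1) ->
  (forall p : nat, prime p -> odd p -> (p %| `|D|)%N -> legendre (- e * q) p = 1) ->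
  (forall l : nat, prime l -> odd l -> (l %| `|q|)%N -> legendre (e * D) l = 1) ->
  (e * D < 0 -> 0 < m) ->
  exists a b z : int, [/\ a%:~R + b%:~R * om != 0,
    a ^+ 2 + tau * a * b + nu * b ^+ 2 = e * D * z ^+ 2 &
    forall p : nat, prime p -> (p %| a)%Z -> (p %| b)%Z -> False].
Proof.
move=> sD Em he la lb hm; have [D0 sD'] := sD.
have [m0 sm] := qf_sqf F.
have q0 : q != 0 by apply: contraNneq m0 => h; rewrite Em h mul0r.
have e0 : e != 0 by case: he => ->.
have absE (x : int) : `|(e * x)%R|%N = `|x|%N.
  by case: he => ->; rewrite ?mul1r // mulN1r abszN.
have sq' (p : nat) : prime p -> ~~ (p * p %| `|q|)%N.
  by move=> pp; apply: contra (sm p pp) => h; rewrite Em abszM dvdn_mulr.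
have [|||||||||x [y [z [xy0 E]]]] := @legendre_conic (e * D) (- e * q).
- by rewrite mulf_neq0.
- by rewrite mulf_neq0 ?oppr_eq0.
- by move=> p pp; rewrite absE; exact: sD'.
- by move=> p pp; rewrite mulNr abszN absE; exact: sq'.
- rewrite coprimezE mulNr abszN !absE; apply/negPn/negP => nc.
  have g1 : (1 < gcdn `|D| `|q|)%N.
    rewrite ltn_neqAle eq_sym nc gcdn_gt0 absz_gt0 D0 //.
  have pp := pdiv_prime g1; case/negP: (sm _ pp).
  rewrite Em abszM dvdn_mul //; apply: dvdn_trans (pdiv_dvd _) _.
    exact: dvdn_gcdr.
  exact: dvdn_gcdl.
- have [h|h] := ltP 0 (e * D); first by [].
  have hneg : e * D < 0 by rewrite lt_neqAle h mulf_neq0.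
  have := hm hneg; rewrite Em; move: hneg; case: he => ->.
    by rewrite mul1r mulN1r => h1 h2 /=; rewrite oppr_gt0; rewrite nmulr_lgt0 in h2.
  rewrite !mulN1r opprK oppr_lt0 => h1 h2 /=; rewrite pmulr_lgt0 // in h2.
  by rewrite mul1r.
(* The product of the two coefficients is [- m], and [m] is not a square. *)
- move=> z; have -> : z ^+ 2 + e * D * (- e * q) = z ^+ 2 - m.
    by rewrite Em; case: he => ->; ring.
  rewrite subr_eq0; apply/eqP => h; case/eqP: (qf_neq1 F).
  have := @squarefree_sqr m z 1 (qf_sqf F); rewrite mulr1 => /(_ (esym h)) z1.
  by rewrite -h -absz_sqr z1.
- by move=> p pp po; rewrite absE => pD; apply: la.
- by move=> p pp po; rewrite mulNr abszN absE => pD; apply: lb.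
pose w := (D * x)%:~R + y%:~R * sq m.
have Ow : O w by apply: inOD; [|apply: inOM; [|exact: inO_sq]]; exact: inO_int.
have w0 : w != 0.
  apply/eqP => h; have : ratr (D * x)%:~R + ratr y%:~R * sq m = 0 by rewrite !ratr_int.
  case/(sq_indep (qf_sqf F) (qf_neq1 F)) => /eqP + /eqP.
  by rewrite !intr_eq0 mulf_eq0 (negbTE D0) /= => /eqP x0 /eqP y0; move: xy0; rewrite x0 y0.
have Nw : w * F w = (e * D * z ^+ 2)%:~R.
  have -> : e * D * z ^+ 2 = (D * x) ^+ 2 - m * y ^+ 2.
    by rewrite -E Em; case: he => ->; ring.
  by rewrite /w (norm_sq_coord F).
have [X [Y Ew]] := inO_coord F Ow.
have XY0 : (X != 0) || (Y != 0).
  rewrite -negb_and; apply: contraNN w0 => /andP[/eqP X0 /eqP Y0].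
  by rewrite Ew X0 Y0 mul0r addr0.
have [g [a [b [g0 EX EY cop]]]] := coprime_pair XY0.
have gC : (g%:~R : algC) != 0 by rewrite intr_eq0.
have Ewg : w = g%:~R * (a%:~R + b%:~R * om) by rewrite Ew EX EY; ring.
have Nab : g ^+ 2 * (a ^+ 2 + tau * a * b + nu * b ^+ 2) = e * D * z ^+ 2.
  apply: (@intr_inj algC); rewrite -Nw Ewg intrM -(norm_coord F).
  by ring.
have [z' Ez'] : exists z' : int, z%:~R / g%:~R = z'%:~R :> rat.
  have gQ : (g%:~R : rat) != 0 by rewrite intr_eq0.
  apply: (@rat_sqr_mul_int D (e * (a ^+ 2 + tau * a * b + nu * b ^+ 2))) => //.
  apply: (mulfI (expf_neq0 2 gQ)); transitivity ((e * (e * D * z ^+ 2))%:~R : rat).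
    by case: he => ->; field.
  by rewrite -Nab; ring.
have Ez : z = g * z'.
  apply: (@intr_inj rat); rewrite intrM -Ez' mulrC divfK // intr_eq0 //.
exists a, b, z'; split=> //; first by apply: contraNneq w0 => h; rewrite Ewg h mulr0.
by apply: (mulfI (expf_neq0 2 g0)); rewrite Nab Ez; ring.
Qed.

(* Up to squares of K, w makes the twist below minimal at a prime of odd residue characteristic. *)
Definition scaled v (w : algC) (D : int) :=
  exists u w', [/\ K u, u != 0, K w' & w = u ^+ 2 * w'] /\
    inL v (D%:~R * w') /\ unitL v (D%:~R * w' ^+ 2).

(** [w / z^2] equals [e D / F w], a quotient of units. *)
Lemma notP_conj_scaled v (w : algC) (e D z : int) : O w -> ~~ (pl_p v %| D)%Z ->
  (e = 1 \/ e = -1) -> w != 0 ->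
  w * F w = (e * D * z ^+ 2)%:~R -> ~ pl v (F w) ->
  z%:~R != 0 :> algC /\ unitL v (w / z%:~R ^+ 2).
Proof.
move=> Ow nD he w0 N nF.
have fw0 := cj_neq0 F w0.
have z0 : z%:~R != 0 :> algC.
  rewrite intr_eq0; apply: contraNneq (mulf_neq0 w0 fw0) => h.
  by rewrite N h expr0n mulr0.
split=> //.
have -> : w / z%:~R ^+ 2 = (e * D)%:~R / F w.
  apply/eqP; rewrite eqr_div ?expf_neq0 // N; apply/eqP; ring.
apply: unit_div; last by apply: unit_O => //; exact: inO_cj.
by apply: unit_int; case: he => ->; rewrite ?mul1r // mulN1r rpredN.
Qed.

Lemma primitive_conj v (a b : int) : ~~ ram v ->
  (forall p : nat, prime p -> (p %| a)%Z -> (p %| b)%Z -> False) ->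
  pl v (a%:~R + b%:~R * om) -> ~ pl v (F (a%:~R + b%:~R * om)).
Proof.
move=> rv cop Pw Pfw; have [y [/(inO_coord F)[c [d ->]] E]] := unram_pdiv rv Pw Pfw.
have : a%:~R + b%:~R * om = ((pl_p v)%:Z * c)%:~R + ((pl_p v)%:Z * d)%:~R * om by rewrite E; ring.
by case/(om_inj F) => Ea Eb; apply: (cop _ (pl_pP v)); rewrite ?Ea ?Eb dvdz_mulr.
Qed.

(** A correction is needed only where [w] lies in the prime. At an unramified place [w / z^2]
    replaces [w]. At a ramified place [w^-1] does: primitivity leaves a single factor [p] in the
    norm, so [p] divides [D] but not [z], and [D / w^2] is a unit times [F w / w]. *)
Lemma scaled_odd v (a b e D q z : int) : pl_p v != 2%N -> squarefree D -> m = q * D ->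
  (e = 1 \/ e = -1) -> a%:~R + b%:~R * om != 0 ->
  a ^+ 2 + tau * a * b + nu * b ^+ 2 = e * D * z ^+ 2 ->
  (forall p : nat, prime p -> (p %| a)%Z -> (p %| b)%Z -> False) ->
  scaled v (a%:~R + b%:~R * om) D.
Proof.
move=> p2 sD Em he w0 N cop; pose w := a%:~R + b%:~R * om.
have pp := pl_pP v; have Ow : O w by exact: inO_mk.
have Nw : w * F w = (e * D * z ^+ 2)%:~R by rewrite norm_coord N.
have Ofw := inO_cj F Ow; have fw0 := cj_neq0 F w0.
have [D0 sD'] := sD; have DC : (D%:~R : algC) != 0 by rewrite intr_eq0.
have np2 : ~~ (pl_p v %| 2)%Z.
  by rewrite dvdzE /= dvdn_prime2 // (negbTE p2).
have np4 (x : int) : (pl_p v %| 4 * x)%Z = (pl_p v %| x)%Z.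
  have -> : 4 * x = 2 * (2 * x) by ring.
  by rewrite !prime_dvdzM // (negbTE np2).
have triv : ~ pl v w -> ~~ (pl_p v %| D)%Z -> scaled v w D.
  move=> nP nD; have Uw := unit_O Ow nP; exists 1, w; split.
    by split; [exact: inK1 | exact: oner_neq0 | exact: inO_K | rewrite expr1n mul1r].
  split; first by apply: LM; [exact: L_int | exact: unit_L].
  by apply: unitM; [exact: unit_int | exact: unitX].
have [rv|rv] := orP (orbN (ram v)); last first.
  have nD : ~~ (pl_p v %| D)%Z.
    by apply: contra rv => h; rewrite ram_odd //; have := dvdz_mull q h; rewrite -Em.
  have [Pw|nP] := classic (pl v w); last exact: triv.
  have [z0 Uz] := notP_conj_scaled Ow nD he w0 Nw (primitive_conj rv cop Pw).
  exists z%:~R, (w / z%:~R ^+ 2); split.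
    split=> //; [exact: inK_int | exact: unit_K Uz | by rewrite [RHS]mulrC divfK // expf_neq0].
  split; first by apply: LM; [exact: L_int | exact: unit_L].
  by apply: unitM; [exact: unit_int | exact: unitX].
have pm : (pl_p v %| m)%Z by move: (rv); rewrite ram_odd.
have [Pw|nP] := classic (pl v w); last first.
  apply: triv => //; apply/negP => h.
  apply: (notP_M Ow Ofw nP (ram_cjN rv Ow nP)); rewrite Nw; apply/pl_int.
  by rewrite -mulrA dvdz_mull // dvdz_mulr.
have pN : (pl_p v %| a ^+ 2 + tau * a * b + nu * b ^+ 2)%Z.
  by apply/pl_int; rewrite -(norm_coord F); apply: plMr.
have pT : (pl_p v %| 2 * a + tau * b)%Z.
  apply: (@prime_dvdzX _ _ 2) => //.
  have -> : (2 * a + tau * b) ^+ 2 = 4 * (a ^+ 2 + tau * a * b + nu * b ^+ 2)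
    + (tau ^+ 2 - 4 * nu) * b ^+ 2 by ring.
  by apply: rpredD; [exact: dvdz_mull | exact: dvdz_mulr].
(* If [p^2] divided the norm it would divide the discriminant times [b^2]; then [p] would divide [b]
   and [a], against primitivity. *)
have n2N : ~~ (pl_p v ^ 2 %| `|(a ^+ 2 + tau * a * b + nu * b ^+ 2)%R|)%N.
  apply/negP => h2; have h2z : ((pl_p v)%:Z ^+ 2 %| a ^+ 2 + tau * a * b + nu * b ^+ 2)%Z.
    by rewrite dvdzE abszX.
  have h3 : ((pl_p v)%:Z ^+ 2 %| (tau ^+ 2 - 4 * nu) * b ^+ 2)%Z.
    have -> : (tau ^+ 2 - 4 * nu) * b ^+ 2 = (2 * a + tau * b) * (2 * a + tau * b)
      - 4 * (a ^+ 2 + tau * a * b + nu * b ^+ 2) by ring.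
    by apply: rpredB; [rewrite expr2 dvdz_mul | apply: dvdz_mull].
  have /dvdzP[d' Ed'] := pm.
  have nd' : ~~ (pl_p v %| d')%Z.
    have [_ /(_ _ pp)] := qf_sqf F; apply: contra => /dvdzP[k Ek].
    by have := congr1 absz Ed'; rewrite Ek !abszM /= => ->; rewrite -mulnA dvdn_mull.
  have pb : (pl_p v %| b)%Z.
    have p0 : (pl_p v)%:Z != 0 by have := prime_gt0 pp; clear; lia.
    have {}h3 : (pl_p v %| d' * b ^+ 2)%Z.
      have /dvdzP[k Ek] := h3.
      case: (@disc_om_cases m) => hd; rewrite hd in Ek.
        apply/dvdzP; exists k; apply: (mulIf p0).
        by transitivity (m * b ^+ 2); [rewrite [in RHS]Ed' | rewrite Ek]; ring.
      rewrite -np4; apply/dvdzP; exists k; apply: (mulIf p0).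
      by transitivity (4 * m * b ^+ 2); [rewrite [in RHS]Ed' | rewrite Ek]; ring.
    by move: h3; rewrite prime_dvdzM // (negbTE nd') /= => /(prime_dvdzX pp).
  have pa : (pl_p v %| a)%Z.
    have : (pl_p v %| 2 * a)%Z.
      have -> : 2 * a = (2 * a + tau * b) - tau * b by ring.
      by apply: rpredB => //; apply: dvdz_mull.
    by rewrite prime_dvdzM // (negbTE np2).
  exact: cop pp pa pb.
have nz : ~~ (pl_p v %| z)%Z.
  apply: contra n2N => /dvdzP[k Ek]; rewrite N Ek.
  have : ((pl_p v)%:Z ^+ 2 %| e * D * (k * (pl_p v)%:Z) ^+ 2)%Z.
    by apply/dvdzP; exists (e * D * k ^+ 2); ring.
  by rewrite dvdzE abszX.
have ne : ~~ (pl_p v %| e)%Z.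
  have -> : (pl_p v %| e)%Z = (pl_p v == 1)%N by rewrite dvdzE; case: he => ->; rewrite dvdn1.
  by apply: contraTneq pp => ->.
have /dvdzP[D1 ED] : (pl_p v %| D)%Z.
  move: pN; rewrite N (prime_dvdzM _ (z ^+ 2) pp) (prime_dvdzM e D pp).
  case/orP=> [/orP[|//]|h]; last by case/negP: nz; exact: (prime_dvdzX pp h).
  by rewrite (negbTE ne).
have nD1 : ~~ (pl_p v %| D1)%Z.
  apply/negP => /dvdzP[k Ek]; have /negP := sD' _ pp; apply.
  by rewrite ED Ek !abszM /= -mulnA dvdn_mull.
have z0 : (z%:~R : algC) != 0 by apply: unit_neq0 (unit_int nz).
have eC : (e%:~R : algC) != 0 by case: he => ->; rewrite intr_eq0.
have e2 : (e%:~R : algC) * e%:~R = 1 by case: he => ->; rewrite -intrM.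
have pC := p_neq0 v.
have D1C : (D1%:~R : algC) != 0 by apply: unit_neq0 (unit_int nD1).
(* With [x + F x = p T'] and [x F x = p n], where [n] is prime to [p], one has
   [F x / x = (T' F x - n) / n]. Applied to [w] and to [F w], this makes [F w / w] a unit. *)
have half x : O x -> pl v x -> x * F x = w * F w -> F x != 0 -> inL v (F x / x).
  move=> Ox Px Nx fx0.
  have x0 : x != 0.
    by apply: contraNneq (mulf_neq0 w0 fw0) => h; rewrite -/w -Nx h mul0r.
  have [T ET] := trace_int F Ox.
  have /dvdzP[T' ET'] : (pl_p v %| T)%Z.
    by apply/pl_int; rewrite -ET; apply: plD => //; exact: ram_cj.
  have -> : F x / x = (T'%:~R * F x - (e * D1 * z ^+ 2)%:~R) / (e * D1 * z ^+ 2)%:~R.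
    have n0 : (e * D1 * z ^+ 2)%:~R != 0 :> algC.
      by rewrite !intrM !mulf_neq0.
    apply/eqP; rewrite eqr_div //; apply/eqP; apply: (mulfI pC).
    have EN : (pl_p v)%:R * (e * D1 * z ^+ 2)%:~R = x * F x.
      by rewrite Nx Nw ED; ring.
    have ETp : (pl_p v)%:R * T'%:~R = x + F x by rewrite ET ET' intrM mulrC.
    transitivity (F x * ((pl_p v)%:R * (e * D1 * z ^+ 2)%:~R)); first by ring.
    transitivity ((((pl_p v)%:R * T'%:~R) * F x - (pl_p v)%:R * (e * D1 * z ^+ 2)%:~R) * x); last by ring.
    by rewrite EN ETp; ring.
  apply: LM.
    by apply: LB; [apply: LM; [exact: L_int | exact/L_O/inO_cj] | exact: L_int].
  apply/unit_LV/unit_int; apply/negP; rewrite (prime_dvdzM _ (z ^+ 2) pp) (prime_dvdzM e D1 pp).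
  rewrite (negbTE ne) (negbTE nD1) /= => h; case/negP: nz; exact: (prime_dvdzX pp h).
exists w, w^-1; split.
  split=> //; [exact: inO_K | exact/inKV/inO_K |].
  by rewrite expr2 mulfK.
have EDw : D%:~R / w = e%:~R * F w / z%:~R ^+ 2.
  apply/eqP; rewrite eqr_div ?expf_neq0 //; apply/eqP.
  transitivity (e%:~R * (w * F w)); last by ring.
  rewrite Nw; transitivity ((e%:~R * e%:~R) * (D%:~R * z%:~R ^+ 2) : algC); last by ring.
  by rewrite e2 mul1r.
split.
  rewrite EDw; apply: LM; first by apply: LM; [exact: L_int | exact: L_O].
  by apply/unit_LV/unitX/unit_int.
have -> : D%:~R * w^-1 ^+ 2 = e%:~R * (F w / w) / z%:~R ^+ 2.
  by transitivity ((D%:~R / w) / w); [ring | rewrite EDw; ring].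
apply: unit_div; last by apply/unitX/unit_int.
apply: unitM; first exact: unit_sign.
apply/unit_iff; split; first by rewrite mulf_neq0 ?invr_eq0.
  by apply: half.
rewrite invf_div; have := half (F w) Ofw (ram_cj F rv Pw).
rewrite (cjK F (inO_K Ow)); apply=> //; exact: mulrC.
Qed.

End Backward.


(** * Square classes modulo 4 above 2, for odd D *)

Lemma odd_sign (n s : int) : ~~ (2 %| n)%Z -> (s = 1 \/ s = -1) ->
  exists r j : int, (r = 1 \/ r = -1) /\ r * n = s + 4 * j.
Proof.
move=> nn hs; have [k [Ek|Ek]] : exists k, n = 4 * k + 1 \/ n = 4 * k - 1.
- by exists ((n + 1) %/ 4)%Z; clear -nn; lia.
- by exists s, (s * k); split=> //; rewrite Ek; ring.
- exists (- s), (- s * k); split; last by rewrite Ek; ring.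
  by case: hs => ->; [right | left].
Qed.

Lemma sign_diff (r s : int) : (r = 1 \/ r = -1) -> (s = 1 \/ s = -1) ->
  exists i, r = s + 2 * i.
Proof. by case=> -> [] ->; [exists 0|exists 1|exists (-1)|exists 0]. Qed.

(** With [a] and hence [z] odd, the equation modulo 4 is [1 + 2 a b = 1]. *)
Lemma even_coord_unram (a b k z n : int) : ~~ (2 %| a)%Z ->
  a ^+ 2 + a * (2 * b) + n * (2 * b) ^+ 2 = (4 * k + 1) * z ^+ 2 -> exists c, b = 2 * c.
Proof.
move=> na N; have [c Ec] := odd_sqr na; rewrite Ec in N.
have nz : ~~ (2 %| z)%Z by apply/negP => /dvdzP[z' Ez]; move: N; rewrite Ez; clear; lia.
have [d Ed] := odd_sqr nz; have [a' Ea] := odd_half na.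
have [b2 [->|Eb]] := int_parity b; first by exists b2.
by exfalso; move: N; rewrite Ed Ea Eb; clear; lia.
Qed.

(** For [m = 4 h + 3] and [a = 2 x] the equation modulo 8 says that [x] and [h + 1] have equal
    parity. The form of [a] matches [(1 + sq m)^2 / 2 = 2 h + 2 + sq m]. *)
Lemma odd_coord_ram (a b k z m : int) : (m %% 4)%Z <> 0 -> (m %% 4)%Z <> 1 ->
  ~~ (2 %| b)%Z -> a ^+ 2 - m * b ^+ 2 = (8 * k + 1) * z ^+ 2 ->
  exists h j, m = 4 * h + 3 /\ a = 2 * h + 2 + 4 * j.
Proof.
move=> m0 m1 nb N; have [c Ec] := odd_sqr nb; rewrite Ec in N.
have [h [Em|Em]] : exists h, m = 4 * h + 2 \/ m = 4 * h + 3.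
- by exists (m %/ 4)%Z; clear -m0 m1; lia.
- exfalso; move: N; rewrite Em.
  have [x [->|->]] := int_parity a; have [y [->|->]] := int_parity z;
    clear; lia.
have [x [Ea|Ea]] := int_parity a; last first.
  by exfalso; move: N; rewrite Em Ea; have [y [->|->]] := int_parity z; clear; lia.
have nz : ~~ (2 %| z)%Z.
  by apply/negP => /dvdzP[y Ez]; move: N; rewrite Em Ea Ez; clear; lia.
have [d Ed] := odd_sqr nz.
have [u Eu] : exists u, x = h + 1 + 2 * u.
  have [u [Eu|Eu]] := int_parity (x - (h + 1)).
    by exists u; rewrite -Eu; ring.
  have Ex : x = h + 2 + 2 * u by rewrite -[LHS](subrK (h + 1)) Eu; ring.
  exfalso; have [h' [Eh|Eh]] := int_parity h;
    by move: N; rewrite Em Ea Ed Ex Eh; clear; lia.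
by exists h, u; split=> //; rewrite Ea Eu; ring.
Qed.

Lemma even_coord_ram (a b k z m : int) : ~~ (2 %| a)%Z ->
  a ^+ 2 - m * (2 * b) ^+ 2 = (8 * k + 1) * z ^+ 2 ->
  (exists c, b = 2 * c) \/ (exists m' c, m = 2 * m' /\ b = 2 * c + 1).
Proof.
move=> na N; have [c Ec] := odd_sqr na; rewrite Ec in N.
have nz : ~~ (2 %| z)%Z by apply/negP => /dvdzP[z' Ez]; move: N; rewrite Ez; clear; lia.
have [d Ed] := odd_sqr nz; have [b2 [->|Eb]] := int_parity b; first by left; exists b2.
right; have [m' [Em|Em]] := int_parity m; first by exists m', b2.
by exfalso; move: N; rewrite Ed Em Eb; clear; lia.
Qed.

Section OddD.
Context {m : int} (F : quadfield m).
Local Notation K := (inK m).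
Local Notation O := (inOK m).
Local Notation om := (om m).
Local Notation tau := (tau m).
Local Notation nu := (nu m).
Local Notation inL v := (inOP m (pl v)).
Local Notation unitL v := (unitOP m (pl v)).
Implicit Type v : place m.

Lemma square_mod4_unit v (s : int) (x : algC) : pl_p v = 2%N -> (s = 1 \/ s = -1) ->
  inL v x -> unitL v (s%:~R + 4 * x).
Proof.
move=> p2 hs Lx; apply: notM_unit.
  by apply: LD; [exact: L_int | apply: LM => //; exact: L_nat].
move=> M; have : inM v s%:~R.
  have -> : (s%:~R : algC) = (s%:~R + 4 * x) - (2 * 2)%:R * x by ring.
  by apply: MB => //; apply: MLr => //; exact: M_nat.
by move/M_int; rewrite p2; case: hs => ->.
Qed.

(* Up to squares of K, w is a local unit congruent to s times a square modulo 4. *)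
Definition square_class v (w : algC) (s : int) :=
  exists u w' rho x, [/\ K u, u != 0, w = u ^+ 2 * w' & w' = s%:~R * rho ^+ 2 + 4 * x] /\
    [/\ inL v rho, inL v x & unitL v w'].

Lemma square_class_one v (w : algC) (s : int) (x : algC) : pl_p v = 2%N ->
  (s = 1 \/ s = -1) -> inL v x -> w = s%:~R + 4 * x -> square_class v w s.
Proof.
move=> p2 hs Lx Ew; exists 1, w, 1, x; split.
  by split; [exact: inK1|exact: oner_neq0|rewrite expr1n mul1r|rewrite expr1n mulr1].
by split=> //; [exact: L1 | rewrite Ew; exact: square_mod4_unit].
Qed.

(** The factors by which [w] may be multiplied; all are units at odd primes and so leave [scaled]
    intact. *)
Definition sign_or_double (r : int) := exists s, (s = 1 \/ s = -1) /\ (r = s \/ r = 2 * s).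

(** For odd [b] the norm equation gives [w T = (w + z)^2 + 4 k z^2] with the odd integer
    [T = Tr(w) + 2 z], so [w T] is a square modulo 4 and the sign [r] adjusts [T] to [s]. For even
    [b] the norm equation makes 4 divide [b], and [w = a] modulo 4. *)
Lemma square_class_unram (a b e D z s : int) :
  (m %% 4)%Z = 1 -> ~~ (2 %| D)%Z -> (4 %| e * D - 1)%Z -> (e = 1 \/ e = -1) ->
  (s = 1 \/ s = -1) -> a%:~R + b%:~R * om != 0 ->
  a ^+ 2 + tau * a * b + nu * b ^+ 2 = e * D * z ^+ 2 ->
  (forall p : nat, prime p -> (p %| a)%Z -> (p %| b)%Z -> False) ->
  exists r, sign_or_double r /\ forall v, pl_p v = 2%N ->
    square_class v (r%:~R * (a%:~R + b%:~R * om)) s.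
Proof.
move=> m1 nD /dvdzP[k Ek] he hs w0 N cop.
have [t1 Enu] : tau = 1 /\ 4 * nu = 1 - m by case: (tau_nu_cases m) => -[].
rewrite t1 in N.
have eD : e * D = 4 * k + 1 by rewrite -[LHS](subrK 1) Ek; ring.
pose w := a%:~R + b%:~R * om.
have Ow : O w by exact: inO_mk.
have [nb|bb] := orP (orNb (2 %| b)%Z).
  pose T := 2 * a + b + 2 * z.
  have nT : ~~ (2 %| T)%Z by rewrite /T; clear -nb; lia.
  have [r [i [hr Er]]] := odd_sign nT hs.
  exists r; split; first by exists r; split=> //; left.
  move=> v p2.
  have UT : unitL v T%:~R by apply: unit_int; rewrite p2.
  have T0 := unit_neq0 UT.
  have Ur : unitL v r%:~R by exact: unit_sign hr.
  have idw : w * T%:~R = (w + z%:~R) ^+ 2 + 4 * k%:~R * z%:~R ^+ 2.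
    have Nc : (a ^+ 2 + a * b + nu * b ^+ 2)%:~R = (4 * k + 1)%:~R * z%:~R ^+ 2 :> algC.
      by rewrite -eD -[a * b]mul1r mulrA N; ring.
    have ww : w ^+ 2 = (2 * a + b)%:~R * w - (a ^+ 2 + a * b + nu * b ^+ 2)%:~R.
      by have := om_sqr m; rewrite t1 /w => h; ring: h.
    have -> : (w + z%:~R) ^+ 2 = w ^+ 2 + 2 * z%:~R * w + z%:~R ^+ 2 by ring.
    by rewrite ww Nc /T; ring.
  have rv : ~~ ram v by rewrite /ram p2 t1 Enu; clear -m1; lia.
  have LT : inL v (T%:~R)^-1 by exact: unit_LV.
  have Lw : inL v w by exact: L_O.
  have ErC : r%:~R * T%:~R = s%:~R + 4 * i%:~R :> algC by rewrite -intrM Er; ring.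
  have [Pw|nP] := classic (pl v w); last first.
    pose rho := (w + z%:~R) / T%:~R.
    pose x := i%:~R * rho ^+ 2 + (s%:~R + 4 * i%:~R) * k%:~R * (z%:~R / T%:~R) ^+ 2.
    exists 1, (r%:~R * w), rho, x; split.
      split; [exact: inK1|exact: oner_neq0|by rewrite expr1n mul1r|].
      apply: (mulIf (expf_neq0 2 T0)).
      transitivity ((s%:~R + 4 * i%:~R) * ((w + z%:~R) ^+ 2 + 4 * k%:~R * z%:~R ^+ 2)).
        by rewrite -ErC -idw; ring.
      by rewrite /x /rho; field.
    have Lrho : inL v rho by rewrite /rho; in_local.
    split=> //; last by apply: unitM => //; exact: unit_O.
    by in_local.
  have Nw : w * F w = (e * D * z ^+ 2)%:~R by rewrite norm_coord t1 N.
  have nD2 : ~~ (pl_p v %| D)%Z by rewrite p2.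
  have [z0 Uz] := notP_conj_scaled Ow nD2 he w0 Nw (primitive_conj rv cop Pw).
  (* Where [w] is not a unit, [y = w / z^2] is one, and the identity for [w T] is divided by
     [z^2]. *)
  pose y := w / z%:~R ^+ 2.
  have Ly : inL v y by exact: unit_L.
  pose rho := (z%:~R * y + 1) / T%:~R.
  pose x := i%:~R * rho ^+ 2 + (s%:~R + 4 * i%:~R) * k%:~R * (T%:~R)^-1 ^+ 2.
  have Lrho : inL v rho by apply: LM => //; apply: LD; [in_local | exact: L1].
  exists z%:~R, (r%:~R * y), rho, x; split.
    split=> //; [exact: inK_int|by rewrite /y -/w; field|].
    apply: (mulIf (expf_neq0 2 T0)); apply: (mulIf (expf_neq0 2 z0)).
    transitivity ((s%:~R + 4 * i%:~R) * ((w + z%:~R) ^+ 2 + 4 * k%:~R * z%:~R ^+ 2)).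
      by rewrite -ErC -idw /y; field.
    by rewrite /x /rho /y; field; rewrite z0 T0.
  split=> //; last by apply: unitM.
  by in_local.
have na : ~~ (2 %| a)%Z by apply/negP => h; exact: (cop 2%N isT h bb).
have [b' Eb] : exists b', b = 4 * b'.
  have /dvdzP[b1 Eb1] := bb; rewrite mulrC in Eb1.
  have [|c Ec] := @even_coord_unram a b1 k z nu na; last by exists c; rewrite Eb1 Ec; ring.
  by rewrite -eD -N Eb1; ring.
have [r [i [hr Er]]] := odd_sign na hs.
exists r; split; first by exists r; split=> //; left.
move=> v p2; apply: (@square_class_one v _ s (i%:~R + r%:~R * b'%:~R * om) p2 hs).
  apply: LD; first exact: L_int.
  apply: LM; last exact/L_O/inO_om.
  by apply: LM; exact: L_int.
transitivity ((r * a)%:~R + r%:~R * b%:~R * om); first by ring.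
by rewrite Er Eb; ring.
Qed.

(** The useful square is [(1 + sq m)^2 = 1 + m + 2 sq m]. For odd [b] it equals [2 (2 h + 2 + sq m)]
    with [m = 4 h + 3], and [2 r w] is this square times [s + 4 x]: here the factor 2 in the twist
    is needed. If [b = 2] modulo 4, then [m] is even and [r w = s (1 + sq m)^2] modulo 4. If 4
    divides [b], then [w = a] modulo 4. *)
Lemma square_class_ram (a b e D z s : int) :
  (m %% 4)%Z <> 1 -> (8 %| e * D - 1)%Z ->
  (s = 1 \/ s = -1) ->
  a ^+ 2 + tau * a * b + nu * b ^+ 2 = e * D * z ^+ 2 ->
  (forall p : nat, prime p -> (p %| a)%Z -> (p %| b)%Z -> False) ->
  exists r, sign_or_double r /\ forall v, pl_p v = 2%N ->
    square_class v (r%:~R * (a%:~R + b%:~R * om)) s.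
Proof.
move=> m1 /dvdzP[k Ek] hs N cop.
have [t0 [Enu Eom]] := om_mod4_neq1 m m1.
have eD : e * D = 8 * k + 1 by rewrite -[LHS](subrK 1) Ek; ring.
have m0 := sqf_mod4 F.
have {}N : a ^+ 2 - m * b ^+ 2 = (8 * k + 1) * z ^+ 2 by rewrite -eD -N t0 Enu; ring.
have OZ (x y : int) : O (x%:~R + y%:~R * sq m) by rewrite -Eom; exact: inO_mk.
rewrite Eom.
have dob (r : int) : (r = 1 \/ r = -1) -> sign_or_double r.
  by move=> hr; exists r; split=> //; left.
have rv v : pl_p v = 2%N -> ram v.
  by move=> p2; rewrite /ram p2 t0 Enu; apply/dvdzP; exists (2 * m); ring.
have [nb|bb] := orP (orNb (2 %| b)%Z).
  have [h [j [Em Ea]]] := odd_coord_ram m0 m1 nb N.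
  have [r [i [hr Er]]] := odd_sign nb hs; have [l El] := sign_diff hr hs.
  exists (2 * r); split; first by exists r; split=> //; right.
  move=> v p2; pose y := (2 * h + 2)%:~R + 1%:~R * sq m.
  have Uy : unitL v y.
    apply: unit_O; first exact: OZ.
    move/(M_P); move/(ram2_M F p2 (rv v p2)); rewrite Em; clear; lia.
  have y0 := unit_neq0 Uy.
  have sC : sq m ^+ 2 = 4 * h%:~R + 3 :> algC by rewrite sq2 {1}Em; ring.
  pose x := ((l * (h + 1) + r * j)%:~R + i%:~R * sq m) / y.
  have Lx : inL v x by apply: LM; [exact/L_O/OZ | exact: unit_LV].
  have u0 : 1 + sq m != 0.
    apply/eqP => hu; have : ratr 1 + ratr 1 * sq m = 0 by rewrite rmorph1 mul1r.
    by case/(sq_indep (qf_sqf F) (qf_neq1 F)) => /eqP.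
  exists (1 + sq m), (s%:~R + 4 * x), 1, x; split.
    split=> //; [by apply: inKD; [exact: inK1 | exact: inK_sq] | | by rewrite expr1n mulr1].
    have Exy : x * y = (l * (h + 1) + r * j)%:~R + i%:~R * sq m by rewrite divfK.
    apply: (mulIf y0); transitivity ((1 + sq m) ^+ 2 * (s%:~R * y + 4 * (x * y))); last by ring.
    rewrite Exy.
    transitivity (((r * (2 * h + 2 + 4 * j))%:~R + (r * b)%:~R * sq m) * (2 * y)).
      by rewrite Ea; ring.
    by rewrite Er El /y; ring: sC.
  by split=> //; [exact: L1 | exact: square_mod4_unit].
have na : ~~ (2 %| a)%Z by apply/negP => h; exact: (cop 2%N isT h bb).
have /dvdzP[b1 Eb1] := bb; rewrite mulrC in Eb1; rewrite Eb1 in N.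
have [[c Ec]|[m' [c [Em Ec]]]] := even_coord_ram na N.
  have [r [i [hr Er]]] := odd_sign na hs.
  exists r; split; first exact: dob.
  move=> v p2; apply: (@square_class_one v _ s (i%:~R + (r * c)%:~R * sq m) p2 hs).
    exact/L_O/OZ.
  transitivity ((r * a)%:~R + r%:~R * b%:~R * sq m); first by ring.
  by rewrite Er Eb1 Ec; ring.
have nn : ~~ (2 %| a * (1 + m))%Z.
  by rewrite (@prime_dvdzM 2) // (negbTE na) /= Em; clear; lia.
have [r [j [hr Er]]] := odd_sign nn hs; have [i Ei] := sign_diff hr hs.
exists r; split; first exact: dob.
move=> v p2; have sC : sq m ^+ 2 = 2 * m'%:~R :> algC by rewrite sq2 {1}Em; ring.
have Uw : unitL v (a%:~R + b%:~R * sq m).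
  apply: unit_O; first exact: OZ.
  move/(M_P); move/(ram2_M F p2 (rv v p2)); rewrite Em => h2; case/negP: na.
  apply: (@prime_dvdzX 2 a 2 isT).
  have -> : a ^+ 2 = (a ^+ 2 - 2 * m' * b ^+ 2) + 2 * (m' * b ^+ 2) by ring.
  by apply: rpredD => //; exact: dvdz_mulr.
have Ur : unitL v r%:~R by exact: unit_sign hr.
(* [(1 + m)^2 = 1 + 4 (m' + m'^2)] turns the choice of [r], which concerns [r a (1 + m)], into
   [r a = s (1 + m)] modulo 4. *)
have [X Era] : exists X, r * a = s * (1 + m) + 4 * X.
  exists (j * (1 + m) - r * a * (m' + m' ^+ 2)).
  transitivity (r * (a * (1 + m)) * (1 + m) - 4 * (r * a * (m' + m' ^+ 2))).
    by rewrite Em; ring.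
  by rewrite Er; ring.
exists 1, (r%:~R * (a%:~R + b%:~R * sq m)), (1 + sq m),
  (X%:~R + (r * c + i)%:~R * sq m); split.
  split; [exact: inK1|exact: oner_neq0|by rewrite expr1n mul1r|].
  transitivity ((r * a)%:~R + r%:~R * b%:~R * sq m); first by ring.
  rewrite Era Eb1 Ec; move: sC; move: (sq m) => S sC; rewrite Em.
  by rewrite Ei; ring: sC.
split; [|exact/L_O/OZ|exact: unitM].
by have := OZ 1 1; rewrite mul1r => /L_O; apply.
Qed.

End OddD.


(** * The twisted curve and its local models *)

Lemma odd_mod4 (n : int) : ~~ (2 %| n)%Z -> exists s k, (s = 1 \/ s = -1) /\ n = s + 4 * k.
Proof.
move=> nn; have [r [j [hr Er]]] := odd_sign nn (or_introl (erefl 1)).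
by exists r, (r * j); split=> //; case: hr Er => -> Er; move: Er; clear; lia.
Qed.

(** With [A = 27 a + 12] one has [A^3 - 1728 = 3^6 a (27 a^2 + 36 a + 16)], and [D] takes at most
    one factor 3. *)
Lemma dvd27_of_cube (A D t : int) : squarefree D -> (27 %| A - 12)%Z ->
  D * t ^+ 2 = A ^+ 3 - 1728 -> (27 %| t)%Z.
Proof.
move=> sD /dvdzP[a Ea] E; have [->|t0] := eqVneq t 0; first exact: dvdz0.
have [D0 _] := sD; have l1 := squarefree_logn sD (isT : prime 3).
have h : (3%:Z ^+ 6 %| D * t ^+ 2)%Z.
  apply/dvdzP; exists (a * (27 * a ^+ 2 + 36 * a + 16)).
  have EA : A = 27 * a + 12 by rewrite -[LHS](subrK 12) Ea; ring.
  by rewrite E EA; ring.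
have : (6 <= logn 3 `|(D * t ^+ 2)%R|)%N.
  by rewrite -pfactor_dvdn // ?absz_gt0 ?mulf_neq0 ?expf_neq0.
rewrite abszM abszX lognM ?expn_gt0 ?absz_gt0 ?t0 // lognX => l6.
have : (3 <= logn 3 `|t|)%N.
  by move: l1 l6; move: (logn 3 _) (logn 3 _) => x y; clear; lia.
by rewrite -pfactor_dvdn ?absz_gt0 // dvdzE.
Qed.

Section GoodReduction.
Context {m : int} (F : quadfield m).
Local Notation K := (inK m).
Local Notation inL v := (inOP m (pl v)).
Local Notation unitL v := (unitOP m (pl v)).
Implicit Type v : place m.

(** The quadratic twist by [w] of the rational curve with covariants [A D] and [t D^2]; its
    j-invariant is [A^3]. *)
Definition twist (A D t : int) (w : algC) :=
  short (A%:~R * D%:~R * w ^+ 2) (t%:~R * D%:~R ^+ 2 * w ^+ 3).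

Lemma disc_of_covariants (A D t : int) (w : algC) E' : D * t ^+ 2 = A ^+ 3 - 1728 ->
  c4 E' = A%:~R * D%:~R * w ^+ 2 -> c6 E' = t%:~R * D%:~R ^+ 2 * w ^+ 3 ->
  disc E' = (D%:~R * w ^+ 2) ^+ 3.
Proof.
move=> E h4 h6; apply: (@mulfI _ 1728); first by rewrite pnatr_eq0.
rewrite -c4_c6_disc h4 h6.
have EC : D%:~R * t%:~R ^+ 2 = A%:~R ^+ 3 - 1728 :> algC.
  by transitivity ((D * t ^+ 2)%:~R : algC); [|rewrite E]; ring.
transitivity ((A%:~R ^+ 3 - D%:~R * t%:~R ^+ 2) * D%:~R ^+ 3 * w ^+ 6 : algC); first by ring.
by rewrite EC; ring.
Qed.

(** Replacing [w] by [w'] scales the short model by [u], so any locally integral model with the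
    covariants of [w'] will do at [v]. *)
Lemma good_at v (A D t : int) (w u w' : algC) E' : D * t ^+ 2 = A ^+ 3 - 1728 ->
  K u -> u != 0 -> w = u ^+ 2 * w' -> coefs_in (inL v) E' ->
  c4 E' = A%:~R * D%:~R * w' ^+ 2 -> c6 E' = t%:~R * D%:~R ^+ 2 * w' ^+ 3 ->
  unitL v (D%:~R * w' ^+ 2) -> good_reduction_at m (twist A D t w) (pl v).
Proof.
move=> E Ku u0 Ew cf h4 h6 Ud; exists E'; split; last first.
  by split=> //; rewrite (disc_of_covariants E h4 h6); exact: unitX.
have [k1 k2 k3 _ _] : coefs_in K E' by case: cf => *; split; apply: L_K; eassumption.
exists u, (u ^+ 2 * b2 E' / 12), (u * a1 E' / 2), (u ^+ 3 * a3 E' / 2); split.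
  have kn n : K n%:R by exact: inK_nat.
  split=> //; apply: inK_div => //; apply: inKM => //; try exact: inKX.
  by rewrite /b2; apply: inKD; [exact: inKX | exact: inKM].
by apply: change_short; rewrite ?h4 ?h6 Ew; ring.
Qed.

(* The curve y^2 + x y = x^3 - 36 x / (j - 1728) - 1 / (j - 1728) with j = A^3, rescaled by
   u^2 = - t D w / A; rho is the freedom in b2 = rho^2 + 4 a2. *)
Definition model_a (A D t : int) (w rho : algC) :=
  WCurve rho ((- (t%:~R * D%:~R * w / A%:~R) - rho ^+ 2) / 4) 0
    (- 36 * (D%:~R * w ^+ 2) / A%:~R ^+ 2) (t%:~R * (D%:~R * w ^+ 2) * (D%:~R * w) / A%:~R ^+ 3).

Lemma model_aE (A D t : int) (w rho : algC) : D * t ^+ 2 = A ^+ 3 - 1728 -> A != 0 ->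
  c4 (model_a A D t w rho) = A%:~R * D%:~R * w ^+ 2 /\
  c6 (model_a A D t w rho) = t%:~R * D%:~R ^+ 2 * w ^+ 3.
Proof.
move=> E A0; have AC : (A%:~R : algC) != 0 by rewrite intr_eq0.
have EC : D%:~R * t%:~R ^+ 2 = A%:~R ^+ 3 - 1728 :> algC.
  by transitivity ((D * t ^+ 2)%:~R : algC); [|rewrite E]; ring.
rewrite /c4 /c6 /b2 /b4 /b6 /=; split.
  apply: (mulIf (expf_neq0 2 AC)).
  transitivity (D%:~R * w ^+ 2 * (D%:~R * t%:~R ^+ 2 + 1728) : algC); first by field.
  by rewrite EC; ring.
apply: (mulIf (expf_neq0 3 AC)).
transitivity (t%:~R * D%:~R ^+ 2 * w ^+ 3 * (D%:~R * t%:~R ^+ 2 + 1728) : algC); first by field.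
by rewrite EC; ring.
Qed.

(* The short model, with rho the freedom in b6 = rho^2 + 4 a6. *)
Definition model_b (A D t : int) (w rho : algC) :=
  WCurve 0 0 rho (- (A%:~R * D%:~R * w ^+ 2) / 48)
    ((- (t%:~R * D%:~R ^+ 2 * w ^+ 3) / 216 - rho ^+ 2) / 4).

Lemma model_bE (A D t : int) (w rho : algC) :
  c4 (model_b A D t w rho) = A%:~R * D%:~R * w ^+ 2 /\
  c6 (model_b A D t w rho) = t%:~R * D%:~R ^+ 2 * w ^+ 3.
Proof. by rewrite /c4 /c6 /b2 /b4 /b6 /=; split; field. Qed.

(** The denominators of [model_b] involve only 2 and 3. At 3, if 3 divides [A], then 27 divides [t]
    and the powers of 3 cancel; otherwise [model_a] has only powers of [A] and of 2 in its
    denominators. *)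
Lemma good_at_odd v (A D t r : int) (w : algC) : D * t ^+ 2 = A ^+ 3 - 1728 ->
  squarefree D -> inR A -> pl_p v != 2%N -> sign_or_double r -> scaled v w D ->
  good_reduction_at m (twist A D t (r%:~R * w)) (pl v).
Proof.
move=> E sD RA p2 [s [hs hr]] [u [w' [[Ku u0 Kw' Ew] [Lw Uw]]]].
have pp := pl_pP v.
have np2 : ~~ (pl_p v %| 2)%Z by rewrite dvdzE /= dvdn_prime2 // (negbTE p2).
have ns : ~~ (pl_p v %| s)%Z.
  have -> : (pl_p v %| s)%Z = (pl_p v == 1)%N by rewrite dvdzE; case: hs => ->; rewrite dvdn1.
  by apply: contraTneq pp => ->.
have Ur : unitL v r%:~R.
  apply: unit_int; case: hr => -> //.
  by rewrite prime_dvdzM // (negbTE np2) (negbTE ns).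
have U2 : unitL v 2 by exact: (unit_int np2).
pose w1 := r%:~R * w'.
have L1 : inL v (D%:~R * w1).
  by rewrite /w1 mulrCA; apply: LM => //; exact: L_int.
have U1 : unitL v (D%:~R * w1 ^+ 2).
  have -> : D%:~R * w1 ^+ 2 = r%:~R ^+ 2 * (D%:~R * w' ^+ 2) by rewrite /w1; ring.
  by apply: unitM => //; exact: unitX.
have Lw2 := unit_L U1.
have Ew1 : r%:~R * w = u ^+ 2 * w1 by rewrite Ew /w1; ring.
have L2 : inL v 2^-1 by exact: unit_LV.
have l0 : inL v 0 by exact: L0.
have [p3|p3] := eqVneq (pl_p v) 3%N; last first.
  have U3 : unitL v 3.
    by apply: (@unit_int _ v 3); rewrite dvdzE /= dvdn_prime2 // (negbTE p3).
  have L3 : inL v 3^-1 by exact: unit_LV.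
  have [h4 h6] := model_bE A D t w1 0.
  apply: (good_at E Ku u0 Ew1 _ h4 h6 U1); split=> //=.
    have -> : - (A%:~R * D%:~R * w1 ^+ 2) / 48
      = - (A%:~R * (D%:~R * w1 ^+ 2)) * (2^-1 ^+ 4 * 3^-1) by field.
    by in_local.
  have -> : (- (t%:~R * D%:~R ^+ 2 * w1 ^+ 3) / 216 - 0 ^+ 2) / 4
    = - (t%:~R * (D%:~R * w1 ^+ 2) * (D%:~R * w1)) * (2^-1 ^+ 5 * 3^-1 ^+ 3) by field.
  by in_local.
have [A3|nA3] := orP (orbN (3 %| A)%Z).
  have h27 := RA.2 A3.
  have /dvdzP[t' Et] := dvd27_of_cube sD h27 E; have /dvdzP[A' EA] := A3.
  have [h4 h6] := model_bE A D t w1 0.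
  apply: (good_at E Ku u0 Ew1 _ h4 h6 U1); split=> //=.
    have -> : - (A%:~R * D%:~R * w1 ^+ 2) / 48
      = - (A'%:~R * (D%:~R * w1 ^+ 2)) * (2^-1 ^+ 4) by rewrite EA; field.
    by in_local.
  have -> : (- (t%:~R * D%:~R ^+ 2 * w1 ^+ 3) / 216 - 0 ^+ 2) / 4
    = - (t'%:~R * (D%:~R * w1 ^+ 2) * (D%:~R * w1)) * (2^-1 ^+ 5) by rewrite Et; field.
  by in_local.
have UA : unitL v A%:~R by apply: unit_int; rewrite p3.
have LA : inL v (A%:~R)^-1 by exact: unit_LV.
have A0 : A != 0 by apply: contraNneq nA3 => ->.
have [h4 h6] := model_aE w1 0 E A0.
apply: (good_at E Ku u0 Ew1 _ h4 h6 U1); split=> //=.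
- have -> : (- (t%:~R * D%:~R * w1 / A%:~R) - 0 ^+ 2) / 4
    = - (t%:~R * (D%:~R * w1) * (A%:~R)^-1) * (2^-1 ^+ 2) by field; exact: unit_neq0 UA.
  by in_local.
- have -> : - 36 * (D%:~R * w1 ^+ 2) / A%:~R ^+ 2
    = - (36 * (D%:~R * w1 ^+ 2) * (A%:~R)^-1 ^+ 2) by field; exact: unit_neq0 UA.
  by in_local.
rewrite -exprVn; in_local.
Qed.

(** For odd [A], the coefficient [a2] of [model_a] is integral once [- t D w' / A] is [rho^2] modulo
    4. For [A = 16 a], the same holds for [a6] of [model_b] with [a3 = rho^3], once
    [- t D^2 w'^3 / 216] is [rho^6] modulo 4. With [w' = s rho^2] modulo 4, both follow from the
    condition on [s]. *)
Lemma good_at_two_odd v (A D t s k : int) (w : algC) : D * t ^+ 2 = A ^+ 3 - 1728 ->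
  pl_p v = 2%N -> ~~ (2 %| D)%Z -> (s = 1 \/ s = -1) ->
  (~~ (2 %| A)%Z /\ - t * D * A = s + 4 * k) \/
  (exists a t', [/\ A = 16 * a, t = 8 * t' & - t' * D ^+ 2 * 27 = s + 4 * k]) ->
  square_class v w s -> good_reduction_at m (twist A D t w) (pl v).
Proof.
move=> E p2 nD hs hA [u [w' [rho [x [[Ku u0 Ew Ew'] [Lr Lx Uw]]]]]].
have Lw := unit_L Uw.
have ss : (s%:~R : algC) ^+ 2 = 1 by case: hs => ->; ring.
have U1 : unitL v (D%:~R * w' ^+ 2).
  by apply: unitM; [apply: unit_int; rewrite p2 | exact: unitX].
have l0 : inL v 0 by exact: L0.
have U3 : unitL v 3 by apply: (@unit_int _ v 3); rewrite p2.
have L3 : inL v 3^-1 by exact: unit_LV.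
case: hA => [[nA Ek]|[a [t' [EA Et Ek]]]].
  have A0 : A != 0 by apply: contraNneq nA => ->.
  have UA : unitL v A%:~R by apply: unit_int; rewrite p2.
  have LA : inL v (A%:~R)^-1 by exact: unit_LV.
  have AC := unit_neq0 UA.
  have [c Ec] := odd_sqr nA.
  have [h4 h6] := model_aE w' rho E A0.
  apply: (good_at E Ku u0 Ew _ h4 h6 U1); split=> //=.
  - have -> : (- (t%:~R * D%:~R * w' / A%:~R) - rho ^+ 2) / 4
      = (s%:~R * x + k%:~R * s%:~R * rho ^+ 2 + 4 * k%:~R * x - 2 * c%:~R * rho ^+ 2)
        * (A%:~R)^-1 ^+ 2.
      apply: (@mulIf _ (4 * A%:~R ^+ 2)); first by rewrite mulf_neq0 ?expf_neq0 ?pnatr_eq0.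
      transitivity ((- t * D * A)%:~R * w' - rho ^+ 2 * (A ^+ 2)%:~R); first by field.
      rewrite Ek Ec Ew'.
      transitivity (s%:~R ^+ 2 * rho ^+ 2 + 4 * (s%:~R * x + k%:~R * s%:~R * rho ^+ 2
         + 4 * k%:~R * x - 2 * c%:~R * rho ^+ 2) - rho ^+ 2 : algC); first by ring.
      by rewrite ss; field.
    by in_local.
  - by rewrite -exprVn; in_local.
  - by rewrite -exprVn; in_local.
have [h4 h6] := model_bE A D t w' (rho ^+ 3).
apply: (good_at E Ku u0 Ew _ h4 h6 U1); split=> //=; first exact: LX.
  have -> : - (A%:~R * D%:~R * w' ^+ 2) / 48 = - (a%:~R * (D%:~R * w' ^+ 2) * 3^-1).
    by rewrite EA; field.
  by in_local.
pose X := 3 * rho ^+ 4 * x + 12 * s%:~R * rho ^+ 2 * x ^+ 2 + 16 * x ^+ 3.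
have EX : w' ^+ 3 = s%:~R * rho ^+ 6 + 4 * X.
  transitivity (s%:~R ^+ 2 * (s%:~R * rho ^+ 6) + 4 * (s%:~R ^+ 2 * (3 * rho ^+ 4 * x)
    + 12 * s%:~R * rho ^+ 2 * x ^+ 2 + 16 * x ^+ 3)); first by rewrite Ew'; ring.
  by rewrite ss /X; ring.
(* The denominator 27 is cleared by [27^2 = 729], and [182 = (729 - 1) / 4]. *)
have -> : (- (t%:~R * D%:~R ^+ 2 * w' ^+ 3) / 216 - (rho ^+ 3) ^+ 2) / 4
  = (s%:~R * X + k%:~R * s%:~R * rho ^+ 6 + 4 * k%:~R * X - 182 * rho ^+ 6) * 3^-1 ^+ 6.
  apply: (@mulIf _ (4 * 3 ^+ 6)); first by rewrite mulf_neq0 ?expf_neq0 ?pnatr_eq0.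
  transitivity ((- t' * D ^+ 2 * 27)%:~R * w' ^+ 3 - 729 * rho ^+ 6); first by rewrite Et; field.
  rewrite Ek EX.
  transitivity (s%:~R ^+ 2 * rho ^+ 6 + 4 * (s%:~R * X + k%:~R * s%:~R * rho ^+ 6
     + 4 * k%:~R * X - 182 * rho ^+ 6) - rho ^+ 6 : algC); first by ring.
  by rewrite ss; field.
have LX' : inL v X by rewrite /X; in_local.
by in_local.
Qed.

End GoodReduction.


(* The numerators of a4 and a6 in the model with a1 = sqrt m, a2 = 0 and a3 = 1 + d sqrt m: the
   parity of d and the sign r are chosen to make them divisible by 4 and 8. *)
Lemma even_model_int (A' D' m' s a b : int) :
  (A' %% 4)%Z = 1 -> ~~ (2 %| D')%Z -> ~~ (2 %| m')%Z -> ~~ (2 %| s)%Z ->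
  ~~ (2 %| a)%Z -> ~~ (2 %| b)%Z -> (8 %| m' - D' - 2)%Z ->
  exists r d P4 Q4 P6 Q6 : int, let C := 2 * a ^+ 2 + m' * b ^+ 2 in
   [/\ r = 1 \/ r = -1,
    m' ^+ 4 - A' * D' * C - 12 * m' ^+ 3 * d = 4 * P4,
    - 2 * A' * D' * a * b - 6 * m' ^+ 2 = 4 * Q4,
    m' ^+ 6 - 3 * m' ^+ 2 * A' * D' * C - 4 * r * s * D' ^+ 2 * a * (C + 2 * m' * b ^+ 2)
      - 54 * m' ^+ 3 * (1 + 2 * m' * d ^+ 2) = 8 * P6 &
    - 6 * m' ^+ 2 * A' * D' * a * b - 2 * r * s * D' ^+ 2 * b * (4 * a ^+ 2 + C)
      - 108 * m' ^+ 3 * d = 8 * Q6].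
Proof.
move=> hA nD nm ns na nb /dvdzP[l El].
have [al Eal] : exists al, A' = 4 * al + 1 by exists (A' %/ 4)%Z; clear -hA; lia.
have [mu Emu] := odd_half nm.
(* [d] is the parity of [al + mu]; this makes the rational coordinate of the numerator of [a6]
   divisible by 8. The sign [r] is then chosen for the other coordinate. *)
have [d [n En]] : exists d n, al + mu = d + 2 * n /\ (d = 0 \/ d = 1).
  have [n [En|En]] := int_parity (al + mu); first by exists 0, n; split; [rewrite En; ring|left].
  by exists 1, n; split; [rewrite En; ring|right].
pose C := 2 * a ^+ 2 + m' * b ^+ 2.
have [xa Exa] := odd_sqr na; have [xb Exb] := odd_sqr nb.
have [xm Exm] := odd_sqr nm; have [xD ExD] := odd_sqr nD.
have EC : C = D' + 4 + 8 * (2 * xa + m' * xb + l).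
  have Em' : m' = D' + 2 + 8 * l.
    by transitivity ((m' - D' - 2) + D' + 2); [|rewrite El]; ring.
  by rewrite /C Exa Exb; transitivity (2 + m' + 8 * (2 * xa + m' * xb)); [|rewrite {1}Em']; ring.
pose c := 2 * xa + m' * xb + l.
have oddM (x y : int) : ~~ (2 %| x)%Z -> ~~ (2 %| y)%Z -> ~~ (2 %| x * y)%Z.
  by move=> hx hy; rewrite (@prime_dvdzM 2) // (negbTE hx).
have nA : ~~ (2 %| A')%Z by rewrite Eal; clear; lia.
have nC : ~~ (2 %| C)%Z.
  have [x Ex] := odd_half nD; rewrite EC Ex; move: (2 * xa + _ + _) => X; clear; lia.
have n4C : ~~ (2 %| 4 * a ^+ 2 + C)%Z.
  by have [x ->] := odd_half nC; move: (a ^+ 2) => X; clear; lia.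
have no2 : ~~ (2 %| s * D' ^+ 2 * b * (4 * a ^+ 2 + C))%Z.
  exact: (oddM _ _ (oddM _ _ (oddM _ _ ns (oddM _ _ nD nD)) nb) n4C).
have no1 : ~~ (2 %| - (3 * m' ^+ 2 * A' * D' * a * b) + 2 * d)%Z.
  have : ~~ (2 %| 3 * m' ^+ 2 * A' * D' * a * b)%Z.
    exact: (oddM _ _ (oddM _ _ (oddM _ _ (oddM _ _ (oddM 3 _ isT (oddM _ _ nm nm)) nA) nD) na) nb).
  by move: (3 * _ * _ * _ * _ * _) => X; clear; lia.
have [sg [k [hsg Ek]]] := odd_mod4 no1.
have [r [j [hr Er]]] := odd_sign no2 hsg.
have [q4 Eq4] : exists q, A' * D' * a * b = 2 * q + 1.
  by apply: odd_half; exact: (oddM _ _ (oddM _ _ (oddM _ _ nA nD) na) nb).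
have [hd Ed] := En.
exists r, d.
exists (16 * xm ^+ 2 + 4 * xm - al * D' * C - 2 * xD - D' - 2 * D' * c - 3 * m' ^+ 3 * d).
exists (- q4 - 2 - 12 * xm).
have [P6 EP6] : exists P6, m' ^+ 6 - 3 * m' ^+ 2 * A' * D' * C
   - 4 * r * s * D' ^+ 2 * a * (C + 2 * m' * b ^+ 2)
   - 54 * m' ^+ 3 * (1 + 2 * m' * d ^+ 2) = 8 * P6.
  have nP : ~~ (2 %| r * (s * (D' * D') * a * (C + 2 * m' * b ^+ 2)))%Z.
    have nr : ~~ (2 %| r)%Z by case: hr => ->.
    have nC2 : ~~ (2 %| C + 2 * m' * b ^+ 2)%Z.
      have [x ->] := odd_half nC; have -> : 2 * x + 1 + 2 * m' * b ^+ 2 = 2 * (x + m' * b ^+ 2) + 1 by ring.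
      by clear; lia.
    exact: (oddM _ _ nr (oddM _ _ (oddM _ _ (oddM _ _ ns (oddM _ _ nD nD)) na) nC2)).
  have [o Eo] := odd_half nP; have [x Ex] := odd_half nD.
  pose g := xD + x + D' * c.
  have EDC : D' * C = 5 + 8 * g.
    have -> : D' * C = D' ^+ 2 + 4 * D' + 8 * D' * c by rewrite EC /c; ring.
    by rewrite ExD /g {1}Ex; ring.
  have dd : d ^+ 2 = d by case: Ed => ->.
  have Eal' : al = d + 2 * n - mu by rewrite -hd; ring.
  exists (64 * xm ^+ 3 + 24 * xm ^+ 2 + 3 * xm - 3 * (2 * al + 4 * al * g + g)
    - 3 * xm * (A' * (5 + 8 * g)) - o - 54 * m' * xm - 108 * (2 * xm + 8 * xm ^+ 2) * d
    - 15 * d - 3 * n - 12 * mu - 9).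
  transitivity ((m' ^+ 2) ^+ 3 - 3 * m' ^+ 2 * (A' * (D' * C))
    - 4 * (r * (s * (D' * D') * a * (C + 2 * m' * b ^+ 2)))
    - 54 * m' * m' ^+ 2 - 108 * (m' ^+ 2) ^+ 2 * d ^+ 2); first by ring.
  by rewrite Eo dd EDC Exm Eal Eal' Emu; ring.
have [Q6 EQ6] : exists Q6, - 6 * m' ^+ 2 * A' * D' * a * b
   - 2 * r * s * D' ^+ 2 * b * (4 * a ^+ 2 + C) - 108 * m' ^+ 3 * d = 8 * Q6.
  have rE : r * (s * D' ^+ 2 * b * (4 * a ^+ 2 + C))
     = - (3 * m' ^+ 2 * A' * D' * a * b) + 2 * d + 4 * (j - k).
    by rewrite Er Ek; ring.
  exists (- (j - k) - d * (27 * (mu * (8 * xm + 1) + 4 * xm) + 14)).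
  transitivity (2 * (- (3 * m' ^+ 2 * A' * D' * a * b)
    - r * (s * D' ^+ 2 * b * (4 * a ^+ 2 + C)) - 54 * (m' * m' ^+ 2) * d)); first by ring.
  by rewrite rE Exm Emu; ring.
exists P6, Q6; split=> //.
  have -> : m' ^+ 4 = (8 * xm + 1) ^+ 2 by rewrite -Exm; ring.
  rewrite -/C.
  have -> : A' * D' * C = 4 * (al * D' * C) + D' * C by rewrite Eal; ring.
  have -> : D' * C = D' ^+ 2 + 4 * D' + 8 * D' * c by rewrite EC /c; ring.
  by rewrite ExD; ring.
by rewrite Exm; transitivity (- 2 * (A' * D' * a * b) - 6 * (8 * xm + 1)); [|rewrite Eq4]; ring.
Qed.

(** * Good reduction above 2 for even D, and sufficiency of the conditions *)

Section EvenD.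
Context {m : int} (F : quadfield m).
Local Notation K := (inK m).
Local Notation O := (inOK m).
Local Notation om := (om m).
Local Notation tau := (tau m).
Local Notation nu := (nu m).
Local Notation inL v := (inOP m (pl v)).
Local Notation unitL v := (unitOP m (pl v)).
Implicit Type v : place m.

(** The scaling is [u = sq m], so [w' = r w / m]. As [w^2 = 2 c] with [c] a unit,
    [2 D' w'^2 = D' c / m'^2] is a unit. The coefficients [a4] and [a6] are solved from the
    covariants, and the divisibilities assumed of their numerators make them integral. *)
Lemma good_at_two_even v (A' D' m' s a b r d P4 Q4 P6 Q6 : int) :
  let C := 2 * a ^+ 2 + m' * b ^+ 2 in
  m = 2 * m' -> pl_p v = 2%N -> 2 * D' * (8 * s) ^+ 2 = (4 * A') ^+ 3 - 1728 ->
  ~~ (2 %| D')%Z -> ~~ (2 %| m')%Z -> ~~ (2 %| b)%Z -> (r = 1 \/ r = -1) ->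
  m' ^+ 4 - A' * D' * C - 12 * m' ^+ 3 * d = 4 * P4 ->
  - 2 * A' * D' * a * b - 6 * m' ^+ 2 = 4 * Q4 ->
  m' ^+ 6 - 3 * m' ^+ 2 * A' * D' * C - 4 * r * s * D' ^+ 2 * a * (C + 2 * m' * b ^+ 2)
      - 54 * m' ^+ 3 * (1 + 2 * m' * d ^+ 2) = 8 * P6 ->
  - 6 * m' ^+ 2 * A' * D' * a * b - 2 * r * s * D' ^+ 2 * b * (4 * a ^+ 2 + C)
      - 108 * m' ^+ 3 * d = 8 * Q6 ->
  good_reduction_at m
    (twist (4 * A') (2 * D') (8 * s) (r%:~R * ((2 * a)%:~R + b%:~R * sq m))) (pl v).
Proof.
move=> C Em p2 E nD nm nb hr h4 k4 h6 k6.
have [|t0 [Enu Eom]] := om_mod4_neq1 m; first by rewrite Em; clear; lia.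
have rv : ram v by rewrite /ram p2 t0 Enu; apply/dvdzP; exists (2 * m); ring.
have OZ (x y : int) : O (x%:~R + y%:~R * sq m) by rewrite -Eom; exact: inO_mk.
have Um : unitL v m'%:~R by apply: unit_int; rewrite p2.
have mC := unit_neq0 Um; have Lm := unit_LV Um.
have U3 : unitL v 3 by apply: (@unit_int _ v 3); rewrite p2.
have L3 : inL v 3^-1 by exact: unit_LV.
have sC : sq m ^+ 2 = 2 * m'%:~R :> algC by rewrite sq2 {1}Em intrM.
have sq0 : sq m != 0.
  by apply/eqP => h; have := sC; rewrite h expr0n => /esym/eqP; rewrite mulf_eq0 pnatr_eq0 (negbTE mC).
have rC : (r%:~R : algC) ^+ 2 = 1 by case: hr => ->; ring.
have Ur : unitL v r%:~R by exact: unit_sign hr.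
pose c := C%:~R + (2 * a * b)%:~R * sq m.
have Uc : unitL v c.
  apply: unit_O; first exact: OZ.
  move/(M_P); move/(ram2_M F p2 rv) => h; case/negP: nb.
  have h2 : (2 %| C ^+ 2)%Z.
    have -> : C ^+ 2 = (C ^+ 2 - m * (2 * a * b) ^+ 2) + 2 * (m' * (2 * a * b) ^+ 2).
      by rewrite Em; ring.
    by apply: rpredD => //; exact: dvdz_mulr.
  have : (2 %| C - 2 * a ^+ 2)%Z.
    by apply: rpredB; [exact: (@prime_dvdzX 2 C 2 isT h2) | exact: dvdz_mulr].
  have -> : C - 2 * a ^+ 2 = m' * b ^+ 2 by rewrite /C; ring.
  by rewrite (@prime_dvdzM 2) // (negbTE nm) /=; exact: (@prime_dvdzX 2 b 2 isT).
pose w := (2 * a)%:~R + b%:~R * sq m.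
have wc : w ^+ 2 = 2 * c by rewrite /w /c /C; ring: sC.
pose w' := r%:~R * w / (2 * m'%:~R).
have n2 : (2 : algC) != 0 by rewrite pnatr_eq0.
have w'E : (2 * m'%:~R) * w' = r%:~R * w by rewrite /w' mulrC divfK // mulf_neq0.
have Ud : (2 * D')%:~R * w' ^+ 2 = D'%:~R * c / m'%:~R ^+ 2.
  rewrite /w' !exprMn exprVn rC wc; field.
  by rewrite mC.
pose x4 := (P4%:~R + Q4%:~R * sq m) * (3^-1 * (m'%:~R)^-1 ^+ 2).
pose x6 := (P6%:~R + Q6%:~R * sq m) * (3^-1 ^+ 3 * (m'%:~R)^-1 ^+ 3).
have e4 : 12 * m'%:~R ^+ 2 * x4
   = (4 * P4)%:~R + (4 * Q4)%:~R * sq m by rewrite /x4; field.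
have e6 : 216 * m'%:~R ^+ 3 * x6
   = (8 * P6)%:~R + (8 * Q6)%:~R * sq m by rewrite /x6; field.
rewrite -h4 -k4 in e4; rewrite -h6 -k6 in e6.
pose E' := WCurve (sq m) 0 (1 + d%:~R * sq m) x4 x6.
have cE4 : c4 E' = (4 * A')%:~R * (2 * D')%:~R * w' ^+ 2.
  rewrite -mulrA Ud; apply: (mulIf (expf_neq0 2 mC)).
  transitivity (4 * A'%:~R * D'%:~R * c); last by field.
  rewrite /c4 /b2 /b4 /=.
  transitivity (m'%:~R ^+ 2 * (sq m ^+ 2) ^+ 2 - 4 * (12 * m'%:~R ^+ 2 * x4)
    - 24 * m'%:~R ^+ 2 * (sq m + d%:~R * sq m ^+ 2)); first by ring.
  by rewrite e4 /c; ring: sC.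
have cE6 : c6 E' = (8 * s)%:~R * (2 * D')%:~R ^+ 2 * w' ^+ 3.
  have r3 : w' ^+ 3 = r%:~R * (c * w) / (4 * m'%:~R ^+ 3).
    apply: (@mulfI _ ((2 * m'%:~R) ^+ 3)); first by rewrite expf_neq0 // mulf_neq0.
    transitivity (((2 * m'%:~R) * w') ^+ 3); first by ring.
    rewrite w'E; transitivity (r%:~R ^+ 2 * r%:~R * (w ^+ 2 * w)); first by ring.
    by rewrite rC wc; field.
  rewrite r3; apply: (mulIf (expf_neq0 3 mC)).
  transitivity (8 * s%:~R * D'%:~R ^+ 2 * r%:~R * (c * w)); last by field.
  rewrite /c6 /b2 /b4 /b6 /=.
  transitivity (- m'%:~R ^+ 3 * (sq m ^+ 2) ^+ 3
    + 6 * m'%:~R * sq m ^+ 2 * (12 * m'%:~R ^+ 2 * x4)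
    + 36 * m'%:~R ^+ 3 * sq m ^+ 2 * (sq m + d%:~R * sq m ^+ 2)
    - 216 * m'%:~R ^+ 3 * (1 + 2 * d%:~R * sq m + d%:~R ^+ 2 * sq m ^+ 2)
    - 4 * (216 * m'%:~R ^+ 3 * x6)); first by ring.
  by rewrite e4 e6 /c /w /C; ring: sC.
apply: (@good_at _ v (4 * A') (2 * D') (8 * s) _ (sq m) w' E' E) => //.
- exact: inK_sq.
- by rewrite sC w'E.
- have LZ (x y : int) : inL v (x%:~R + y%:~R * sq m) by exact/L_O/OZ.
  split=> /=.
  + by have := LZ 0 1; rewrite add0r mul1r.
  + exact: L0.
  + by have := LZ 1 d.
  + by apply: LM => //; apply: LM => //; exact: LX.
  + by apply: LM => //; apply: LM; exact: LX.
by rewrite Ud; apply: unit_div; [apply: unitM => //; apply: unit_int; rewrite p2 | exact: unitX].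
Qed.

Lemma backward (D q : int) : good D -> m = q * D ->
  (forall p : nat, prime p -> odd p -> (p %| `|D|)%N -> legendre (- eps D * q) p = 1) ->
  (forall l : nat, prime l -> odd l -> (l %| `|q|)%N -> legendre (eps D * D) l = 1) ->
  (eps D * D < 0 -> 0 < m) ->
  ((D %% 8)%Z = 3 \/ (D %% 8)%Z = 5 -> (q %% 4)%Z = (D %% 4)%Z) ->
  ((2 %| D)%Z -> (q %% 8)%Z = ((D + 1) %% 8)%Z) ->
  exists E : wcurve, elliptic_over m E /\ rational_j E /\ everywhere_good m E.
Proof.
move=> [sD [A [t [RA E]]]] Em ca cb cc cd ce.
have he : eps D = 1 \/ eps D = -1 by rewrite /eps; case: ifP; [left|right].
have [a [b [z [w0 N cop]]]] := primitive_norm F sD Em he ca cb cc.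
have [D0 sD'] := sD; have DC : (D%:~R : algC) != 0 by rewrite intr_eq0.
(* Only the primes above 2 remain: the odd ones are handled by [scaled_odd], whatever admissible [r]
   is chosen. *)
suff [r [hr h2]] : exists r, sign_or_double r /\ forall v, pl_p v = 2%N ->
    good_reduction_at m (twist A D t (r%:~R * (a%:~R + b%:~R * om))) (pl v).
  pose w := r%:~R * (a%:~R + b%:~R * om).
  have rC : (r%:~R : algC) != 0.
    by rewrite intr_eq0; case: hr => s [] [] -> [] ->.
  have ww0 : w != 0 by rewrite mulf_neq0.
  have Kw : K w by apply: inKM; [exact: inK_int | exact/inO_K/inO_mk].
  have Ed : disc (twist A D t w) = (D%:~R * w ^+ 2) ^+ 3.
    by apply: disc_of_covariants E _ _; [exact: c4_short | exact: c6_short].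
  exists (twist A D t w); split.
    split; last by rewrite Ed expf_neq0 // mulf_neq0 // expf_neq0.
    have kn n : K n%:R by exact: inK_nat.
    have ki n : K n%:~R by exact: inK_int.
    split=> /=; try exact: inK0.
      by apply: inK_div => //; apply: inKN; do !apply: inKM => //; exact: inKX.
    by apply: inK_div => //; apply: inKN; do !apply: inKM => //; exact: inKX.
  split.
    exists (A ^+ 3)%:~R; rewrite c4_short Ed ratr_int; ring.
  move=> P /(prime_ideal_place F)[v <-].
  have [p2|p2] := eqVneq (pl_p v) 2%N; first exact: h2.
  apply: (good_at_odd E sD RA p2 hr); exact: (scaled_odd F p2 sD Em he w0 N cop).
have [nD|bD] := orP (orNb (2 %| D)%Z).
  have e4 : (4 %| eps D * D - 1)%Z.
    by rewrite /eps; case: eqP => h; move: nD; clear -h; lia.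
  (* [s] is the sign that [good_at_two_odd] prescribes for [w] modulo 4, up to squares. *)
  have [s [k [hs hA]]] : exists s k, (s = 1 \/ s = -1) /\
     ((~~ (2 %| A)%Z /\ - t * D * A = s + 4 * k) \/
     (exists a t', [/\ A = 16 * a, t = 8 * t' & - t' * D ^+ 2 * 27 = s + 4 * k])).
    have [A2|nA] := orP (orbN (2 %| A)%Z).
      have /dvdzP[a' Ea] : (16 %| A)%Z.
        case: (RA.1 A2) => // h4; have t0 : t != 0.
          by apply: contraNneq (inR_cube_neq RA) => t0; rewrite -E t0 expr0n mulr0.
        have [_ par] := good_parity sD t0 E; have [j Ej] := dvdzP h4.
        case/negP: nD; apply: (par (4 * j + 1)); last by clear; lia.
        by rewrite -[A](subrK 4) Ej; ring.
      rewrite mulrC in Ea.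
      have /dvdzP[t' Et] : (8 %| t)%Z.
        by apply: (odd_dvd8 (n := 64 * a' ^+ 3 - 27) nD); rewrite E Ea; ring.
      rewrite mulrC in Et.
      have nt : ~~ (2 %| t')%Z.
        apply/negP => /dvdzP[x Ex].
        have : 64 * (4 * (D * x ^+ 2) - 64 * a' ^+ 3 + 27) = 0.
          by transitivity (D * t ^+ 2 - (A ^+ 3 - 1728)); [rewrite Et Ex Ea | rewrite E]; ring.
        by move: (D * x ^+ 2) (a' ^+ 3) => u u'; clear; lia.
      have nn : ~~ (2 %| - t' * D ^+ 2 * 27)%Z.
        rewrite (@prime_dvdzM 2) // (@prime_dvdzM 2) // rpredN (negbTE nt) orbF /=.
        by apply: contra nD; exact: (@prime_dvdzX 2 D 2 isT).
      have [s [k [hs Ek]]] := odd_mod4 nn.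
      by exists s, k; split=> //; right; exists a', t'.
    have nt : ~~ (2 %| t)%Z.
      apply/negP => /dvdzP[x Ex]; case/negP: nA; apply: (@prime_dvdzX 2 A 3) => //.
      have -> : A ^+ 3 = D * t ^+ 2 + 2 * 864 by rewrite E; ring.
      rewrite Ex; have -> : D * (x * 2) ^+ 2 + 2 * 864 = 2 * (2 * (D * x ^+ 2) + 864) by ring.
      exact: dvdz_mulr.
    have nn : ~~ (2 %| - t * D * A)%Z.
      by rewrite (@prime_dvdzM 2) // (@prime_dvdzM 2) // rpredN (negbTE nt) (negbTE nD).
    have [s [k [hs Ek]]] := odd_mod4 nn.
    by exists s, k; split=> //; left.
  have fin r : sign_or_double r -> (forall v, pl_p v = 2%N ->
      square_class v (r%:~R * (a%:~R + b%:~R * om)) s) ->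
    exists r, sign_or_double r /\ forall v, pl_p v = 2%N ->
      good_reduction_at m (twist A D t (r%:~R * (a%:~R + b%:~R * om))) (pl v).
    move=> hr h; exists r; split=> // v p2.
    by apply: (good_at_two_odd E p2 nD hs hA); exact: h.
  have [m1|m1] := eqVneq (m %% 4)%Z 1.
    by have [r [hr h]] := square_class_unram F m1 nD e4 he hs w0 N cop; exact: fin hr h.
  (* Condition (d) enters here: [D = 3] or [5] modulo 8 would give [m = q D = D^2 = 1] modulo 4. *)
  have e8 : (8 %| eps D * D - 1)%Z.
    have nd35 : ~ ((D %% 8)%Z = 3 \/ (D %% 8)%Z = 5).
      move=> h; have q4 := cd h; case/eqP: m1; rewrite Em.
      have [x [y [i [hi [-> ->]]]]] : exists x y i, (i = 1 \/ i = 3) /\ q = 4 * x + i /\ D = 4 * y + i.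
        exists (q %/ 4)%Z, (D %/ 4)%Z, (D %% 4)%Z; clear -h q4; lia.
      have -> : (4 * x + i) * (4 * y + i) = 4 * (4 * x * y + x * i + y * i) + i ^+ 2 by ring.
      by move: (4 * x * y + _ + _) => X; case: hi => ->; clear; lia.
    by rewrite /eps; case: eqP => h; clear -h nd35 nD; lia.
  have m1' : (m %% 4)%Z <> 1 by exact/eqP.
  by have [r [hr h]] := square_class_ram F m1' e8 hs N cop; exact: fin hr h.
have q8 := ce bD; have /dvdzP[D' ED] := bD; rewrite mulrC in ED.
have nD : ~~ (2 %| D')%Z.
  apply/negP => /dvdzP[x Ex]; have E4 : D = 2 ^+ 2 * x by rewrite ED Ex; ring.
  by have := squarefree_sqr sD E4.
have [Dx EDx] := odd_sqr nD.
pose m' := q * D'.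
have Em' : m = 2 * m' by rewrite Em ED /m'; ring.
have [j Ej] : exists j, q = D + 1 + 8 * j.
  by exists ((q - (D + 1)) %/ 8)%Z; clear -q8; lia.
(* Condition (e) multiplied by [D'], whose square is 1 modulo 8. *)
have hm8 : (8 %| m' - D' - 2)%Z.
  apply/dvdzP; exists (2 * Dx + j * D').
  transitivity (2 * D' ^+ 2 + 8 * j * D' - 2); first by rewrite /m' Ej ED; ring.
  by rewrite EDx; ring.
have nm : ~~ (2 %| m')%Z.
  by rewrite /m' (@prime_dvdzM 2) // (negbTE nD) orbF Ej ED; clear; lia.
have [|t0 [Enu Eom]] := om_mod4_neq1 m; first by rewrite Em'; clear; lia.
have e1 : eps D = -1 by rewrite /eps; case: eqP => // h; exfalso; clear -h bD; lia.
have A2 : (2 %| A)%Z.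
  apply: (@prime_dvdzX 2 A 3) => //.
  have -> : A ^+ 3 = 2 * (D' * t ^+ 2 + 864) by transitivity (D * t ^+ 2 + 1728); [rewrite E | rewrite ED]; ring.
  exact: dvdz_mulr.
have tn0 : t != 0 by apply: contraNneq (inR_cube_neq RA) => t0'; rewrite -E t0' expr0n mulr0.
have [par _] := good_parity sD tn0 E.
have h16 : (16 %| A - 4)%Z.
  by case: (RA.1 A2) => // h; case/negP: (par (or_intror h)).
have [A' [EA hA']] : exists A', A = 4 * A' /\ (A' %% 4)%Z = 1.
  by exists (A %/ 4)%Z; clear -h16; lia.
have [al Eal] : exists al, A' = 4 * al + 1 by exists (A' %/ 4)%Z; clear -hA'; lia.
pose F0 := 32 * al ^+ 3 + 24 * al ^+ 2 + 6 * al - 13.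
have EF0 : D' * t ^+ 2 = 64 * F0.
  have n2 : (2 : int) != 0 by [].
  apply: (mulfI n2); transitivity (D * t ^+ 2); first by rewrite ED; ring.
  by rewrite E EA Eal /F0; ring.
have /dvdzP[s Es] := odd_dvd8 nD EF0; rewrite mulrC in Es.
have ns : ~~ (2 %| s)%Z.
  apply/negP => /dvdzP[x Ex].
  have : 64 * (4 * (D' * x ^+ 2) - F0) = 0.
    by transitivity (D' * t ^+ 2 - 64 * F0); [rewrite Es Ex | rewrite EF0]; ring.
  by rewrite /F0; move: (D' * x ^+ 2) (al ^+ 3) (al ^+ 2) => u u' u2; clear; lia.
have N2 : a ^+ 2 - 2 * m' * b ^+ 2 = - (2 * D') * z ^+ 2.
  by rewrite -ED -Em'; transitivity (a ^+ 2 + tau * a * b + nu * b ^+ 2); [rewrite t0 Enu | rewrite N e1];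
    ring.
have /dvdzP[a' Ea] : (2 %| a)%Z.
  apply: (@prime_dvdzX 2 a 2) => //.
  have -> : a ^+ 2 = 2 * (m' * b ^+ 2 - D' * z ^+ 2).
    by transitivity (a ^+ 2 - 2 * m' * b ^+ 2 + 2 * m' * b ^+ 2); [|rewrite N2]; ring.
  exact: dvdz_mulr.
rewrite mulrC in Ea.
have nb : ~~ (2 %| b)%Z by apply/negP => h; apply: (cop 2%N isT _ h); rewrite Ea dvdz_mulr.
have [xb Exb] := odd_sqr nb.
(* The halved norm equation: with [b] and [m'] odd it makes [z] odd, and modulo 8, with
   [m' = D' + 2], it makes [a'] odd. *)
have N3 : 2 * a' ^+ 2 - m' * b ^+ 2 = - D' * z ^+ 2.
  have n2 : (2 : int) != 0 by [].
  by apply: (mulfI n2); transitivity (a ^+ 2 - 2 * m' * b ^+ 2); [rewrite Ea | rewrite N2]; ring.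
have nz : ~~ (2 %| z)%Z.
  apply/negP => /dvdzP[x Ex]; case/negP: nm; apply/dvdzP.
  exists (a' ^+ 2 - m' * (4 * xb) + 2 * (D' * x ^+ 2)).
  have h : m' = 2 * a' ^+ 2 - 8 * m' * xb + D' * z ^+ 2.
    transitivity (2 * a' ^+ 2 - (2 * a' ^+ 2 - m' * b ^+ 2) - 8 * m' * xb).
      by rewrite Exb; ring.
    by rewrite N3; ring.
  by rewrite {1}h Ex; ring.
have [xz Exz] := odd_sqr nz.
have na : ~~ (2 %| a')%Z.
  apply/negP => /dvdzP[x Ex]; have /dvdzP[l El] := hm8.
  move: N3; rewrite Ex Exb Exz.
  have -> : m' = D' + 2 + 8 * l by transitivity ((m' - D' - 2) + D' + 2); [|rewrite El]; ring.
  by clear; lia.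
have [r [d [P4 [Q4 [P6 [Q6 [hr h4 k4 h6 k6]]]]]]] := even_model_int hA' nD nm ns na nb hm8.
exists r; split; first by exists r; split=> //; left.
move=> v p2; rewrite EA ED Es Eom Ea.
have E' : 2 * D' * (8 * s) ^+ 2 = (4 * A') ^+ 3 - 1728 by rewrite -ED -Es -EA.
exact: (good_at_two_even Em' p2 E' nD nm nb hr h4 k4 h6 k6).
Qed.

End EvenD.

Unset Implicit Arguments.

Theorem theorem2p3 (m : int) (hsq : squarefree m) (hm0 : m != 0) (hm1 : m != 1) :
  (exists E : wcurve, elliptic_over m E /\ rational_j E /\ everywhere_good m E) <->
  (exists D q : int,
     good D /\ m = q * D /\ [/\
         (forall p : nat, prime p -> odd p -> (p %| `|D|)%N -> legendre (- eps D * q) p = 1),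
         (forall l : nat, prime l -> odd l -> (l %| `|q|)%N -> legendre (eps D * D) l = 1),
         (eps D * D < 0 -> 0 < m),
         ((D %% 8)%Z = 3 \/ (D %% 8)%Z = 5 -> (q %% 4)%Z = (D %% 4)%Z) &
         ((2 %| D)%Z -> (q %% 8)%Z = ((D + 1) %% 8)%Z)]).
Proof.
have [F _] := quadfield_exists hsq hm1; split.
  by move=> [E [el [rj eg]]]; exact: (forward F el rj eg).
by move=> [D [q [gD [Em [ca cb cc cd ce]]]]]; exact: (backward F gD Em ca cb cc cd ce).
Qed.
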